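(* Let $p\ge1$, $\delta\in(0,\infty)$, $c,\tilde c\in(0,1]$, let $\theta\in\mathbb R^p$ be deterministic and let $\Sigma\in\mathbb R^{p\times p}$ be symmetric positive definite. Let $(\alpha,\beta,\kappa,\nu)\in\mathbb R_{>0}^4$ be a solution of System A$'(\ell,\phi,c\delta,\theta,\Sigma)$ and $(\tilde\alpha,\tilde\beta,\tilde\kappa,\tilde\nu)\in\mathbb R_{>0}^4$ a solution of System A$'(\tilde\ell,\tilde\phi,\tilde c\delta,\theta,\Sigma)$. Then the functions $F_\ell,F_\phi:[-1,1]\to\mathbb R$ defined in the context satisfy: 1. $|F_\ell(\eta_G)|\le\sqrt{c\tilde c}$ and $|F_\phi(\eta_H)|\le1$ for all $\eta_G\in[-1,1]$ and $\eta_H\in[-1,1]$. 2. $F_\ell$ and $F_\phi$ are non-decreasing and differentiable, and the compositions $F_\ell\circ F_\phi$ and $F_\phi\circ F_\ell$ are $\min\{c,\tilde c\}$-Lipschitz. 3. The system $\eta_G=F_\phi(\eta_H)$, $\eta_H=F_\ell(\eta_G)$ in the variables $(\eta_G,\eta_H)\in[-1,1]^2$ admits a unique solution $(\eta_G^\star,\eta_H^\star)$, and $(\eta_G^\star,\eta_H^\star)\in[-1,1]\times[-\sqrt{c\tilde c},\sqrt{c\tilde c}]$.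
   Context: $F_z$ is a probability distribution on $\mathbb R$; $\ell,\tilde\ell:\mathbb R\to\mathbb R$ are convex losses; $\phi,\tilde\phi:\mathbb R^p\to\mathbb R\cup\{+\infty\}$ are proper, lower semicontinuous, convex (possibly non-separable) regularizers. For convex $f:\mathbb R\to\mathbb R$, $\tau>0$: $\mathrm{env}_f(x;\tau)=\min_{y\in\mathbb R}\{f(y)+\frac1{2\tau}(x-y)^2\}$ and $\mathrm{env}_f'(x;\tau)=\frac{\partial}{\partial x}\mathrm{env}_f(x;\tau)$. For $v\in\mathbb R^p$ and a symmetric positive definite $\Lambda\in\mathbb R^{p\times p}$: $\mathrm{env}_\phi(v;\Lambda)=\min_{x\in\mathbb R^p}\{\frac12(v-x)^\top\Lambda^{-1}(v-x)+\phi(x)\}$, with unique minimizer $\mathrm{prox}_\phi(v;\Lambda)$, and $\nabla\mathrm{env}_\phi(v;\Lambda)=\Lambda^{-1}(v-\mathrm{prox}_\phi(v;\Lambda))$ is its gradient with respect to $v$. System A$'(\ell,\phi,c\delta,\theta,\Sigma)$, in $(\alpha,\beta,\kappa,\nu)\in\mathbb R_{>0}^4$: $$\alpha^2=\tfrac1p\mathbb E\Big[\big\|\tfrac{\Sigma^{-1/2}}{\nu}\nabla\mathrm{env}_\phi(\theta+\tfrac\beta\nu\Sigma^{-1/2}h;\tfrac{\Sigma^{-1}}\nu)-\tfrac\beta\nu h\big\|_2^2\Big],\qquad \beta^2=c\delta\,\mathbb E[\mathrm{env}_\ell'(Z+\alpha G;\kappa)^2],$$ $$\kappa\beta=\tfrac1p\mathbb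 E\Big[\big(\tfrac{\Sigma^{-1/2}}{\nu}\nabla\mathrm{env}_\phi(\theta+\tfrac\beta\nu\Sigma^{-1/2}h;\tfrac{\Sigma^{-1}}\nu)-\tfrac\beta\nu h\big)^\top(-h)\Big],\qquad \nu\alpha=c\delta\,\mathbb E[\mathrm{env}_\ell'(Z+\alpha G;\kappa)\,G],$$ where $h\sim N(0_p,I_p)$, $G\sim N(0,1)$, $Z\sim F_z$ are mutually independent. The functions $F_\ell,F_\phi:[-1,1]\to\mathbb R$ are $$F_\ell(\eta_G)=\frac{\delta c\tilde c}{\beta\tilde\beta}\,\mathbb E\big[\mathrm{env}_\ell'(Z+\alpha G;\kappa)\,\mathrm{env}_{\tilde\ell}'(Z+\tilde\alpha\tilde G;\tilde\kappa)\big],$$ $$F_\phi(\eta_H)=\frac1{\alpha\tilde\alpha}\frac1p\,\mathbb E\Big[\big(\tfrac{\Sigma^{-1/2}}{\nu}\nabla\mathrm{env}_\phi(\theta+\tfrac\beta\nu\Sigma^{-1/2}h;\tfrac{\Sigma^{-1}}\nu)-\tfrac\beta\nu h\big)^\top\big(\tfrac{\Sigma^{-1/2}}{\tilde\nu}\nabla\mathrm{env}_{\tilde\phi}(\theta+\tfrac{\tilde\beta}{\tilde\nu}\Sigma^{-1/2}\tilde h;\tfrac{\Sigma^{-1}}{\tilde\nu})-\tfrac{\tilde\beta}{\tilde\nu}\tilde h\big)\Big],$$ where the pairs $(h_j,\tilde h_j)$, $j\in[p]$, are i.i.d. centered bivariate Gaussian with unit variances and correlation $\eta_H$, $(G,\tilde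 G)$ is centered bivariate Gaussian with unit variances and correlation $\eta_G$, $Z\sim F_z$, and $(h,\tilde h)$, $(G,\tilde G)$, $Z$ are mutually independent. *)

(* Defs.v *)
From HB Require Import structures.
From mathcomp Require Export all_boot all_order all_algebra.
From mathcomp Require Export all_classical all_reals all_analysis.
From mathcomp Require Export measurable_realfun.

Set Implicit Arguments.
Unset Strict Implicit.
Unset Printing Implicit Defensive.

Export Order.TTheory GRing.Theory Num.Theory.
Export numFieldNormedType.Exports.

#[export] Set Implicit Arguments.
#[export] Unset Strict Implicit.
#[export] Unset Printing Implicit Defensive.

Global Open Scope classical_set_scope.
Global Open Scope ring_scope.

Section laws.
Context (R : realType).

Section iid.
Context d (T : measurableType d).

Definition tuple_cons n (w : T * n.-tuple T) : n.+1.-tuple T :=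
  [the n.+1.-tuple T of w.1 :: w.2].

Lemma measurable_tuple_cons n : measurable_fun setT (@tuple_cons n).
Proof. exact: measurable_cons. Qed.

HB.instance Definition _ n :=
  isMeasurableFun.Build _ _ _ _ (@tuple_cons n) (@measurable_tuple_cons n).

(* The n-fold product of P, i.e. the joint law of n i.i.d. samples of P. *)
Fixpoint iid_law (P : probability T R) n : probability (n.-tuple T) R :=
  match n with
  | 0 => dirac ([tuple] : 0.-tuple T)
  | n'.+1 => distribution (P \x iid_law P n')%E (@tuple_cons n')
  end.

End iid.

Definition std_normal : probability (measurableTypeR R) R := normal_prob 0 1.

Definition correlate (eta : R) (w : measurableTypeR R * measurableTypeR R) :
    measurableTypeR R * measurableTypeR R :=
  (w.1, eta * w.1 + Num.sqrt (1 - eta ^+ 2) * w.2).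

Lemma measurable_correlate eta : measurable_fun setT (correlate eta).
Proof.
apply/measurable_fun_pair => //=.
by apply: measurable_funD; exact: measurable_funM.
Qed.

HB.instance Definition _ eta :=
  isMeasurableFun.Build _ _ _ _ (correlate eta) (measurable_correlate eta).

(* For |eta| <= 1, the centered Gaussian law on R^2 with unit variances and
   correlation eta: the law of (X, eta X + sqrt(1 - eta^2) Y) for X, Y
   independent N(0, 1).  It is degenerate, as it should be, for |eta| = 1. *)
Definition binormal (eta : R) :
    probability (measurableTypeR R * measurableTypeR R)%type R :=
  distribution (std_normal \x std_normal)%E (correlate eta).

End laws.
Arguments std_normal {R}.

Section linear_algebra.
Context (R : realType) (p : nat).
Implicit Types (u v : 'cV[R]_p) (A : 'M[R]_p).

Definition dotv u v : R := (u^T *m v) 0 0.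

Definition posdefmx A := A^T = A /\ forall v, v != 0 -> 0 < dotv v (A *m v).

(* The positive definite square root of a positive definite matrix (which
   exists and is unique). *)
Definition sqrtmx A : 'M[R]_p :=
  xget 0 [set S : 'M[R]_p | posdefmx S /\ S *m S = A].

Definition gradient (f : 'cV[R]_p -> R) v : 'cV[R]_p :=
  \col_i 'D_(delta_mx i 0) f v.

End linear_algebra.

Section envelopes.
Context (R : realType).

Definition env (f : R -> R) (x tau : R) : R :=
  inf (range (fun y : R => f y + (2 * tau)^-1 * (x - y) ^+ 2)).

Definition env' (f : R -> R) (x tau : R) : R :=
  derive1 (fun t : R => env f t tau) x.

Context (p : nat).
Implicit Types (phi : 'cV[R]_p -> \bar R) (v : 'cV[R]_p) (Lambda : 'M[R]_p).

Definition proper_efun phi :=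
  (forall x, phi x != -oo%E) /\ (exists x, phi x != +oo%E).

Definition econvex phi := forall x y (t : R), 0 <= t <= 1 ->
  (phi (t *: x + (1 - t) *: y)%R <= t%:E * phi x + (1 - t)%:E * phi y)%E.

Definition regularizer phi :=
  [/\ proper_efun phi, lower_semicontinuous phi & econvex phi].

Definition menv phi v Lambda : \bar R :=
  ereal_inf (range (fun x : 'cV[R]_p =>
    ((2^-1 * dotv (v - x) (invmx Lambda *m (v - x)))%:E + phi x)%E)).

(* menv phi is finite everywhere when phi is proper, lsc and convex and Lambda
   is positive definite, so fine loses no information. *)
Definition grad_menv phi v Lambda : 'cV[R]_p :=
  gradient (fun u => fine (menv phi u Lambda)) v.

End envelopes.

Section system.
Context (R : realType) (Fz : probability (measurableTypeR R) R) (p : nat).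
Implicit Types (ell ellt : R -> R) (phi phit : 'cV[R]_p -> \bar R).
Implicit Types (theta h : 'cV[R]_p) (Sigma : 'M[R]_p).

Definition residual phi theta Sigma (beta nu : R) h : 'cV[R]_p :=
  let isqrt := invmx (sqrtmx Sigma) in
  nu^-1 *: (isqrt *m grad_menv phi (theta + (beta / nu) *: (isqrt *m h))
                               (nu^-1 *: invmx Sigma))
  - (beta / nu) *: h.

Definition colt (t : p.-tuple (measurableTypeR R)) : 'cV[R]_p :=
  \col_j tnth t j.

(* h ~ iid_law std_normal p and (Z, G) ~ Fz \x std_normal.  The expectations
   take values in \bar R, so that the equations entail that the (nonnegative)
   second moments are finite. *)
Definition systemA ell phi (gamma : R) theta Sigma
    (alpha beta kappa nu : R) : Prop :=
  let r := residual phi theta Sigma beta nu in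
  [/\ [/\ 0 < alpha, 0 < beta, 0 < kappa & 0 < nu],
   ((alpha ^+ 2)%:E = (p%:R^-1)%:E *
      'E_(iid_law std_normal p)[(fun t => dotv (r (colt t)) (r (colt t)))%R])%E,
   ((beta ^+ 2)%:E = gamma%:E *
      'E_(Fz \x std_normal)[(fun w =>
        env' ell (w.1 + alpha * w.2) kappa ^+ 2)%R])%E,
   ((kappa * beta)%:E = (p%:R^-1)%:E *
      'E_(iid_law std_normal p)[(fun t => dotv (r (colt t)) (- colt t))%R])%E &
   ((nu * alpha)%:E = gamma%:E *
      'E_(Fz \x std_normal)[(fun w =>
        env' ell (w.1 + alpha * w.2) kappa * w.2)%R])%E].

Definition Fl ell ellt (delta c ct alpha beta kappa alphat betat kappat : R)
    (eta : R) : R :=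
  delta * c * ct / (beta * betat) *
  fine ('E_(Fz \x binormal eta)[(fun w =>
    env' ell (w.1 + alpha * w.2.1) kappa *
    env' ellt (w.1 + alphat * w.2.2) kappat)%R])%E.

Definition Fphi phi phit theta Sigma
    (alpha beta nu alphat betat nut : R) (eta : R) : R :=
  (alpha * alphat)^-1 * p%:R^-1 *
  fine ('E_(iid_law (binormal eta) p)[(fun t =>
    dotv (residual phi theta Sigma beta nu (\col_j (tnth t j).1))
         (residual phit theta Sigma betat nut (\col_j (tnth t j).2)))%R])%E.

End system.

(* Differentiability of the restriction of f to A, one-sided at the end points
   when A is a compact interval. *)
Definition derivable_within (R : realType) (A : set R) (f : R -> R) :=
  forall x, A x -> cvg ((f y - f x) / (y - x) @[y --> within A x^']).

(* Main.v *)
From HB Require Import structures.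
Require Import Defs.
From mathcomp Require Import ring lra.

(* For standard Gaussian vectors h, h' with correlation eta and Lipschitz maps f, g,
   put corr f g eta = E[f(h) g(h')].  With h' = eta h + sqrt(1 - eta^2) k, the
   semigroup identity corr f g (a b) = E[T_a f T_b g] and invariance under plane
   rotations give corr f g eta - corr f g (r eta) as half the expected product of
   increments of T_sqrt(eta) f and T_sqrt(eta) g, whence Lipschitz continuity and
   differentiability.  The derivative at eta is eta^-1 times the expectation of the
   trace of the product of the Jacobians of T_sqrt(eta) f and T_sqrt(eta) g; when f
   and g are gradients of convex functions both are positive semidefinite, so the
   correlation is nondecreasing.

   env' ell is the derivative of a smooth convex function, and so is x / kappa - env' ell;
   likewise for minus the residual r and (beta / nu) h + r.  Applying monotonicity to the
   complementary map of one factor bounds the slope of the correlation by the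
   correlation of the identity with the other factor, which is linear in eta and
   whose slope the system of equations gives.  This produces two Lipschitz constants
   for each of F_l, F_phi, whose cross products are c and ct.  The slope bound
   for F_l is strict because neither env' ell nor its complement is constant, so the
   fixed point, which exists by monotonicity, is unique even if c = ct = 1. *)

(** * Gaussian measure on the line *)

Section gaussian_line.
Context {R : realType}.
Local Notation mu := (@lebesgue_measure R).
Local Notation RM := (measurableTypeR R).

(** Neither [env'] nor the residual need be differentiable, so the Jacobians exist only after
    smoothing by [OU] with parameter sqrt(eta) < 1, and the bounds so obtained blow up as eta tends
    to 1. The points 0, 1 and -1 therefore need arguments of their own: at 0 the slope is the inner
    product of the first Hermite coefficients, at 1 it comes from convexity of [corr w w] in log eta
    together with polarization, and changing the sign of one argument carries everything over to
    negative eta. In R^p the correlations of single coordinates need not be monotone: a product of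
    two positive semidefinite matrices can have negative diagonal entries, and only its trace is
    nonnegative. The law [Fz] may have no moments, so integrability over the noise never comes from
    Lipschitz growth but from the second moments that the system makes finite. Gaussian integrals,
    by contrast, are taken over functions of exponential growth, a class stable under all operations
    used and containing the Cameron-Martin densities. *)

Lemma integral_std_normal (f : RM -> \bar R) :
  measurable_fun setT f -> (forall x, 0 <= f x)%E ->
  (\int[std_normal]_x f x = \int[mu]_x (f x * (normal_pdf 0 1 x)%:E))%E.
Proof.
move=> mf f0.
have dom : (std_normal : {finite_measure set RM -> \bar R}) `<< mu.
  exact: normal_prob_dominates.
have mpdf : measurable_fun setT (fun x : RM => (normal_pdf 0 1 x)%:E).
  by apply/measurable_EFinP; exact: measurable_normal_pdf.
rewrite -(Radon_Nikodym_SigmaFinite.change_of_variables dom)//.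
set g := Radon_Nikodym_SigmaFinite.f _ _.
have gi : mu.-integrable setT g by exact: Radon_Nikodym_SigmaFinite.f_integrable.
apply: ae_eq_integral => //.
- by apply: emeasurable_funM => //; exact: measurable_int gi.
- exact: emeasurable_funM.
(* The Radon-Nikodym derivative and the density have the same integral over every measurable set,
   hence agree almost everywhere. *)
- apply: ae_eqe_mul2l; apply: integral_ae_eq => // E _ mE.
  by rewrite -Radon_Nikodym_SigmaFinite.f_integral.
Qed.

Lemma lebesgue_measure_shift (a : R) (A : set RM) : measurable A ->
  pushforward mu ((fun x => x + a) : RM -> RM) A = mu A.
Proof.
move=> mA; apply/esym.
have mfa : measurable_fun setT ((fun x => x + a) : RM -> RM).
  exact: measurable_funD.
pose fa := fun x : RM => (x + a : RM).
have mfa' : measurable_fun setT fa by [].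
pose ifa := isMeasurableFun.Build _ _ _ _ fa mfa'.
pose fa' : {mfun RM >-> RM} := HB.pack fa ifa.
apply: (@lebesgue_measure_unique R (pushforward mu fa')) => //= _ [[b c]] _ <-.
rewrite /pushforward /=.
rewrite (_ : _ @^-1` _ = `](b - a)%R, (c - a)%R]%classic); last first.
  by apply/seteqP; split => x /=; rewrite !in_itv/= ltrBlDr lerBrDr.
rewrite !lebesgue_measure_itv/= !lte_fin ltrD2r.
by case: ifPn => // _; rewrite -!EFinB; congr (_%:E); ring.
Qed.

Lemma integral_lebesgue_shift (a : R) (f : RM -> \bar R) :
  measurable_fun setT f -> (forall x, 0 <= f x)%E ->
  (\int[mu]_x f (x + a)%R = \int[mu]_x f x)%E.
Proof.
move=> mf f0.
have mfa : measurable_fun setT ((fun x => x + a) : RM -> RM).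
  exact: measurable_funD.
transitivity (\int[pushforward mu ((fun x => x + a)%R : RM -> RM)]_x f x)%E.
  by rewrite ge0_integral_pushforward// preimage_setT.
apply: eq_measure_integral => A mA _; exact: lebesgue_measure_shift.
Qed.

Lemma integral_lebesgueN (f : RM -> \bar R) :
  measurable_fun setT f -> (forall x, 0 <= f x)%E ->
  (\int[mu]_x f (- x)%R = \int[mu]_x f x)%E.
Proof.
move=> mf f0.
transitivity (\int[pushforward mu (-%R : RM -> RM)]_x f x)%E.
  by rewrite ge0_integral_pushforward// preimage_setT.
apply: eq_measure_integral => A mA _; exact: lebesgue_measureN.
Qed.

Section plane.
Variable Psi : RM * RM -> \bar R.
Hypotheses (mPsi : measurable_fun setT Psi) (Psi0 : forall w, (0 <= Psi w)%E).

Let msec x : measurable_fun setT (fun y => Psi (x, y)).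
Proof. exact: measurableT_comp. Qed.

Let msec' y : measurable_fun setT (fun x => Psi (x, y)).
Proof. exact: measurableT_comp. Qed.

Lemma lebesgue_shear_right a :
  (\int[mu]_x \int[mu]_y Psi (x, y + a * x)%R =
   \int[mu]_x \int[mu]_y Psi (x, y))%E.
Proof.
apply: eq_integral => x _.
exact: (integral_lebesgue_shift (a * x) (msec x) (fun y => Psi0 _)).
Qed.

Lemma lebesgue_shear_left a :
  (\int[mu]_x \int[mu]_y Psi (x + a * y, y)%R =
   \int[mu]_x \int[mu]_y Psi (x, y))%E.
Proof.
have mPsi' : measurable_fun setT (fun w : RM * RM => Psi (w.1 + a * w.2, w.2)%R).
  apply: measurableT_comp => //; apply/measurable_fun_pair => //=.
  by apply: measurable_funD => //; exact: measurable_funM.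
rewrite (fubini_tonelli (fun w : RM * RM => Psi (w.1 + a * w.2, w.2)%R) mPsi' (fun w => Psi0 _)).
rewrite (fubini_tonelli Psi mPsi Psi0); apply: eq_integral => y _.
exact: (integral_lebesgue_shift (a * y) (msec' y) (fun y => Psi0 _)).
Qed.

Lemma lebesgue_flip_right :
  (\int[mu]_x \int[mu]_y Psi (x, - y)%R =
   \int[mu]_x \int[mu]_y Psi (x, y))%E.
Proof. by apply: eq_integral => x _; exact: (integral_lebesgueN (msec x) (fun y => Psi0 _)). Qed.

Lemma lebesgue_flip_left :
  (\int[mu]_x \int[mu]_y Psi (- x, y)%R =
   \int[mu]_x \int[mu]_y Psi (x, y))%E.
Proof.
have mPsi' : measurable_fun setT (fun w : RM * RM => Psi (- w.1, w.2)%R).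
  by apply: measurableT_comp => //; apply/measurable_fun_pair => //=; exact: measurableT_comp.
rewrite (fubini_tonelli (fun w : RM * RM => Psi (- w.1, w.2)%R) mPsi' (fun w => Psi0 _)).
rewrite (fubini_tonelli Psi mPsi Psi0); apply: eq_integral => y _.
exact: (integral_lebesgueN (msec' y) (fun y => Psi0 _)).
Qed.
End plane.

(* A plane rotation is a product of three shears. *)
Lemma lebesgue_reflection (Psi : RM * RM -> \bar R) (c s : R) :
  measurable_fun setT Psi -> (forall w, (0 <= Psi w)%E) ->
  c ^+ 2 + s ^+ 2 = 1 ->
  (\int[mu]_x \int[mu]_y Psi (c * x + s * y, s * x - c * y)%R =
   \int[mu]_x \int[mu]_y Psi (x, y))%E.
Proof.
move=> mPsi Psi0 cs1.
(* For s = 0 the shear parameter below is undefined, and the map is a sign flip of one axis. *)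
have [s0|s0] := eqVneq s 0.
  have : (c - 1) * (c + 1) = 0 
    by rewrite (_ : _ * _ = c ^+ 2 + s ^+ 2 - 1 - s ^+ 2); [rewrite cs1 s0; ring|ring].
  move=> /eqP; rewrite mulf_eq0 => /orP[] /eqP c1.
    have -> : c = 1 by lra.
    rewrite -(lebesgue_flip_right mPsi Psi0); apply: eq_integral => x _.
    by apply: eq_integral => y _; rewrite s0 !mul0r mul1r addr0 add0r mul1r.
  have -> : c = -1 by lra.
  rewrite -(lebesgue_flip_left mPsi Psi0); apply: eq_integral => x _.
  by apply: eq_integral => y _; rewrite s0 !mul0r !mulN1r addr0 add0r opprK.
(* With (c, s) = (cos t, sin t) this is - tan (t / 2), the parameter of the two outer shears; the
   extra flip of y turns the rotation into the reflection. *)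
pose a := (c - 1) / s.
have mU (P : RM * RM -> \bar R) : measurable_fun setT P ->
    measurable_fun setT (fun w : RM * RM => P (w.1 + a * w.2, w.2)%R).
  move=> mP; apply: measurableT_comp => //; apply/measurable_fun_pair => //=.
  by apply: measurable_funD => //; exact: measurable_funM.
have mL (P : RM * RM -> \bar R) : measurable_fun setT P ->
    measurable_fun setT (fun w : RM * RM => P (w.1, w.2 + s * w.1)%R).
  move=> mP; apply: measurableT_comp => //; apply/measurable_fun_pair => //=.
  by apply: measurable_funD => //; exact: measurable_funM.
rewrite -(lebesgue_shear_left mPsi Psi0 a).
rewrite -(lebesgue_shear_right (mU _ mPsi) (fun w => Psi0 _) s).
rewrite -(lebesgue_shear_left (mL _ (mU _ mPsi)) (fun w => Psi0 _) a).
rewrite -(lebesgue_flip_right (mU _ (mL _ (mU _ mPsi))) (fun w => Psi0 _)).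
apply: eq_integral => x _; apply: eq_integral => y _ /=.
have sa : s * a = c - 1 by rewrite /a mulrC divfK.
have aca : a * (c + 1) = - s.
  apply: (mulfI s0); rewrite mulrA sa.
  by rewrite (_ : _ * _ = c ^+ 2 + s ^+ 2 - 1 - s ^+ 2); [rewrite cs1; ring|ring].
congr (Psi (_, _)).
- transitivity (x + s * a * x - a * (s * a + 2) * y); last by ring.
  by rewrite sa (_ : c - 1 + 2 = c + 1) ?aca; ring.
- transitivity (s * x - y - s * a * y); last by ring.
  by rewrite sa; ring.
Qed.

(** The product density depends only on x^2 + y^2. Reflections are preferred to rotations because
    they are involutions: this one exchanges x with its correlated copy c x + s y. *)
Lemma gaussian_reflection (Phi : RM * RM -> \bar R) (c s : R) :
  measurable_fun setT Phi -> (forall w, (0 <= Phi w)%E) ->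
  c ^+ 2 + s ^+ 2 = 1 ->
  (\int[std_normal]_x \int[std_normal]_y Phi (c * x + s * y, s * x - c * y)%R =
   \int[std_normal]_x \int[std_normal]_y Phi (x, y))%E.
Proof.
move=> mPhi Phi0 cs1.
pose g (w : RM * RM) : R := normal_pdf 0 1 w.1 * normal_pdf 0 1 w.2.
have mpdf : measurable_fun setT (normal_pdf 0 1 : RM -> RM).
  exact: measurable_normal_pdf.
have g0 w : 0 <= g w by rewrite mulr_ge0// normal_pdf_ge0.
have mg : measurable_fun setT (EFin \o g).
  apply/measurable_EFinP; apply: measurable_funM => //=.
    exact: (measurableT_comp mpdf).
  exact: (measurableT_comp mpdf).
have toL (P : RM * RM -> \bar R) : measurable_fun setT P ->
    (forall w, (0 <= P w)%E) ->
    (\int[std_normal]_x \int[std_normal]_y P (x, y) =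
     \int[mu]_x \int[mu]_y (P (x, y) * (g (x, y))%:E))%E.
  move=> mP P0; rewrite integral_std_normal; last 2 first.
  - exact: measurable_fun_fubini_tonelli_F.
  - by move=> x; exact: integral_ge0.
  apply: eq_integral => x _.
  rewrite integral_std_normal//; last exact: measurableT_comp.
  rewrite -ge0_integralZr//; last 3 first.
  - apply: emeasurable_funM; first exact: measurableT_comp.
    exact/measurable_EFinP.
  - by move=> y _; rewrite mule_ge0// lee_fin normal_pdf_ge0.
  - by rewrite lee_fin normal_pdf_ge0.
  by apply: eq_integral => y _; rewrite -muleA /g/= EFinM [(_ * (normal_pdf 0 1 y)%:E)%E]muleC.
have mr : measurable_fun setT
    (fun w : RM * RM => (c * w.1 + s * w.2, s * w.1 - c * w.2) : RM * RM).
  apply/measurable_fun_pair => /=.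
    by apply: measurable_funD; exact: measurable_funM.
  by apply: measurable_funB; exact: measurable_funM.
pose Psi w := (Phi w * (g w)%:E)%E.
have mPsi : measurable_fun setT Psi by exact: emeasurable_funM.
have Psi0 w : (0 <= Psi w)%E by rewrite mule_ge0// lee_fin.
rewrite (toL Phi mPhi Phi0) -(lebesgue_reflection mPsi Psi0 cs1).
rewrite (toL _ (measurableT_comp mPhi mr) (fun w => Phi0 _)).
apply: eq_integral => x _; apply: eq_integral => y _; congr (_ * _%:E)%E.
rewrite /g/= !normal_pdfE ?oner_neq0// /normal_fun !subr0 mulrACA [RHS]mulrACA.
congr (_ * _); rewrite -!expRD; congr expR.
suff -> : y ^+ 2 = (c * x + s * y) ^+ 2 + (s * x - c * y) ^+ 2 - x ^+ 2 by field.
have -> : (c * x + s * y) ^+ 2 + (s * x - c * y) ^+ 2 =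
  (c ^+ 2 + s ^+ 2) * (x ^+ 2 + y ^+ 2) by ring.
by rewrite cs1; ring.
Qed.

(** Cameron-Martin formula on the line: the weight is the quotient of the translated density by the
    original one. *)
Lemma gaussian_shift (y : R) (f : RM -> \bar R) :
  measurable_fun setT f -> (forall x, (0 <= f x)%E) ->
  (\int[std_normal]_x f (x + y)%R =
   \int[std_normal]_x (f x * (expR (y * x - y ^+ 2 / 2))%:E))%E.
Proof.
move=> mf f0.
have mpdf : measurable_fun setT (normal_pdf 0 1 : RM -> RM).
  exact: measurable_normal_pdf.
have me : measurable_fun setT (fun x : RM => expR (y * x - y ^+ 2 / 2) : RM).
  apply: measurableT_comp => //.
  by apply: measurable_funB; [exact: measurable_funM|exact: measurable_cst].
have ms (z : R) : measurable_fun setT ((fun x => x + z)%R : RM -> RM).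
  exact: measurable_funD.
rewrite integral_std_normal//; last exact: (measurableT_comp mf (ms y)).
rewrite integral_std_normal//; last 2 first.
- by apply: emeasurable_funM => //; exact/measurable_EFinP.
- by move=> x; rewrite mule_ge0// lee_fin expR_ge0.
have e x : normal_pdf 0 1 (x : R) =
   expR (y * (x + y) - y ^+ 2 / 2) * normal_pdf 0 1 (x + y).
  rewrite !normal_pdfE ?oner_neq0// /normal_fun !subr0 mulrCA.
  by congr (_ * _); rewrite -expRD; congr expR; field.
under eq_integral do rewrite e.
under [in RHS]eq_integral do rewrite -muleA -EFinM.
pose h x := (f x * (expR (y * x - y ^+ 2 / 2) * normal_pdf 0 1 x)%:E)%E.
rewrite (integral_lebesgue_shift y (f := h))// /h.
- apply: emeasurable_funM => //; apply/measurable_EFinP.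
  exact: measurable_funM.
- by move=> x; rewrite mule_ge0// lee_fin mulr_ge0 ?expR_ge0 ?normal_pdf_ge0.
Qed.
End gaussian_line.

(** * Laws of i.i.d. tuples *)

Section iid_integral.
Context {R : realType} d (T : measurableType d) (P : probability T R).

Lemma integral_iid_law_cons n (f : n.+1.-tuple T -> \bar R) :
  measurable_fun setT f -> (forall t, (0 <= f t)%E) ->
  (\int[iid_law P n.+1]_t f t =
   \int[P]_x \int[iid_law P n]_t f (tuple_cons (x, t)))%E.
Proof.
move=> mf f0; rewrite [LHS](ge0_integral_pushforward (@measurable_tuple_cons _ _ _)) ?preimage_setT//.
apply: (fubini_tonelli1 (fun w => f (tuple_cons w))) => //.
exact: (measurableT_comp mf (@measurable_tuple_cons _ _ _)).
Qed.

End iid_integral.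

Ltac mproj := solve [ done | exact: measurableT_comp
  | apply: measurableT_comp => //; exact: measurableT_comp ].

Section gaussian_tuple.
Context {R : realType}.
Local Notation RM := (measurableTypeR R).
Local Notation gauss p := (iid_law (@std_normal R) p).

Definition tlin p (a b : R) (x y : p.-tuple RM) : p.-tuple RM :=
  [tuple a * tnth x i + b * tnth y i | i < p].

Lemma tlin_cons p a b x y (x' y' : p.-tuple RM) :
  tlin a b (@tuple_cons _ RM _ (x, x')) (@tuple_cons _ RM _ (y, y')) =
  @tuple_cons _ RM _ (a * x + b * y, tlin a b x' y').
Proof.
apply: eq_from_tnth => i; rewrite tnth_mktuple.
by case: (unliftP ord0 i) => [j|] ->; rewrite /tuple_cons/= ?tnthS ?tnth_mktuple ?tnth0.
Qed.

Lemma measurable_tlin p a b :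
  measurable_fun setT (fun w : p.-tuple RM * p.-tuple RM => tlin a b w.1 w.2).
Proof.
apply/measurable_fun_tnthP => i.
rewrite (_ : _ \o _ = fun w => a * tnth w.1 i + b * tnth w.2 i); last first.
  by apply/funext => w /=; rewrite tnth_mktuple.
have m := @measurable_tnth _ RM p i.
apply: measurable_funD; apply: measurable_funM => //.
  exact: (measurableT_comp m).
exact: (measurableT_comp m).
Qed.

(** Regroups coordinates so that the two heads form a pair outside the integrals over the tails, the
    shape in which statements on the plane are lifted by induction on the dimension. *)
Lemma integral2_gauss_cons p (Psi : p.+1.-tuple RM * p.+1.-tuple RM -> \bar R) :
  measurable_fun setT Psi -> (forall w, (0 <= Psi w)%E) ->
  (\int[gauss p.+1]_x \int[gauss p.+1]_y Psi (x, y) =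
   \int[std_normal]_x \int[std_normal]_y \int[gauss p]_x' \int[gauss p]_y'
     Psi (@tuple_cons _ RM _ (x, x'), @tuple_cons _ RM _ (y, y')))%E.
Proof.
move=> mPsi Psi0.
rewrite integral_iid_law_cons; last 2 first.
- exact: measurable_fun_fubini_tonelli_F.
- by move=> x; exact: integral_ge0.
apply: eq_integral => x _.
transitivity (\int[gauss p]_x' \int[std_normal]_y \int[gauss p]_y'
     Psi (@tuple_cons _ RM _ (x, x'), @tuple_cons _ RM _ (y, y')))%E.
  apply: eq_integral => x' _; rewrite integral_iid_law_cons//.
  exact: measurableT_comp.
pose G (w : p.-tuple RM * RM) := (\int[gauss p]_y'
     Psi (@tuple_cons _ RM _ (x, w.1), @tuple_cons _ RM _ (w.2, y')))%E.
apply: (fubini_tonelli G); last by move=> w; exact: integral_ge0.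
apply: (measurable_fun_fubini_tonelli_F (fun w : (p.-tuple RM * RM) * p.-tuple RM =>
  Psi (@tuple_cons _ RM _ (x, w.1.1), @tuple_cons _ RM _ (w.1.2, w.2)))) => //.
apply: measurableT_comp => //; apply/measurable_fun_pair => /=.
  by apply: measurable_cons => //=; exact: measurableT_comp.
by apply: measurable_cons => //=; exact: measurableT_comp.
Qed.

Lemma measurable_integral2_cons p (Psi : p.+1.-tuple RM * p.+1.-tuple RM -> \bar R) :
  measurable_fun setT Psi -> (forall w, (0 <= Psi w)%E) ->
  measurable_fun setT (fun w : RM * RM => \int[gauss p]_x' \int[gauss p]_y'
     Psi (@tuple_cons _ RM _ (w.1, x'), @tuple_cons _ RM _ (w.2, y')))%E.
Proof.
move=> mPsi Psi0.
pose G (w : (RM * RM) * p.-tuple RM) := (\int[gauss p]_y'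
     Psi (@tuple_cons _ RM _ (w.1.1, w.2), @tuple_cons _ RM _ (w.1.2, y')))%E.
apply: (measurable_fun_fubini_tonelli_F G); last first.
- by move=> w; exact: integral_ge0.
- apply: (measurable_fun_fubini_tonelli_F
    (fun w : ((RM * RM) * p.-tuple RM) * p.-tuple RM =>
    Psi (@tuple_cons _ RM _ (w.1.1.1, w.1.2), @tuple_cons _ RM _ (w.1.1.2, w.2)))) => //.
  apply: measurableT_comp => //; apply/measurable_fun_pair => /=.
    by apply: measurable_cons => /=; mproj.
  by apply: measurable_cons => /=; mproj.
Qed.

(** The reflection acts separately on each pair of matching coordinates: induction removes it from
    the tails, the plane case from the heads. *)
Lemma integral2_gauss_reflection p (Phi : p.-tuple RM * p.-tuple RM -> \bar R) (c s : R) :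
  measurable_fun setT Phi -> (forall w, (0 <= Phi w)%E) ->
  c ^+ 2 + s ^+ 2 = 1 ->
  (\int[gauss p]_x \int[gauss p]_y Phi (tlin c s x y, tlin s (- c) x y) =
   \int[gauss p]_x \int[gauss p]_y Phi (x, y))%E.
Proof.
elim: p Phi => [|p IH] Phi mPhi Phi0 cs1.
  by apply: eq_integral => x _; apply: eq_integral => y _;
    congr (Phi (_, _)); exact: etrans (tuple0 _) (esym (tuple0 _)).
pose Psi (w : p.+1.-tuple RM * p.+1.-tuple RM) :=
  Phi (tlin c s w.1 w.2, tlin s (- c) w.1 w.2).
have mPsi : measurable_fun setT Psi.
  apply: measurableT_comp => //; apply/measurable_fun_pair => /=;
    exact: measurable_tlin.
rewrite (integral2_gauss_cons mPhi Phi0) (integral2_gauss_cons mPsi (fun w => Phi0 _)).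
pose F (w : RM * RM) := (\int[gauss p]_x' \int[gauss p]_y'
  Phi (@tuple_cons _ RM _ (w.1, x'), @tuple_cons _ RM _ (w.2, y')))%E.
have F0 w : (0 <= F w)%E by apply: integral_ge0 => x _; exact: integral_ge0.
transitivity (\int[std_normal]_x \int[std_normal]_y
    F (c * x + s * y, s * x - c * y)%R)%E; last first.
  exact: (gaussian_reflection (measurable_integral2_cons mPhi Phi0) F0 cs1).
apply: eq_integral => x _; apply: eq_integral => y _.
have mPhi' : measurable_fun setT (fun w : p.-tuple RM * p.-tuple RM =>
    Phi (@tuple_cons _ RM _ (c * x + s * y, w.1), @tuple_cons _ RM _ (s * x - c * y, w.2))).
  apply: measurableT_comp => //; apply/measurable_fun_pair => /=;
    by apply: measurable_cons => /=; mproj.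
rewrite /F/= -(IH _ mPhi' (fun w => Phi0 _) cs1).
apply: eq_integral => x' _; apply: eq_integral => y' _.
by rewrite /Psi /= !tlin_cons mulNr.
Qed.

Definition fsts p (t : p.-tuple (RM * RM)) : p.-tuple RM := map_tuple fst t.
Definition snds p (t : p.-tuple (RM * RM)) : p.-tuple RM := map_tuple snd t.

Lemma measurable_fsts_snds p :
  measurable_fun setT (fun t : p.-tuple (RM * RM) => (fsts t, snds t)).
Proof.
apply/measurable_fun_pair; apply/measurable_fun_tnthP => i.
  rewrite (_ : _ \o _ = fst \o (fun t => tnth t i)); last first.
    by apply/funext => t /=; rewrite tnth_map.
  by apply: measurableT_comp => //; exact: measurable_tnth.
rewrite (_ : _ \o _ = snd \o (fun t => tnth t i)); last first.
  by apply/funext => t /=; rewrite tnth_map.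
by apply: measurableT_comp => //; exact: measurable_tnth.
Qed.

Lemma integral_binormal (eta : R) (Phi : RM * RM -> \bar R) :
  measurable_fun setT Phi -> (forall w, (0 <= Phi w)%E) ->
  (\int[binormal eta]_w Phi w = \int[std_normal]_x \int[std_normal]_y
     Phi (x, eta * x + Num.sqrt (1 - eta ^+ 2) * y)%R)%E.
Proof.
move=> mPhi Phi0; rewrite (ge0_integral_pushforward (measurable_correlate eta)) ?preimage_setT//.
exact: (fubini_tonelli1 _ (measurableT_comp mPhi (measurable_correlate eta)) (fun w => Phi0 _)).
Qed.

(** Turns a tuple of correlated pairs into a pair of independent Gaussian tuples, on which
    reflections act. *)
Lemma integral_iid_binormal p (eta : R) (Phi : p.-tuple RM * p.-tuple RM -> \bar R) :
  measurable_fun setT Phi -> (forall w, (0 <= Phi w)%E) ->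
  (\int[iid_law (binormal eta) p]_t Phi (fsts t, snds t) =
   \int[gauss p]_x \int[gauss p]_y
     Phi (x, tlin eta (Num.sqrt (1 - eta ^+ 2)) x y))%E.
Proof.
elim: p Phi => [|p IH] Phi mPhi Phi0.
  have e (x y : 0.-tuple RM) : Phi (x, y) = Phi ([tuple], [tuple]).
    by congr (Phi (_, _)); exact: tuple0.
  transitivity (Phi ([tuple], [tuple])).
    under eq_integral do rewrite e.
    by rewrite integral_cst//= diracT mule1.
  under eq_integral.
    move=> x _; under eq_integral do rewrite e.
    rewrite integral_cst//= diracT mule1; over.
  by rewrite integral_cst//= -[LHS]mule1; congr (_ * _)%E; exact/esym/diracT.
have mf := measurableT_comp mPhi (@measurable_fsts_snds p.+1).
rewrite (integral_iid_law_cons (binormal eta) mf (fun t => Phi0 _)).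
pose Psi (w : p.+1.-tuple RM * p.+1.-tuple RM) :=
  Phi (w.1, tlin eta (Num.sqrt (1 - eta ^+ 2)) w.1 w.2).
have mPsi : measurable_fun setT Psi.
  apply: measurableT_comp => //; apply/measurable_fun_pair => //=;
    exact: measurable_tlin.
rewrite (integral2_gauss_cons mPsi (fun w => Phi0 _)).
pose F (w : RM * RM) := (\int[gauss p]_x' \int[gauss p]_y'
   Phi (@tuple_cons _ RM _ (w.1, x'),
        @tuple_cons _ RM _ (w.2, tlin eta (Num.sqrt (1 - eta ^+ 2)) x' y')))%E.
transitivity (\int[binormal eta]_w F w)%E.
  apply: eq_integral => w _; rewrite /F.
  rewrite -(IH (fun v => Phi (@tuple_cons _ RM _ (w.1, v.1), @tuple_cons _ RM _ (w.2, v.2))))//.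
    by apply: eq_integral => t _; congr (Phi (_, _)); exact: val_inj.
  apply: measurableT_comp => //; apply/measurable_fun_pair => /=;
    by apply: measurable_cons => /=; mproj.
rewrite integral_binormal.
- apply: eq_integral => x _; apply: eq_integral => y _.
  apply: eq_integral => x' _; apply: eq_integral => y' _.
  by rewrite /Psi/= tlin_cons.
- pose G (w : (RM * RM) * p.-tuple RM) := (\int[gauss p]_y'
     Phi (@tuple_cons _ RM _ (w.1.1, w.2),
          @tuple_cons _ RM _ (w.1.2, tlin eta (Num.sqrt (1 - eta ^+ 2)) w.2 y')))%E.
  apply: (measurable_fun_fubini_tonelli_F G); last first.
    by move=> w; exact: integral_ge0.
  apply: (measurable_fun_fubini_tonelli_F
    (fun w : ((RM * RM) * p.-tuple RM) * p.-tuple RM =>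
    Phi (@tuple_cons _ RM _ (w.1.1.1, w.1.2), @tuple_cons _ RM _ (w.1.1.2,
      tlin eta (Num.sqrt (1 - eta ^+ 2)) w.1.2 w.2)))) => //.
  apply: measurableT_comp => //; apply/measurable_fun_pair => /=.
    by apply: measurable_cons => /=; mproj.
  apply: measurable_cons => /=; first by mproj.
  apply: (measurableT_comp (@measurable_tlin p _ _)
    (g := fun w : ((RM * RM) * p.-tuple RM) * p.-tuple RM => (w.1.2, w.2))).
  by apply/measurable_fun_pair => //=; exact: measurableT_comp.
- by move=> w; apply: integral_ge0 => x _; exact: integral_ge0.
Qed.

(** The density of N(y, I) with respect to N(0, I). *)
Definition cm_weight p (y t : p.-tuple RM) : R :=
  expR (\sum_i (tnth y i * tnth t i - tnth y i ^+ 2 / 2)).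

Lemma cm_weight_cons p y x (y' x' : p.-tuple RM) :
  cm_weight (@tuple_cons _ RM _ (y, y')) (@tuple_cons _ RM _ (x, x')) =
  expR (y * x - y ^+ 2 / 2) * cm_weight y' x'.
Proof.
rewrite /cm_weight big_ord_recl expRD/= /tuple_cons !tnth0/=; congr (_ * expR _).
by apply: eq_bigr => i _; rewrite !tnthS.
Qed.

Lemma measurable_cm_weight p (y : p.-tuple RM) : measurable_fun setT (cm_weight y).
Proof.
apply: measurableT_comp => //; apply: measurable_sum => i.
apply: measurable_funB => //; apply: measurable_funM => //; exact: measurable_tnth.
Qed.

Lemma integral_gauss_shift p (y : p.-tuple RM) (f : p.-tuple RM -> \bar R) :
  measurable_fun setT f -> (forall t, (0 <= f t)%E) ->
  (\int[gauss p]_t f (tlin 1 1 t y) =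
   \int[gauss p]_t (f t * (cm_weight y t)%:E))%E.
Proof.
elim: p y f => [|p IH] y f mf f0.
  apply: eq_integral => t _.
  rewrite /cm_weight big_ord0 expR0 mule1; congr f.
  exact: etrans (tuple0 _) (esym (tuple0 _)).
have [y0 [y' yE]] : exists (y0 : RM) (y' : p.-tuple RM), y = @tuple_cons _ RM _ (y0, y').
  by exists (thead y), [tuple of behead y]; rewrite [LHS](tuple_eta y); exact: val_inj.
rewrite {}yE; set y1 := @tuple_cons _ RM _ (y0, y').
have ml : measurable_fun setT (fun t : p.+1.-tuple RM => tlin 1 1 t y1).
  apply: (measurableT_comp (@measurable_tlin p.+1 1 1) (g := fun t => (t, y1))).
  exact: measurable_fun_pair.
have mw := @measurable_cm_weight _ y1.
rewrite (integral_iid_law_cons std_normal (measurableT_comp mf ml) (fun t => f0 _)).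
have mw' : measurable_fun setT (EFin \o cm_weight y1) by exact/measurable_EFinP.
rewrite (integral_iid_law_cons std_normal (emeasurable_funM mf mw')); last first.
  by move=> t; rewrite mule_ge0// lee_fin expR_ge0.
have mf1 (x : RM) : measurable_fun setT (fun t : p.-tuple RM => f (@tuple_cons _ RM _ (x, t))).
  by apply: measurableT_comp => //; apply: measurable_cons => /=; mproj.
pose g x := (\int[gauss p]_t (f (@tuple_cons _ RM _ (x, t)) * (cm_weight y' t)%:E))%E.
have mg : measurable_fun setT (g : RM -> _).
  apply: (measurable_fun_fubini_tonelli_F (fun w : RM * p.-tuple RM =>
    (f (@tuple_cons _ RM _ (w.1, w.2)) * (cm_weight y' w.2)%:E)%E)); last first.
    by move=> w; rewrite mule_ge0// lee_fin expR_ge0.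
  apply: emeasurable_funM.
    by apply: measurableT_comp => //; apply: measurable_cons => /=; mproj.
  apply/measurable_EFinP.
  exact: (measurableT_comp (@measurable_cm_weight _ y')).
have g0 x : (0 <= g x)%E.
  by apply: integral_ge0 => t _; rewrite mule_ge0// lee_fin expR_ge0.
transitivity (\int[std_normal]_x g (x + y0)%R)%E.
  apply: eq_integral => x _; rewrite /g -(IH y' (fun t => f (@tuple_cons _ RM _ ((x + y0 : RM), t))))//.
  by apply: eq_integral => t _; rewrite /= /y1 tlin_cons !mul1r.
etransitivity; first exact: (gaussian_shift y0 mg g0).
apply: eq_integral => x _.
have mcm := @measurable_cm_weight _ y'.
rewrite /g -ge0_integralZr; [|exact: measurableT| | |].
- apply: eq_integral => t _; rewrite /= /y1 cm_weight_cons EFinM -muleA.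
  by congr (_ * _)%E; rewrite muleC.
- by apply: emeasurable_funM => //; apply/measurable_EFinP.
- by move=> t _; rewrite mule_ge0// lee_fin expR_ge0.
- by rewrite lee_fin expR_ge0.
Qed.
End gaussian_tuple.

(** * Functions of exponential growth *)

Section tame.
Context {R : realType} {p : nat}.
Local Notation RM := (measurableTypeR R).
Local Notation V := 'cV[R]_p.
Local Notation T := (p.-tuple RM).
Local Notation gauss := (iid_law (@std_normal R) p).

(** The l1 norm is chosen because its exponential factors over independent coordinates, which makes
    Gaussian exponential moments immediate. *)
Definition N1 (x : V) : R := \sum_i `|x i 0|.

Lemma N1_ge0 x : 0 <= N1 x. Proof. exact: sumr_ge0. Qed.

Lemma N1D x y : N1 (x + y) <= N1 x + N1 y.
Proof. by rewrite -big_split; apply: ler_sum => i _; rewrite mxE ler_normD. Qed.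

Lemma N1Z a x : N1 (a *: x) = `|a| * N1 x.
Proof. by rewrite mulr_sumr; apply: eq_bigr => i _; rewrite mxE normrM. Qed.

Lemma N1N x : N1 (- x) = N1 x.
Proof. by rewrite -scaleN1r N1Z normrN1 mul1r. Qed.

Lemma N1B x y : N1 (x - y) <= N1 x + N1 y.
Proof. by rewrite -(N1N y) N1D. Qed.

Lemma coord_le_N1 (x : V) i : `|x i 0| <= N1 x.
Proof. by rewrite /N1 (bigD1 i)//= lerDl sumr_ge0. Qed.

Definition tcol (x : V) : T := [tuple x i 0 | i < p].

Lemma tcolK x : colt (tcol x) = x.
Proof. by apply/colP => i; rewrite mxE tnth_mktuple. Qed.

Lemma colt_tlin a b (x y : T) : colt (tlin a b x y) = a *: colt x + b *: colt y.
Proof. by apply/colP => i; rewrite !mxE tnth_mktuple. Qed.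

Implicit Types (Phi Psi : V -> V -> R) (f g : V -> R).

(** The Gaussian laws live on tuples and the functions on column vectors, so measurability is pulled
    back along [colt]. *)
Definition mfun2 Phi :=
  measurable_fun setT (fun w : T * T => Phi (colt w.1) (colt w.2)).

(** Growth is exponential rather than polynomial so that the class contains the densities [cmw z]
    and is still Gaussian integrable. A function of one vector is treated as a function of two that
    ignores the second. *)
Definition tame Phi := mfun2 Phi /\ exists C c : R, [/\ 0 <= C, 0 <= c &
  forall x y, `|Phi x y| <= C * expR (c * (N1 x + N1 y))].

Lemma mfun2_affine Phi u a b v c d : mfun2 Phi ->
  mfun2 (fun x y => Phi (u + a *: x + b *: y) (v + c *: x + d *: y)).
Proof.
move=> mPhi.
pose h u a b (w : T * T) := tlin 1 1 (tcol u) (tlin a b w.1 w.2).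
have mh u' a' b' : measurable_fun setT (h u' a' b').
  apply: (measurableT_comp (@measurable_tlin _ p 1 1) (g := fun w : T * T => (tcol u', tlin a' b' w.1 w.2))).
  by apply/measurable_fun_pair => /=; [exact: measurable_cst|exact: measurable_tlin].
rewrite /mfun2 (_ : (fun w : T * T => _) =
    (fun w => Phi (colt w.1) (colt w.2)) \o (fun w => (h u a b w, h v c d w))).
  by apply: measurableT_comp => //; exact/measurable_fun_pair.
apply/funext => w /=; rewrite /h !colt_tlin !tcolK !scale1r !addrA//.
Qed.

Lemma tame_affine u a b v c d Phi : tame Phi ->
  tame (fun x y => Phi (u + a *: x + b *: y) (v + c *: x + d *: y)).
Proof.
case=> mPhi [C [k [C0 k0 PhiC]]]; split; first exact: mfun2_affine.
pose m := `|a| + `|b| + `|c| + `|d|.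
exists (C * expR (k * (N1 u + N1 v))), (k * m); split.
- by rewrite mulr_ge0// expR_ge0.
- by rewrite mulr_ge0// !addr_ge0.
move=> x y; apply: le_trans (PhiC _ _) _; rewrite -mulrA ler_wpM2l// -expRD ler_expR.
rewrite -mulrA -mulrDr ler_wpM2l//.
have N3 (w z t : V) : N1 (w + z + t) <= N1 w + N1 z + N1 t.
  by apply: le_trans (N1D _ _) _; rewrite lerD2r N1D.
apply: le_trans (lerD (N3 _ _ _) (N3 _ _ _)) _; rewrite !N1Z /m.
have := N1_ge0 x; have := N1_ge0 y; move: (N1 x) (N1 y) => X Y Y0 X0.
have := mulr_ge0 (normr_ge0 a) Y0; have := mulr_ge0 (normr_ge0 b) X0.
have := mulr_ge0 (normr_ge0 c) Y0; have := mulr_ge0 (normr_ge0 d) X0.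
by rewrite !mulrDl !mulrDr; lra.
Qed.

Lemma tame_dom Phi Psi : mfun2 Phi -> tame Psi ->
  (forall x y, `|Phi x y| <= Psi x y) -> tame Phi.
Proof.
move=> mPhi [_ [C [c [C0 c0 PsiC]]]] le; split => //; exists C, c; split => // x y.
by apply: le_trans (le x y) _; apply: le_trans (ler_norm _) (PsiC x y).
Qed.

Lemma tame_cst k : tame (fun _ _ => k).
Proof.
split; first exact: measurable_cst.
by exists `|k|, 0; split => // x y; rewrite mul0r expR0 mulr1.
Qed.

Lemma tameD Phi Psi : tame Phi -> tame Psi -> tame (fun x y => Phi x y + Psi x y).
Proof.
case=> mPhi [C [c [C0 c0 PhiC]]] [mPsi [D [d [D0 d0 PsiD]]]].
split; first exact: measurable_funD.
exists (C + D), (c + d); split; [exact: addr_ge0|exact: addr_ge0|] => x y.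
apply: le_trans (ler_normD _ _) _; rewrite mulrDl.
have N0 : 0 <= N1 x + N1 y by rewrite addr_ge0 ?N1_ge0.
apply: lerD.
  apply: le_trans (PhiC x y) _; rewrite ler_wpM2l// ler_expR ler_wpM2r//; lra.
apply: le_trans (PsiD x y) _; rewrite ler_wpM2l// ler_expR ler_wpM2r//; lra.
Qed.

Lemma tameM Phi Psi : tame Phi -> tame Psi -> tame (fun x y => Phi x y * Psi x y).
Proof.
case=> mPhi [C [c [C0 c0 PhiC]]] [mPsi [D [d [D0 d0 PsiD]]]].
split; first exact: measurable_funM.
exists (C * D), (c + d); split; [exact: mulr_ge0|exact: addr_ge0|] => x y.
by rewrite normrM mulrDl expRD mulrACA ler_pM.
Qed.

Lemma tameZ k Phi : tame Phi -> tame (fun x y => k * Phi x y).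
Proof. by move=> ?; apply: tameM => //; exact: tame_cst. Qed.

Lemma tameN Phi : tame Phi -> tame (fun x y => - Phi x y).
Proof.
move=> /(tameZ (-1)) h; rewrite (_ : (fun x y => _) = (fun x y => -1 * Phi x y))//.
by apply/funext => x; apply/funext => y; rewrite mulN1r.
Qed.

Lemma tameB Phi Psi : tame Phi -> tame Psi -> tame (fun x y => Phi x y - Psi x y).
Proof. by move=> ? ?; apply: tameD => //; exact: tameN. Qed.

Lemma tame_sum (I : Type) (r : seq I) (F : I -> V -> V -> R) :
  (forall i, tame (F i)) -> tame (fun x y => \sum_(i <- r) F i x y).
Proof.
move=> tF; elim: r => [|i r IH].
  rewrite (_ : (fun x y => _) = (fun _ _ => 0)); first exact: tame_cst.
  by apply/funext => x; apply/funext => y; rewrite big_nil.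
rewrite (_ : (fun x y => _) = (fun x y => F i x y + \sum_(i <- r) F i x y)).
  exact: tameD.
by apply/funext => x; apply/funext => y; rewrite big_cons.
Qed.

Lemma mfun2_coord1 i : mfun2 (fun x _ => x i 0).
Proof.
rewrite /mfun2 (_ : (fun w : T * T => _) = (fun t => tnth t i) \o fst).
  by apply: measurableT_comp => //; exact: measurable_tnth.
by apply/funext => w; rewrite mxE.
Qed.

Lemma mfun2_N1 : mfun2 (fun x _ => N1 x).
Proof. by apply: measurable_sum => i; apply: measurableT_comp => //; exact: mfun2_coord1. Qed.

Lemma tame_expN1 c : 0 <= c -> tame (fun x _ => expR (c * N1 x)).
Proof.
move=> c0; split.
  by apply: measurableT_comp => //; apply: measurable_funM => //; exact: mfun2_N1.
exists 1, c; split => // x y.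
rewrite mul1r ger0_norm ?expR_ge0// ler_expR ler_wpM2l// lerDl N1_ge0//.
Qed.

Lemma tame_N1 : tame (fun x _ => N1 x).
Proof.
apply: (tame_dom mfun2_N1 (tame_expN1 ler01)) => x _.
rewrite mul1r ger0_norm ?N1_ge0//; have := expR_ge1Dx (N1 x); lra.
Qed.

Lemma tame_coord i : tame (fun x _ => x i 0).
Proof. apply: (tame_dom (mfun2_coord1 i) tame_N1) => x _; exact: coord_le_N1. Qed.

Lemma tame_lift f u a b : tame (fun x _ => f x) -> tame (fun x y => f (u + a *: x + b *: y)).
Proof. exact: (@tame_affine u a b 0 0 0 (fun x _ => f x)). Qed.

Lemma tame_lin f a b : tame (fun x _ => f x) -> tame (fun x y => f (a *: x + b *: y)).
Proof.
move=> /(@tame_lift _ 0 a b); under eq_fun do under eq_fun do rewrite add0r.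
by [].
Qed.

Lemma tame_snd f : tame (fun x _ => f x) -> tame (fun _ y => f y).
Proof.
move=> /(@tame_lin _ 0 1).
by under eq_fun do under eq_fun do rewrite scale0r add0r scale1r.
Qed.

Definition lipf (L : R) f := forall x y, `|f x - f y| <= L * N1 (x - y).

Lemma rat_vec_dense (x : V) (e : R) : 0 < e ->
  exists q : 'cV[rat]_p, N1 (x - map_mx ratr q) < e.
Proof.
move=> e0; pose e' := e / p.+1%:R.
have e'0 : 0 < e' by rewrite divr_gt0.
have /choice[q hq] i : exists q : rat, `|x i 0 - ratr q| < e'.
  have /rat_in_itvoo[q] : x i 0 - e' < x i 0 + e' by rewrite ltrD2l gtrN.
  by rewrite in_itv/= => /andP[? ?]; exists q; rewrite ltr_norml; apply/andP; split; lra.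
exists (\col_i q i); apply: (@le_lt_trans _ _ (\sum_(i < p) e')).
  by apply: ler_sum => i _; rewrite !mxE ltW.
rewrite sumr_const card_ord -mulr_natr /e' mulrAC -mulrA.
by rewrite gtr_pMr// ltr_pdivrMr ?ltr0n// mul1r ltr_nat.
Qed.

Definition continuousN1 f := forall x e, 0 < e -> exists2 d, 0 < d &
  forall y, N1 (y - x) < d -> `|f y - f x| < e.

(** A sublevel set is the union of the balls with rational centre and radius 1/(n+1) that it
    contains: countably many, each measurable since [N1] is. *)
Lemma mfun2_continuous f : continuousN1 f -> mfun2 (fun x _ => f x).
Proof.
move=> fc mD; apply: (measurability _ (RGenInftyO.measurableE R)) => //.
move=> _ [_ [a ->] <-]; rewrite setTI.
pose ball (q : 'cV[rat]_p * nat) (x : V) := N1 (x - map_mx ratr q.1) < q.2.+1%:R^-1.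
rewrite [X in measurable X](_ : _ = \bigcup_(q : 'cV[rat]_p * nat)
   [set w : T * T | ball q (colt w.1) /\ forall x, ball q x -> f x < a]); last first.
  apply/seteqP; split => [w/=|w [q _]/=]; rewrite in_itv/=; last first.
    by move=> [wq]; exact.
  move=> fa; have fa0 : 0 < a - f (colt w.1) by rewrite subr_gt0.
  have [d d0 hd] := fc (colt w.1) _ fa0.
  (* The radius is below d / 2, so a ball of this radius whose centre is that close to the given
     point stays within distance d of it. *)
  pose m := Num.truncn (2 / d).
  have m1 : m.+1%:R^-1 < d / 2.
    rewrite -[ltRHS]invf_div ltf_pV2 ?posrE ?divr_gt0// ?ltr0n//.
    exact: truncnS_gt.
  have m0 : 0 < m.+1%:R^-1 :> R by rewrite invr_gt0 ltr0n.
  have [q hq] := @rat_vec_dense (colt w.1) _ m0.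
  exists (q, m) => //=; split => // x xq.
  have /hd : N1 (x - colt w.1) < d.
    have -> : x - colt w.1 = (x - map_mx ratr q) - (colt w.1 - map_mx ratr q).
      by rewrite opprB addrA subrK.
    apply: le_lt_trans (N1B _ _) _; move: xq; rewrite /ball/=.
    move: m1 hq; move: (m.+1%:R^-1) => z; lra.
  by move=> /ltr_normlP[_]; lra.
apply: countable_bigcupT_measurable => // q.
have [qa|qa] := pselect (forall x, ball q x -> f x < a); last first.
  rewrite [X in measurable X](_ : _ = set0)//.
  by apply/seteqP; split => // w [_ /qa].
rewrite [X in measurable X](_ : _ = (fun w : T * T => N1 (colt w.1 - map_mx ratr q.1)) @^-1`
  `]-oo, q.2.+1%:R^-1[); last first.
  by apply/seteqP; split => w /=; rewrite in_itv/=; [case|].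
rewrite -[X in measurable X]setTI.
have := @mfun2_affine (fun x _ => N1 x) (- map_mx ratr q.1) 1 0 0 0 0 mfun2_N1.
rewrite /mfun2; under eq_fun do rewrite scale0r addr0 scale1r addrC.
by apply.
Qed.

Lemma mfun2_lip L f : lipf L f -> mfun2 (fun x _ => f x).
Proof.
move=> fL; apply: mfun2_continuous => x e e0.
have L1 : 0 < `|L| + 1 by rewrite ltr_pwDr.
exists (e / (`|L| + 1)) => [|y]; first by rewrite divr_gt0.
rewrite ltr_pdivlMr// => h; apply: le_lt_trans (fL _ _) _; apply: le_lt_trans h.
rewrite mulrC; apply: ler_wpM2l; first exact: N1_ge0.
by have := ler_norm L; lra.
Qed.

Lemma tame_lip L f : lipf L f -> tame (fun x _ => f x).
Proof.
move=> fL; apply: (tame_dom (mfun2_lip fL)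
  (tameD (tame_cst `|f 0|) (tameZ L tame_N1))) => x _.
have := fL x 0; rewrite subr0; have := ler_normD (f x - f 0) (f 0).
by rewrite subrK; lra.
Qed.
End tame.

(** * Gaussian expectations *)

Ltac epos := by move=> *; rewrite -?EFinM lee_fin ?mulr_ge0 ?expR_ge0.

Lemma integral_probability_cst {R : realType} d (T : measurableType d)
  (P : probability T R) (k : \bar R) : (\int[P]_x k = k)%E.
Proof. by rewrite integral_cst//= probability_setT mule1. Qed.

Section gaussian_expectation.
Context {R : realType} {p : nat}.
Local Notation RM := (measurableTypeR R).
Local Notation V := 'cV[R]_p.
Local Notation T := (p.-tuple RM).
Local Notation gauss := (iid_law (@std_normal R) p).
Local Notation gauss2 := (gauss \x gauss)%E.
Implicit Types (Phi Psi : V -> V -> R) (f g : V -> R).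

Lemma integral_gauss_expN1 (c : R) : 0 <= c ->
  (\int[gauss]_t (expR (c * N1 (colt t)))%:E < +oo)%E.
Proof.
move=> c0.
(* The translation formula applied to the constant 1 evaluates the Gaussian moment generating
   function. *)
have e1 (y : R) : (\int[std_normal]_x (expR (y * x - y ^+ 2 / 2))%:E = 1)%E.
  have := @gaussian_shift R y (cst 1%E) (measurable_cst _) (fun=> lee01).
  have -> : (\int[@std_normal R]_x (cst 1%E (x + y)%R) = 1)%E.
    by rewrite integral_cst// mul1e; exact: probability_setT.
  by move=> ->; apply: eq_integral => x _; rewrite mul1e.
have me (y : R) : measurable_fun setT (fun x : RM => (expR (y * x))%:E).
  apply/measurable_EFinP; apply: measurableT_comp => //; exact: measurable_funM.
have e2 (y : R) : (\int[std_normal]_x (expR (y * x))%:E < +oo)%E.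
  have -> : (\int[std_normal]_x (expR (y * x))%:E =
    \int[std_normal]_x ((expR (y ^+ 2 / 2))%:E * (expR (y * x - y ^+ 2 / 2))%:E))%E.
    by apply: eq_integral => x _; rewrite -EFinM -expRD; congr (expR _)%:E; ring.
  rewrite ge0_integralZl; [|exact: measurableT| | |].
  - by rewrite e1 mule1 ltry.
  - apply/measurable_EFinP; apply: measurableT_comp => //.
    by apply: measurable_funB; [exact: measurable_funM|exact: measurable_cst].
  - by move=> x _; rewrite lee_fin expR_ge0.
  - by rewrite lee_fin expR_ge0.
have mabs : measurable_fun setT (fun x : RM => (expR (c * `|x|))%:E).
  apply/measurable_EFinP; apply: measurableT_comp => //; apply: measurable_funM => //.
have e3 : (\int[std_normal]_x (expR (c * `|x|))%:E < +oo)%E.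
  apply: (@le_lt_trans _ _ (\int[std_normal]_x
    ((expR (c * x))%:E + (expR (- c * x))%:E))%E).
    apply: ge0_le_integral; [exact: measurableT|epos|exact: mabs| |].
    - by apply: emeasurable_funD; exact: me.
    - move=> x _; rewrite -EFinD lee_fin.
      have [x0|x0] := ger0P x; first by rewrite lerDl expR_ge0.
      by rewrite mulrN -mulNr lerDr expR_ge0.
  rewrite ge0_integralD; [|exact: measurableT|epos|exact: me|epos|exact: me].
  exact: lte_add_pinfty.
elim: p => [|n IH].
  under eq_integral do rewrite /N1 big_ord0 mulr0 expR0.
  by rewrite integral_cst//= diracT mule1 ltry.
have mN n' : measurable_fun setT (fun t : n'.-tuple RM => (expR (c * N1 (colt t)))%:E).
  apply/measurable_EFinP; apply: measurableT_comp => //; apply: measurable_funM => //.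
  apply: measurable_sum => i; apply: measurableT_comp => //.
  under eq_fun do rewrite mxE; exact: measurable_tnth.
rewrite (integral_iid_law_cons std_normal (mN _)); last first.
  by move=> t; rewrite lee_fin expR_ge0.
rewrite (_ : (\int[_]_x _ = \int[std_normal]_x ((expR (c * `|x|))%:E *
   \int[iid_law std_normal n]_t (expR (c * N1 (colt t)))%:E))%E); last first.
  apply: eq_integral => x _.
  rewrite -ge0_integralZl; [|exact: measurableT|exact: mN|epos|epos].
  - apply: eq_integral => t _; rewrite -EFinM -expRD -mulrDr; congr (expR (c * _))%:E.
    rewrite /N1 big_ord_recl mxE /tuple_cons/= tnth0; congr (_ + _).
    by apply: eq_bigr => i _; rewrite !mxE tnthS.
have i0 : (0 <= \int[iid_law std_normal n]_t (expR (c * N1 (colt t)))%:E)%E.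
  by apply: integral_ge0 => t _; rewrite lee_fin expR_ge0.
rewrite ge0_integralZr; [|exact: measurableT|exact: mabs|epos|exact: i0].
have j0 : (0 <= \int[std_normal]_x (expR (c * `|x|))%:E)%E.
  by apply: integral_ge0 => t _; rewrite lee_fin expR_ge0.
by rewrite lte_mul_pinfty// ge0_fin_numE.
Qed.

Lemma tame_integrable Phi : tame Phi ->
  gauss2.-integrable setT (EFin \o (fun w => Phi (colt w.1) (colt w.2))).
Proof.
case=> mPhi [C [c [C0 c0 PhiC]]].
have mN := mfun2_N1 (R := R) (p := p).
have mN' : measurable_fun setT (fun t : T => (expR (c * N1 (colt t)))%:E).
  apply/measurable_EFinP; apply: measurableT_comp => //; apply: measurable_funM => //.
  apply: measurable_sum => i; apply: measurableT_comp => //.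
  under eq_fun do rewrite mxE; exact: measurable_tnth.
pose D (w : T * T) := ((C%:E * (expR (c * N1 (colt w.1)))%:E) * (expR (c * N1 (colt w.2)))%:E)%E.
have mD : measurable_fun setT D.
  apply: emeasurable_funM; last exact: (measurableT_comp mN' measurable_snd).
  by apply: emeasurable_funM => //; exact: (measurableT_comp mN' measurable_fst).
have D0 w : (0 <= D w)%E by rewrite /D -!EFinM lee_fin !mulr_ge0// expR_ge0.
apply: (@le_integrable _ _ _ _ _ measurableT _ D).
- exact/measurable_EFinP.
- move=> w _; rewrite [leRHS]gee0_abs// /D -!EFinM lee_fin; apply: le_trans (PhiC _ _) _.
  by rewrite mulrDr expRD mulrA.
apply/integrableP; split => //.
under eq_integral => w _ do rewrite gee0_abs//.
rewrite (fubini_tonelli1 D mD D0).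
rewrite (_ : (\int[_]_x _ = \int[gauss]_x ((C%:E * (expR (c * N1 (colt x)))%:E) *
   \int[gauss]_y (expR (c * N1 (colt y)))%:E))%E); last first.
  apply: eq_integral => x _; rewrite /fubini_F /D/=.
  by rewrite -ge0_integralZl; [|exact: measurableT|exact: mN'|epos|epos].
have i0 : (0 <= \int[gauss]_t (expR (c * N1 (colt t)))%:E)%E.
  by apply: integral_ge0 => t _; rewrite lee_fin expR_ge0.
have mCN : measurable_fun setT (fun t : T => C%:E * (expR (c * N1 (colt t)))%:E)%E.
  by apply: emeasurable_funM; [exact: measurable_cst|exact: mN'].
rewrite ge0_integralZr; [|exact: measurableT|exact: mCN|epos|exact: i0].
have fin : (\int[gauss]_t (expR (c * N1 (colt t)))%:E)%E \is a fin_num.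
  by rewrite ge0_fin_numE// integral_gauss_expN1.
rewrite lte_mul_pinfty//.
- by apply: integral_ge0; epos.
- rewrite ge0_integralZl; [|exact: measurableT|exact: mN'|epos|epos].
  by rewrite fin_numM.
- exact: integral_gauss_expN1.
Qed.

(** Expectation over two independent standard Gaussian vectors, [E1] over one; these real integrals
    obey the usual rules on [tame] functions. *)
Definition E2 Phi : R := \int[gauss2]_w Phi (colt w.1) (colt w.2).
Definition E1 f : R := \int[gauss]_t f (colt t).

Lemma eq_E2 Phi Psi : (forall x y, Phi x y = Psi x y) -> E2 Phi = E2 Psi.
Proof. by move=> e; apply: eq_Rintegral => w _; exact: e. Qed.

Lemma eq_E1 f g : f =1 g -> E1 f = E1 g.
Proof. by move=> e; apply: eq_Rintegral => w _; exact: e. Qed.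

Lemma E2D Phi Psi : tame Phi -> tame Psi ->
  E2 (fun x y => Phi x y + Psi x y) = E2 Phi + E2 Psi.
Proof. by move=> tPhi tPsi; rewrite /E2 RintegralD//; exact: tame_integrable. Qed.

Lemma E2B Phi Psi : tame Phi -> tame Psi ->
  E2 (fun x y => Phi x y - Psi x y) = E2 Phi - E2 Psi.
Proof. by move=> tPhi tPsi; rewrite /E2 RintegralB//; exact: tame_integrable. Qed.

Lemma E2Z k Phi : tame Phi -> E2 (fun x y => k * Phi x y) = k * E2 Phi.
Proof. by move=> tPhi; rewrite /E2 RintegralZl//; exact: tame_integrable. Qed.

Lemma E2_cst k : E2 (fun _ _ => k) = k.
Proof.
rewrite /E2 Rintegral_cst; last exact: measurableT.
rewrite (_ : fine _ = 1) ?mulr1//.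
by rewrite -[RHS]/(fine 1%E); congr fine; exact: probability_setT.
Qed.

Lemma E2_sum (I : Type) (r : seq I) (F : I -> V -> V -> R) :
  (forall i, tame (F i)) ->
  E2 (fun x y => \sum_(i <- r) F i x y) = \sum_(i <- r) E2 (F i).
Proof.
move=> tF; elim: r => [|i r IH].
  rewrite big_nil; apply: etrans (E2_cst 0).
  by apply: eq_E2 => x y; rewrite big_nil.
rewrite big_cons -IH -E2D//; last exact: tame_sum.
by apply: eq_E2 => x y; rewrite big_cons.
Qed.

Lemma E2_le Phi Psi : tame Phi -> tame Psi ->
  (forall x y, Phi x y <= Psi x y) -> E2 Phi <= E2 Psi.
Proof.
by move=> tPhi tPsi le; apply: le_Rintegral => //; exact: tame_integrable.
Qed.

Lemma E2_ge0 Phi : (forall x y, 0 <= Phi x y) -> 0 <= E2 Phi.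
Proof. by move=> Phi0; apply: Rintegral_ge0. Qed.

Lemma E2_norm_le Phi Psi : tame Phi -> tame Psi ->
  (forall x y, `|Phi x y| <= Psi x y) -> `|E2 Phi| <= E2 Psi.
Proof.
move=> tPhi tPsi le.
have le1 : E2 Phi <= E2 Psi.
  by apply: E2_le => // x y; exact: le_trans (ler_norm _) (le x y).
have le2 : E2 (fun x y => - Phi x y) <= E2 Psi.
  apply: E2_le => //; first exact: tameN.
  by move=> x y; apply: le_trans (le x y); rewrite -normrN ler_norm.
rewrite ler_norml le1 andbT lerNl; apply: le_trans le2.
rewrite (_ : E2 (fun x y => - Phi x y) = - E2 Phi)//.
rewrite -mulN1r -E2Z//; by apply: eq_E2 => x y; rewrite mulN1r.
Qed.

Lemma E2_split Phi : E2 Phi =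
  fine (\int[gauss2]_w (Num.max (Phi (colt w.1) (colt w.2)) 0)%:E -
        \int[gauss2]_w (Num.max (- Phi (colt w.1) (colt w.2)) 0)%:E)%E.
Proof.
rewrite /E2 /Rintegral integralE; congr (fine (_ - _)).
  by apply: eq_integral => w _; rewrite funeposE/= -EFin_max.
by apply: eq_integral => w _; rewrite funenegE/= -EFin_max.
Qed.

(** Changes of variables are available for nonnegative integrands; taking for k the positive and the
    negative part extends them to signed ones without any integrability. *)
Lemma E2_transfer Phi Psi :
  (forall k : R -> R, measurable_fun setT (k : RM -> RM) -> (forall r, 0 <= k r) ->
    (\int[gauss2]_w (k (Phi (colt w.1) (colt w.2)))%:E =
     \int[gauss2]_w (k (Psi (colt w.1) (colt w.2)))%:E)%E) ->
  E2 Phi = E2 Psi.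
Proof.
move=> h; rewrite !E2_split; congr (fine (_ - _)).
  apply: (h (fun r => Num.max r 0)) => [|r]; last by rewrite le_max lexx orbT.
  exact: measurable_maxr.
apply: (h (fun r => Num.max (- r) 0)) => [|r]; last by rewrite le_max lexx orbT.
by apply: measurable_maxr => //; exact: oppr_measurable.
Qed.

Lemma E2_reflection c s Phi : mfun2 Phi -> c ^+ 2 + s ^+ 2 = 1 ->
  E2 (fun x y => Phi (c *: x + s *: y) (s *: x - c *: y)) = E2 Phi.
Proof.
move=> mPhi cs1; apply: E2_transfer => k mk k0.
pose F (w : T * T) := (k (Phi (colt w.1) (colt w.2)))%:E.
have mF : measurable_fun setT F.
  by apply/measurable_EFinP; apply: (measurableT_comp mk).
have F0 w : (0 <= F w)%E by rewrite lee_fin.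
have mF' : measurable_fun setT (fun w : T * T => F (tlin c s w.1 w.2, tlin s (- c) w.1 w.2)).
  apply: measurableT_comp => //; apply/measurable_fun_pair => /=; exact: measurable_tlin.
transitivity (\int[gauss2]_w (fun w : T * T => F (tlin c s w.1 w.2, tlin s (- c) w.1 w.2)) w)%E.
  by apply: eq_integral => w _; rewrite /F/= !colt_tlin scaleNr.
rewrite (fubini_tonelli1 _ mF' (fun w => F0 _)).
rewrite [RHS](fubini_tonelli1 _ mF F0).
exact: (integral2_gauss_reflection mF F0 cs1).
Qed.

Lemma tame_fst_measurable f : mfun2 (fun x _ => f x) ->
  measurable_fun setT (fun t : T => f (colt t)).
Proof.
move=> mf; apply: (measurableT_comp mf (g := fun t : T => (t, t))).
exact: measurable_fun_pair.
Qed.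

Lemma E2_E1 f : mfun2 (fun x _ => f x) -> E2 (fun x _ => f x) = E1 f.
Proof.
move=> /tame_fst_measurable mf.
rewrite E2_split /E1 /Rintegral integralE; congr (fine (_ - _)).
  have mg : measurable_fun setT (fun w : T * T => (Num.max (f (colt w.1)) 0)%:E).
    by apply/measurable_EFinP; apply: measurable_maxr => //; exact: (measurableT_comp mf).
  rewrite (fubini_tonelli1 _ mg); last by move=> w; rewrite lee_fin le_max lexx orbT.
  apply: eq_integral => x _; rewrite /fubini_F/= integral_probability_cst.
  by rewrite funeposE/= -EFin_max.
have mg : measurable_fun setT (fun w : T * T => (Num.max (- f (colt w.1)) 0)%:E).
  apply/measurable_EFinP; apply: measurable_maxr => //.
  by apply: measurableT_comp => //; exact: (measurableT_comp mf).
rewrite (fubini_tonelli1 _ mg); last by move=> w; rewrite lee_fin le_max lexx orbT.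
apply: eq_integral => x _; rewrite /fubini_F/= integral_probability_cst.
by rewrite funenegE/= -EFin_max.
Qed.

Lemma E2_fubini Phi : tame Phi -> E2 Phi = E1 (fun x => E1 (Phi x)).
Proof.
move=> tPhi; have iPhi := tame_integrable tPhi.
rewrite /E2 /E1 /Rintegral -(integral12_prod_meas1 iPhi); congr fine.
apply: eq_integral => x _; rewrite /fubini_F/= fineK//.
apply: integrable_fin_num => //.
have [mPhi [C [c [C0 c0 PhiC]]]] := tPhi.
have mx : measurable_fun setT (fun t : T => Phi (colt x) (colt t)).
  by apply: (measurableT_comp mPhi (g := fun t : T => (x, t))); exact: measurable_fun_pair.
have tN := tame_integrable (tameZ (C * expR (c * N1 (colt x))) (tame_expN1 c0)).
have mN : measurable_fun setT (fun t : T => expR (c * N1 (colt t))).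
  have := (tame_expN1 (R := R) (p := p) c0).1; exact: tame_fst_measurable.
apply: (@le_integrable _ _ _ _ _ measurableT _
  (fun t : T => ((C * expR (c * N1 (colt x)))%:E * (expR (c * N1 (colt t)))%:E)%E)).
- exact/measurable_EFinP.
- move=> t _; rewrite [leRHS]gee0_abs; last by rewrite -EFinM lee_fin !mulr_ge0 ?expR_ge0.
  by rewrite lee_fin; apply: le_trans (PhiC _ _) _; rewrite mulrDr expRD mulrA.
apply: integrableZl => //; apply/integrableP; split; first exact/measurable_EFinP.
under eq_integral => t _ do rewrite gee0_abs ?lee_fin ?expR_ge0//.
exact: integral_gauss_expN1.
Qed.

Lemma E2_prod f g : tame (fun x _ => f x) -> tame (fun x _ => g x) ->
  E2 (fun x y => f x * g y) = E1 f * E1 g.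
Proof.
move=> tf tg; rewrite E2_fubini; last by apply: tameM => //; exact: tame_snd.
transitivity (E1 (fun x => E1 g * f x)).
  apply: eq_E1 => x; rewrite mulrC -(E2_E1 tg.1) -E2Z//.
  by rewrite -E2_E1//; exact: (tameZ (f x) tg).1.
have e := @E2_E1 (fun x => E1 g * f x) (tameZ (E1 g) tf).1.
by rewrite -e (E2Z (E1 g) tf) (E2_E1 tf.1) mulrC.
Qed.

Definition cmw (z x : V) : R := expR (\sum_i (z i 0 * x i 0 - z i 0 ^+ 2 / 2)).

Lemma cmwE z t : cmw z (colt t) = cm_weight (tcol z) t.
Proof.
by congr expR; apply: eq_bigr => i _; rewrite mxE tnth_mktuple.
Qed.

Lemma tame_cmw z : tame (fun x _ => cmw z x).
Proof.
have tS : tame (fun (x _ : V) => \sum_i (z i 0 * x i 0 - z i 0 ^+ 2 / 2)).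
  apply: (@tame_sum R p _ _ (fun i x _ => z i 0 * x i 0 - z i 0 ^+ 2 / 2)) => i.
  by apply: tameB; [exact: tameZ (tame_coord i)|exact: tame_cst].
apply: (tame_dom _ (tame_expN1 (N1_ge0 z))).
  by apply: measurableT_comp => //; exact: tS.1.
move=> x _; rewrite ger0_norm ?expR_ge0// ler_expR /N1 mulr_suml.
apply: ler_sum => i _; apply: (@le_trans _ _ (`|z i 0| * `|x i 0|)).
  by rewrite -normrM; have := ler_norm (z i 0 * x i 0); have := sqr_ge0 (z i 0); lra.
by rewrite ler_wpM2l//; exact: (coord_le_N1 x i).
Qed.

Lemma E1_shift z f : tame (fun x _ => f x) ->
  E1 (fun x => f (x + z)) = E1 (fun x => f x * cmw z x).
Proof.
move=> tf; rewrite /E1 /Rintegral integralE [in RHS]integralE.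
have mf : measurable_fun setT (fun t : T => f (colt t)).
  exact: (tame_fst_measurable tf.1).
have mw : measurable_fun setT (fun t : T => cmw z (colt t)).
  exact: (tame_fst_measurable (tame_cmw z).1).
have key (k : R -> R) : measurable_fun setT (k : RM -> RM) -> (forall r, 0 <= k r) ->
   (\int[gauss]_t (k (f (colt t + z)))%:E =
    \int[gauss]_t (k (f (colt t)) * cmw z (colt t))%:E)%E.
  move=> mk k0; pose F (t : T) := (k (f (colt t)))%:E.
  have mF : measurable_fun setT F by apply/measurable_EFinP; exact: (measurableT_comp mk).
  have F0 t : (0 <= F t)%E by rewrite lee_fin.
  transitivity (\int[gauss]_t F (tlin 1 1 t (tcol z)))%E.
    by apply: eq_integral => t _; rewrite /F colt_tlin tcolK !scale1r.
  rewrite (integral_gauss_shift (tcol z) mF F0).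
  by apply: eq_integral => t _; rewrite EFinM cmwE.
congr (fine (_ - _)).
  transitivity (\int[gauss]_t (Num.max (f (colt t + z)) 0)%:E)%E.
    by apply: eq_integral => t _; rewrite funeposE/= -EFin_max.
  rewrite (key (fun r => Num.max r 0)) => [||r].
  - apply: eq_integral => t _; rewrite funeposE/= -EFin_max maxr_pMl ?expR_ge0//.
    by rewrite mul0r.
  - exact: measurable_maxr.
  - by rewrite le_max lexx orbT.
transitivity (\int[gauss]_t (Num.max (- f (colt t + z)) 0)%:E)%E.
  by apply: eq_integral => t _; rewrite funenegE/= -EFin_max.
rewrite (key (fun r => Num.max (- r) 0)) => [||r].
- apply: eq_integral => t _; rewrite funenegE/= -EFin_max maxr_pMl ?expR_ge0//.
  by rewrite mul0r mulNr.
- by apply: measurable_maxr => //; exact: oppr_measurable.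
- by rewrite le_max lexx orbT.
Qed.
End gaussian_expectation.

(** * The Mehler semigroup and correlations *)

Section ornstein_uhlenbeck.
Context {R : realType} {p : nat}.
Local Notation V := 'cV[R]_p.
Implicit Types (Phi Psi : V -> V -> R) (f g : V -> R).

Definition tame1 f := tame (fun x _ => f x).

Lemma E1D f g : tame1 f -> tame1 g -> E1 (fun x => f x + g x) = E1 f + E1 g.
Proof.
move=> tf tg; rewrite -(E2_E1 tf.1) -(E2_E1 tg.1) -E2D// E2_E1//.
exact: (tameD tf tg).1.
Qed.

Lemma E1B f g : tame1 f -> tame1 g -> E1 (fun x => f x - g x) = E1 f - E1 g.
Proof.
move=> tf tg; rewrite -(E2_E1 tf.1) -(E2_E1 tg.1) -E2B// E2_E1//.
exact: (tameB tf tg).1.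
Qed.

Lemma E1Z k f : tame1 f -> E1 (fun x => k * f x) = k * E1 f.
Proof.
move=> tf; rewrite -(E2_E1 tf.1) -E2Z// E2_E1//; exact: (tameZ k tf).1.
Qed.

Lemma E1_cst k : E1 (fun _ : V => k) = k.
Proof. by rewrite -(E2_E1 (f := fun=> k)) ?E2_cst//; exact: (tame_cst k).1. Qed.

Lemma E1_sum (I : Type) (r : seq I) (F : I -> V -> R) : (forall i, tame1 (F i)) ->
  E1 (fun x => \sum_(i <- r) F i x) = \sum_(i <- r) E1 (F i).
Proof.
move=> tF; rewrite -E2_E1; last exact: (tame_sum r tF).1.
by rewrite (E2_sum r tF); apply: eq_bigr => i _; rewrite E2_E1//; exact: (tF i).1.
Qed.

Lemma E1_le f g : tame1 f -> tame1 g -> (forall x, f x <= g x) -> E1 f <= E1 g.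
Proof.
by move=> tf tg fg; rewrite -(E2_E1 tf.1) -(E2_E1 tg.1); exact: E2_le.
Qed.

Lemma E1_ge0 f : (forall x, 0 <= f x) -> 0 <= E1 f.
Proof. by move=> f0; apply: Rintegral_ge0. Qed.

Lemma E1_norm_le f g : tame1 f -> tame1 g -> (forall x, `|f x| <= g x) ->
  `|E1 f| <= E1 g.
Proof.
by move=> tf tg fg; rewrite -(E2_E1 tf.1) -(E2_E1 tg.1); exact: E2_norm_le.
Qed.

Lemma tame1_affine f u a : tame1 f -> tame1 (fun y => f (u + a *: y)).
Proof.
move=> /(@tame_lift _ _ f u a 0).
by under eq_fun do under eq_fun do rewrite scale0r addr0.
Qed.

Lemma tame1_abs f : tame1 f -> tame1 (fun x => `|f x|).
Proof.
case=> mf [C [c [C0 c0 fC]]]; split; first exact: measurableT_comp.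
by exists C, c; split => // x y; rewrite normr_id.
Qed.

(** Sine of the angle whose cosine is a: for independent standard Gaussian X and Y, a X + cosin a Y
    is standard Gaussian and has correlation a with X. *)
Definition cosin (a : R) := Num.sqrt (1 - a ^+ 2).

Lemma cosin_ge0 a : 0 <= cosin a. Proof. exact: sqrtr_ge0. Qed.

Lemma sqr_le1 (a : R) : -1 <= a <= 1 -> 0 <= 1 - a ^+ 2.
Proof. by move=> /andP[a1 a2]; nra. Qed.

Lemma cosin_sqr a : -1 <= a <= 1 -> cosin a ^+ 2 = 1 - a ^+ 2.
Proof. by move=> /sqr_le1 a1; rewrite sqr_sqrtr. Qed.

Lemma cosinD a : -1 <= a <= 1 -> a ^+ 2 + cosin a ^+ 2 = 1.
Proof. by move=> /cosin_sqr ->; rewrite addrC subrK. Qed.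

Lemma cosinN a : cosin (- a) = cosin a. Proof. by rewrite /cosin sqrrN. Qed.

Lemma cosin1 : cosin 1 = 0. Proof. by rewrite /cosin expr1n subrr sqrtr0. Qed.

(** Mehler's formula for the Ornstein-Uhlenbeck semigroup; for 0 < a <= 1 the time is - ln a. *)
Definition OU (a : R) f x := E1 (fun y => f (a *: x + cosin a *: y)).

Definition corr f g (a : R) := E2 (fun x y => f x * g (a *: x + cosin a *: y)).

Lemma lip_OU L a f : lipf L f -> lipf (`|a| * L) (OU a f).
Proof.
move=> fL x y; have tf := tame_lip fL.
rewrite /OU -E1B; [|exact: tame1_affine|exact: tame1_affine].
rewrite -[leRHS]E1_cst; apply: E1_norm_le; first by apply: tameB; exact: tame1_affine.
  exact: tame_cst.
move=> z; apply: le_trans (fL _ _) _.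
by rewrite opprD addrACA subrr addr0 -scalerBr N1Z mulrCA mulrA.
Qed.

Lemma tame_OU L a f : lipf L f -> tame1 (OU a f).
Proof. by move=> /(lip_OU a)/tame_lip. Qed.

Lemma corr_OU L L' f g a : lipf L f -> lipf L' g ->
  corr f g a = E1 (fun x => f x * OU a g x).
Proof.
move=> fL gL; have tf := tame_lip fL; have tg := tame_lip gL.
rewrite /corr E2_fubini; last by apply: tameM => //; exact: tame_lin.
by apply: eq_E1 => x; rewrite E1Z//; exact: tame1_affine.
Qed.

Lemma corr_sym f g a : tame1 f -> tame1 g -> -1 <= a <= 1 -> corr f g a = corr g f a.
Proof.
move=> tf tg a1; rewrite /corr.
rewrite -(@E2_reflection _ _ a (cosin a) (fun x y => f x * g (a *: x + cosin a *: y))).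
- apply: eq_E2 => x y; rewrite mulrC; congr (g _ * _).
  apply/colP => i; rewrite !mxE; have := cosinD a1; move: (cosin a) => s e.
  transitivity ((a ^+ 2 + s ^+ 2) * x i 0); first by ring.
  by rewrite e mul1r.
- by apply: (tameM tf _).1; exact: tame_lin.
- exact: cosinD.
Qed.

(** The two independent Gaussian terms have scales b cosin a and cosin b, whose squares add up to 1
    - (a b)^2; a reflection merges them into a single Gaussian of scale r. *)
Lemma OU_OU L a b f x : lipf L f -> -1 <= a <= 1 -> -1 <= b <= 1 ->
  OU a (OU b f) x = OU (a * b) f x.
Proof.
move=> fL a1 b1; have tf := tame_lip fL.
pose r := cosin (a * b).
have rE : (b * cosin a) ^+ 2 + cosin b ^+ 2 = r ^+ 2.
  rewrite /r [in RHS]cosin_sqr; last by move: a1 b1 => /andP[? ?] /andP[? ?]; apply/andP; nra.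
  by rewrite exprMn (cosin_sqr a1) (cosin_sqr b1); ring.
transitivity (E2 (fun y y' => f ((a * b) *: x + (b * cosin a) *: y + cosin b *: y'))).
  rewrite E2_fubini; last exact: tame_lift.
  apply: eq_E1 => y; apply: eq_E1 => y'.
  by rewrite scalerDr !scalerA (mulrC b a).
(* The reflection has coefficients divided by r; when r = 0 both Gaussian terms are absent. *)
have [r0|r0] := eqVneq r 0.
  have [c0 s0] : b * cosin a = 0 /\ cosin b = 0.
    move: rE; rewrite r0 expr0n/= => /eqP; rewrite paddr_eq0 ?sqr_ge0// !sqrf_eq0.
    by move=> /andP[/eqP -> /eqP ->].
  rewrite c0 s0 /OU -/r r0 -E2_E1; last exact: (tame1_affine _ _ tf).1.
  by apply: eq_E2 => y y'; rewrite !scale0r !addr0.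
transitivity (E2 (fun y (_ : V) => f ((a * b) *: x + r *: y))); last first.
  by rewrite E2_E1//; exact: (tame1_affine _ _ tf).1.
rewrite -(@E2_reflection _ _ (b * cosin a / r) (cosin b / r)
  (fun y _ => f ((a * b) *: x + r *: y))).
- apply: eq_E2 => y y'; rewrite -addrA scalerDr !scalerA; congr (f (_ + (_ *: _ + _ *: _))).
    by rewrite mulrCA divff ?mulr1.
  by rewrite mulrCA divff ?mulr1.
- exact: (tame1_affine _ _ tf).1.
- by rewrite !expr_div_n -mulrDl rE divff// sqrf_eq0.
Qed.

(** The semigroup property puts [OU b] on g; exchangeability of the correlated pair then makes g the
    factor conditioned upon, so that [OU a] falls on f. *)
Lemma corr_split L L' f g a b : lipf L f -> lipf L' g ->
  -1 <= a <= 1 -> -1 <= b <= 1 ->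
  corr f g (a * b) = E1 (fun x => OU a f x * OU b g x).
Proof.
move=> fL gL a1 b1; have lg := lip_OU b gL.
transitivity (corr f (OU b g) a).
  rewrite (corr_OU _ fL gL) (corr_OU _ fL lg).
  by apply: eq_E1 => x; rewrite (OU_OU _ gL a1 b1).
rewrite corr_sym//; [|exact: tame_lip fL|exact: tame_OU gL].
rewrite (corr_OU _ lg fL); apply: eq_E1 => x; exact: mulrC.
Qed.

Lemma corr1 f g : tame1 f -> tame1 g -> corr f g 1 = E1 (fun x => f x * g x).
Proof.
move=> tf tg; rewrite -E2_E1; last exact: (tameM tf tg).1.
by apply: eq_E2 => x y; rewrite cosin1 scale0r addr0 scale1r.
Qed.

Lemma E2_marginal f a : tame1 f -> -1 <= a <= 1 ->
  E2 (fun x y => f (a *: x + cosin a *: y)) = E1 f.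
Proof.
move=> tf a1; rewrite -(E2_E1 tf.1).
by rewrite -[RHS](@E2_reflection _ _ a (cosin a) (fun x _ => f x) tf.1)//; exact: cosinD.
Qed.

(* The pair (x, r x + cosin r y) is exchangeable. *)
Lemma corr_incr f g r : tame1 f -> tame1 g -> -1 <= r <= 1 ->
  corr f g 1 - corr f g r = 2^-1 *
  E2 (fun x y => (f x - f (r *: x + cosin r *: y)) * (g x - g (r *: x + cosin r *: y))).
Proof.
move=> tf tg r1.
have tfh := tame_lin r (cosin r) tf; have tgh := tame_lin r (cosin r) tg.
have e : corr f g 1 = E2 (fun x y => f (r *: x + cosin r *: y) * g (r *: x + cosin r *: y)).
  by rewrite corr1// (@E2_marginal (fun x => f x * g x))//; exact: tameM.
have -> : E2 (fun x y => (f x - f (r *: x + cosin r *: y)) * (g x - g (r *: x + cosin r *: y)))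
  = E2 (fun x y => (f x * g x + f (r *: x + cosin r *: y) * g (r *: x + cosin r *: y))
     - (f x * g (r *: x + cosin r *: y) + g x * f (r *: x + cosin r *: y))).
  by apply: eq_E2 => x y; ring.
rewrite E2B; [|by apply: tameD; exact: tameM|by apply: tameD; exact: tameM].
rewrite E2D; [|exact: tameM|exact: tameM].
rewrite E2D; [|exact: tameM|exact: tameM].
rewrite -e (E2_E1 (f := fun x => f x * g x)); last exact: (tameM tf tg).1.
rewrite -(corr1 tf tg) -/(corr f g r) -/(corr g f r) (corr_sym tg tf r1).
by move: (corr f g r) (corr f g 1) => u v; field.
Qed.

(** Writing r eta = sqrt eta * (r sqrt eta) shares the smoothing equally between f and g, and leaves
    the correlation r between the smoothed functions. *)
Lemma corr_scale L L' f g (eta r : R) : lipf L f -> lipf L' g ->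
  0 <= eta <= 1 -> -1 <= r <= 1 ->
  corr f g (r * eta) = corr (OU (Num.sqrt eta) f) (OU (Num.sqrt eta) g) r.
Proof.
move=> fL gL /andP[eta0 eta1] r1; set a := Num.sqrt eta.
have a01 : 0 <= a <= 1 by rewrite sqrtr_ge0/= -sqrtr1 ler_sqrt.
have a1 : -1 <= a <= 1 by move: a01 => /andP[? ?]; apply/andP; split; lra.
have ra1 : -1 <= r * a <= 1.
  by move: a01 r1 => /andP[? ?] /andP[? ?]; apply/andP; split; nra.
have -> : r * eta = a * (r * a) by rewrite mulrCA -expr2 sqr_sqrtr.
rewrite (corr_split fL gL a1 ra1) (corr_OU _ (lip_OU a fL) (lip_OU a gL)).
by apply: eq_E1 => x; rewrite (OU_OU _ gL r1 a1).
Qed.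

Lemma corr_incr_scale L L' f g (eta r : R) : lipf L f -> lipf L' g ->
  0 <= eta <= 1 -> -1 <= r <= 1 ->
  corr f g eta - corr f g (r * eta) =
  2^-1 * E2 (fun x y => let h := r *: x + cosin r *: y in
    (OU (Num.sqrt eta) f x - OU (Num.sqrt eta) f h) *
    (OU (Num.sqrt eta) g x - OU (Num.sqrt eta) g h)).
Proof.
move=> fL gL eta1 r1.
have := corr_scale fL gL eta1 r1; have := @corr_scale _ _ _ _ _ 1 fL gL eta1.
rewrite mul1r => -> ; last by apply/andP; split; lra.
by move=> ->; apply: corr_incr => //; [exact: tame_OU fL|exact: tame_OU gL].
Qed.

Lemma corr_opp f g a : tame1 f -> tame1 g ->
  corr f g (- a) = corr f (fun x => g (- x)) a.
Proof.
move=> tf tg.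
rewrite /corr -(@E2_reflection _ _ 1 0 (fun x y => f x * g (- (a *: x + cosin a *: y)))).
- apply: eq_E2 => x y; rewrite cosinN; congr (f _ * g _); apply/colP => i; rewrite !mxE; ring.
- apply: (tameM tf _).1.
  have := tame_lin (- a) (- cosin a) tg.
  by under eq_fun do under eq_fun do rewrite !scaleNr -opprD.
- by rewrite expr1n expr0n addr0.
Qed.

Lemma lip_opp L f : lipf L f -> lipf L (fun x => f (- x)).
Proof.
move=> fL x y; apply: le_trans (fL _ _) _.
by rewrite -opprD N1N.
Qed.

(** The displacement of x to r x + s y is of order sqrt (1 - r), so its square is linear in 1 - r;
    this turns a product of two increments into a Lipschitz bound. *)
Lemma sqr_displacement (n X Y s r : R) : -1 <= r <= 1 -> 0 <= n -> 0 <= X ->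
  0 <= Y -> 0 <= s -> s ^+ 2 = 1 - r ^+ 2 -> n <= (1 - r) * X + s * Y ->
  n ^+ 2 <= 4 * (1 - r) * (X ^+ 2 + Y ^+ 2).
Proof.
move=> /andP[r1 r2] n0 X0 Y0 s0 s2 le.
have r0 : 0 <= 1 - r by lra.
have nn : n ^+ 2 <= ((1 - r) * X + s * Y) ^+ 2.
  by rewrite lerXn2r ?nnegrE//; exact: le_trans le.
apply: le_trans nn _.
apply: (@le_trans _ _ (2 * ((1 - r) ^+ 2 * X ^+ 2 + s ^+ 2 * Y ^+ 2))).
  rewrite -subr_ge0 (_ : _ - _ = ((1 - r) * X - s * Y) ^+ 2) ?sqr_ge0//; ring.
rewrite s2 -subr_ge0.
rewrite (_ : _ - _ = 2 * ((1 - r) * ((1 + r) * X ^+ 2 + (1 - r) * Y ^+ 2))); last by ring.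
rewrite mulr_ge0// mulr_ge0// addr_ge0// mulr_ge0 ?sqr_ge0//; lra.
Qed.

(** The factor 2 is the 4 of [sqr_displacement] times the 2^-1 of [corr_incr]. *)
Definition K2 : R := 2 * E2 (fun x y : V => N1 x ^+ 2 + N1 y ^+ 2).

Lemma tame_N1n n : tame (fun (x _ : V) => N1 x ^+ n).
Proof.
elim: n => [|n IH]; first exact: tame_cst.
rewrite (_ : (fun x _ => _) = (fun (x _ : V) => N1 x * N1 x ^+ n)).
  by apply: tameM => //; exact: tame_N1.
by apply/funext => x; apply/funext => y; rewrite exprS.
Qed.

Lemma tame_N1s n : tame (fun (x y : V) => N1 x ^+ n + N1 y ^+ n).
Proof.
by apply: tameD; [exact: tame_N1n|exact: (tame_snd (f := fun x => N1 x ^+ n) (tame_N1n n))].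
Qed.

(** With r = eta' / eta, each of the two smoothed factors gains sqrt eta in its Lipschitz constant,
    and eta (1 - r) = eta - eta': the division by eta is exactly compensated. *)
Lemma corr_lip_le L L' f g eta eta' : 0 <= L -> 0 <= L' -> lipf L f -> lipf L' g ->
  0 <= eta <= 1 -> - eta <= eta' <= eta ->
  `|corr f g eta - corr f g eta'| <= L * L' * K2 * (eta - eta').
Proof.
move=> L0 L'0 fL gL eta1 /andP[eta'1 eta'2].
have [eta0|eta0] := eqVneq eta 0.
  have -> : eta' = 0 by move: eta'1 eta'2; rewrite eta0; lra.
  by rewrite eta0 !subrr normr0 mulr0.
have etap : 0 < eta by rewrite lt_def eta0; case/andP: eta1.
pose r := eta' / eta.
have r1 : -1 <= r <= 1.
  by rewrite /r ler_pdivlMr// ler_pdivrMr// mulN1r mul1r; apply/andP.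
have eta'E : eta' = r * eta by rewrite /r divfK.
rewrite eta'E (corr_incr_scale fL gL eta1 r1).
set a := Num.sqrt eta.
have a0 : 0 <= a by exact: sqrtr_ge0.
have aa : a ^+ 2 = eta by rewrite sqr_sqrtr// ltW.
have tfa := tame_OU a fL; have tga := tame_OU a gL.
pose h (x y : V) := r *: x + cosin r *: y.
rewrite normrM ger0_norm ?invr_ge0//.
rewrite [leRHS](_ : _ = 2^-1 * E2 (fun x y : V =>
   (2 * (L * L') * (eta - r * eta) * 2) * (N1 x ^+ 2 + N1 y ^+ 2))); last first.
  by rewrite E2Z /K2; [field|exact: tame_N1s].
rewrite ler_wpM2l ?invr_ge0//; apply: E2_norm_le.
- have tfh := tame_lin r (cosin r) tfa; have tgh := tame_lin r (cosin r) tga.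
  exact: (tameM (tameB tfa tfh) (tameB tga tgh)).
- exact: (tameZ _ (tame_N1s 2)).
move=> x y /=; rewrite normrM.
have Nh : N1 (x - h x y) ^+ 2 <= 4 * (1 - r) * (N1 x ^+ 2 + N1 y ^+ 2).
  have le : N1 (x - h x y) <= (1 - r) * N1 x + cosin r * N1 y.
    have -> : x - h x y = (1 - r) *: x - cosin r *: y.
      by apply/colP => i; rewrite !mxE; ring.
    apply: le_trans (N1B _ _) _; rewrite !N1Z !ger0_norm ?cosin_ge0//.
    by case/andP: r1; lra.
  exact: (sqr_displacement r1 (N1_ge0 _) (N1_ge0 _) (N1_ge0 _) (cosin_ge0 r) (cosin_sqr r1) le).
apply: (@le_trans _ _ ((a * L * N1 (x - h x y)) * (a * L' * N1 (x - h x y)))).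
  apply: ler_pM => //.
    by apply: le_trans (lip_OU a fL _ _) _; rewrite ger0_norm.
  by apply: le_trans (lip_OU a gL _ _) _; rewrite ger0_norm.
have -> : a * L * N1 (x - h x y) * (a * L' * N1 (x - h x y)) =
    L * L' * eta * N1 (x - h x y) ^+ 2.
  transitivity (L * L' * a ^+ 2 * N1 (x - h x y) ^+ 2); last by rewrite aa.
  by move: (N1 (x - h x y)) => n; ring.
rewrite [leRHS](_ : _ = L * L' * eta * (4 * (1 - r) * (N1 x ^+ 2 + N1 y ^+ 2))); last by ring.
by rewrite ler_wpM2l// mulr_ge0 ?mulr_ge0//; exact: ltW.
Qed.

Lemma corr_lipschitz L L' f g eta eta' : 0 <= L -> 0 <= L' -> lipf L f -> lipf L' g ->
  -1 <= eta <= 1 -> -1 <= eta' <= 1 ->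
  `|corr f g eta - corr f g eta'| <= L * L' * K2 * `|eta - eta'|.
Proof.
move=> L0 L'0 fL gL.
wlog: eta eta' / `|eta'| <= `|eta| => [hw e e'|le e1 e1'].
  have [/hw|/ltW/hw] := leP `|eta'| `|eta|; first exact.
  by move=> /(_ e' e); rewrite distrC [in leRHS]distrC.
have [eta0|eta0] := leP 0 eta.
  have h : - eta <= eta' <= eta.
    by move: le; rewrite (ger0_norm eta0) ler_norml.
  rewrite [X in _ * X]ger0_norm; last by case/andP: h; lra.
  by apply: corr_lip_le => //; rewrite eta0; case/andP: e1.
have tf := tame_lip fL; have tg := tame_lip gL.
have -> : eta = - - eta by rewrite opprK.
have -> : eta' = - - eta' by rewrite opprK.
rewrite !(corr_opp _ tf tg).
have h : - (- eta) <= - eta' <= - eta.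
  by move: le; rewrite (ltr0_norm eta0) ler_norml opprK => /andP[? ?]; apply/andP; split; lra.
rewrite [X in _ * X](_ : _ = (- eta) - (- eta')); last first.
  by rewrite ler0_norm; [ring|case/andP: h; lra].
apply: corr_lip_le => //; first exact: lip_opp.
by case/andP: e1 => ? ?; apply/andP; split; lra.
Qed.
End ornstein_uhlenbeck.

(** * First-order expansion of the semigroup *)

Lemma expR_quad {R : realType} (t : R) : `|expR t - 1 - t| <= t ^+ 2 * expR `|t|.
Proof.
have h1 := expR_ge1Dx t.
have h2 : expR t * (1 - t) <= 1.
  have := expR_ge1Dx (- t); rewrite expRN => h.
  have := ler_wpM2l (expR_ge0 t) h; rewrite divff ?gt_eqF ?expR_gt0//.
have e1 : 1 <= expR `|t| by rewrite -expR0 ler_expR.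
rewrite ger0_norm; last lra.
have [t0|t0] := leP 0 t.
  move: e1; rewrite ger0_norm// => e1.
  move: (expR t) h1 h2 e1 => e *; nra.
apply: (@le_trans _ _ (t ^+ 2)); last by rewrite ler_peMr// sqr_ge0.
move: (expR t) h1 h2 => e *; nra.
Qed.

(** Identifies first-order coefficients in two expansions of the same quantity, in place of
    differentiation under the expectation. *)
Lemma small_quadratic {R : realType} (d C : R) :
  (forall t, 0 < t <= 1 -> `|t * d| <= C * t ^+ 2) -> d = 0.
Proof.
move=> h; apply/eqP; rewrite -normr_le0; apply/ler_addgt0Pr => e e0; rewrite add0r.
pose t := Num.min 1 (e / (`|C| + 1)).
have C1 : 0 < `|C| + 1 by rewrite ltr_pwDr.
have t0 : 0 < t by rewrite lt_min ltr01 divr_gt0.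
have := h t; rewrite t0 ge_min lexx => /(_ isT).
rewrite normrM gtr0_norm// expr2 mulrA (mulrC t) ler_pM2r//= => hd.
apply: le_trans hd _; apply: (@le_trans _ _ (`|C| * t)).
  by rewrite ler_wpM2r ?ler_norm// ltW.
have te : t * (`|C| + 1) <= e.
  by rewrite -ler_pdivlMr// ge_min lexx orbT.
by apply: le_trans te; rewrite mulrC ler_wpM2l ?lerDl// ltW.
Qed.

Section gaussian_taylor.
Context {R : realType} {p : nat}.
Local Notation V := 'cV[R]_p.
Implicit Types (f g : V -> R).

(** Remainder of the expansion of [cmw z k] in z. For N1 z <= 1 the exponent is at most N1 z (N1 k +
    1), whence the first summand; the final 1 pays for the term |z|^2 / 2 of the exponent. *)
Definition cm_rem (k : V) : R := (N1 k + 1) ^+ 2 * expR (N1 k + 1) + 1.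

Lemma tame_cm_rem : tame1 cm_rem.
Proof.
apply: tameD; last exact: tame_cst.
rewrite (_ : (fun x _ => _) =
  (fun (x _ : V) => (N1 x + 1) * (N1 x + 1) * (expR 1 * expR (1 * N1 x)))).
  apply: tameM; last by apply: tameZ; exact: tame_expN1.
  by apply: tameM; apply: tameD; [exact: tame_N1|exact: tame_cst
    |exact: tame_N1|exact: tame_cst].
by apply/funext => x; apply/funext => y; rewrite expr2 -expRD mul1r addrC.
Qed.

Lemma cm_rem_ge0 k : 0 <= cm_rem k.
Proof. by rewrite addr_ge0// mulr_ge0 ?sqr_ge0 ?expR_ge0. Qed.

Lemma sum_coord_le (z k : V) : `|\sum_i z i 0 * k i 0| <= N1 z * N1 k.
Proof.
apply: le_trans (ler_norm_sum _ _ _) _; rewrite /N1 mulr_suml.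
by apply: ler_sum => i _; rewrite normrM ler_wpM2l//; exact: (coord_le_N1 k i).
Qed.

Lemma sum_sqr_le (z : V) : \sum_i z i 0 ^+ 2 <= N1 z ^+ 2.
Proof.
rewrite expr2 {1}/N1 mulr_suml; apply: ler_sum => i _.
by rewrite -real_normK ?num_real// expr2 ler_wpM2l//; exact: (coord_le_N1 z i).
Qed.

Lemma cmw_taylor z k : N1 z <= 1 ->
  `|cmw z k - 1 - \sum_i z i 0 * k i 0| <= N1 z ^+ 2 * cm_rem k.
Proof.
move=> z1; rewrite /cmw sumrB.
set s := \sum_i z i 0 * k i 0.
have -> : \sum_i z i 0 ^+ 2 / 2 = (\sum_i z i 0 ^+ 2) / 2 by rewrite mulr_suml.
set q := \sum_i z i 0 ^+ 2.
have q0 : 0 <= q by apply: sumr_ge0 => i _; exact: sqr_ge0.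
have qN : q <= N1 z ^+ 2 by exact: sum_sqr_le.
have sN : `|s| <= N1 z * N1 k by exact: sum_coord_le.
have z0 := N1_ge0 z; have k0 := N1_ge0 k.
have tN : `|s - q / 2| <= N1 z * (N1 k + 1).
  apply: le_trans (ler_normB _ _) _; rewrite (ger0_norm (x := q / 2)); last by rewrite divr_ge0.
  rewrite mulrDr mulr1 lerD//; move: (N1 z) z0 z1 qN => n *; nra.
apply: (@le_trans _ _ (`|expR (s - q / 2) - 1 - (s - q / 2)| + `|q / 2|)).
  apply: le_trans (ler_normB _ _); rewrite le_eqVlt; apply/orP; left; apply/eqP.
  by congr `| _ |; ring.
rewrite /cm_rem mulrDr mulr1; apply: lerD; last first.
  by rewrite ger0_norm ?divr_ge0//; lra.
apply: le_trans (expR_quad _) _; rewrite mulrA -exprMn; apply: ler_pM.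
- exact: sqr_ge0.
- exact: expR_ge0.
- by rewrite -real_normK ?num_real// lerXn2r ?nnegrE// mulr_ge0// addr_ge0.
- rewrite ler_expR; apply: le_trans tN _.
  by rewrite ler_piMl// addr_ge0.
Qed.

Lemma tame_fcoord f i : tame1 f -> tame1 (fun k => f k * k i 0).
Proof. by move=> tf; apply: tameM => //; exact: tame_coord. Qed.

(** No regularity of f enters: the translation is moved to the Gaussian density, and it is the
    density that is expanded. The linear term is Gaussian integration by parts. *)
Lemma E1_taylor f g z : tame1 f -> tame1 g -> (forall k, `|f k| <= g k) ->
  N1 z <= 1 ->
  `|E1 (fun k => f (k + z)) - E1 f - \sum_i z i 0 * E1 (fun k => f k * k i 0)|
   <= N1 z ^+ 2 * E1 (fun k => g k * cm_rem k).
Proof.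
move=> tf tg fg z1; rewrite (E1_shift z tf).
have tfw : tame1 (fun k => f k * cmw z k) by apply: tameM => //; exact: tame_cmw.
have tS : tame1 (fun k => \sum_i z i 0 * (f k * k i 0)).
  by apply: (@tame_sum R p _ _ (fun i k _ => z i 0 * (f k * k i 0))) => i; exact: tameZ (tame_fcoord i tf).
have -> : \sum_i z i 0 * E1 (fun k => f k * k i 0) =
    E1 (fun k => \sum_i z i 0 * (f k * k i 0)).
  rewrite E1_sum => [|i]; last exact: tameZ (tame_fcoord i tf).
  by apply: eq_bigr => i _; rewrite E1Z//; exact: tame_fcoord.
have tgr : tame1 (fun k => g k * cm_rem k) by apply: tameM => //; exact: tame_cm_rem.
rewrite -E1B// -E1B//; last exact: tameB.
rewrite -E1Z//; apply: E1_norm_le.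
- by apply: tameB => //; exact: tameB.
- exact: tameZ.
- move=> k; have -> : f k * cmw z k - f k - \sum_i z i 0 * (f k * k i 0) =
    f k * (cmw z k - 1 - \sum_i z i 0 * k i 0).
    rewrite !mulrBr mulr1 mulr_sumr; congr (_ - _).
    by apply: eq_bigr => i _; rewrite mulrCA.
  by rewrite normrM mulrCA; apply: ler_pM => //; exact: cmw_taylor.
Qed.

Lemma E1_opp f : tame1 f -> E1 (fun x => f (- x)) = E1 f.
Proof.
move=> tf; have tfN : tame1 (fun x => f (- x)).
  have := tame1_affine 0 (-1) tf.
  by rewrite /tame1; under eq_fun do under eq_fun do rewrite add0r scaleN1r.
rewrite -(E2_E1 tf.1) -(E2_E1 tfN.1).
rewrite -[RHS](@E2_reflection _ _ (-1) 0 (fun x _ => f x) tf.1).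
  by apply: eq_E2 => x y; rewrite scale0r addr0 scaleN1r.
by rewrite sqrrN expr1n expr0n addr0.
Qed.

Lemma E1_coord i : E1 (fun x : V => x i 0) = 0.
Proof.
have h := E1_opp (tame_coord i).
have : E1 (fun x : V => x i 0) = - E1 (fun x : V => x i 0).
  rewrite -{1}h -mulN1r -E1Z; last exact: tame_coord.
  by apply: eq_E1 => x; rewrite mxE mulN1r.
lra.
Qed.

(** The mean of k_i after translation by t e_j is known exactly; comparison with its first-order
    expansion yields the covariance without computing a moment integral. *)
Lemma E1_coord2 i j : E1 (fun x : V => x i 0 * x j 0) = (i == j)%:R.
Proof.
have tc := tame_coord (R := R) i.
have tca := tame1_abs tc.
apply/eqP; rewrite -subr_eq0; apply/eqP.
apply: (@small_quadratic _ _ (E1 (fun k : V => `|k i 0| * cm_rem k))) => t /andP[t0 t1].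
pose z : V := t *: delta_mx j 0.
have zE l : z l 0 = t * (l == j)%:R by rewrite !mxE eqxx andbT.
have Nz : N1 z = t.
  rewrite /N1 (bigD1 j)//= big1 => [|l lj]; last by rewrite zE (negbTE lj) mulr0 normr0.
  by rewrite zE eqxx mulr1 addr0 gtr0_norm.
have := @E1_taylor (fun k => k i 0) (fun k => `|k i 0|) z tc tca (fun=> lexx _).
rewrite Nz => /(_ t1); rewrite E1_coord subr0.
rewrite (bigD1 j)//= big1 => [|l lj]; last by rewrite zE (negbTE lj) mulr0 mul0r.
rewrite zE eqxx mulr1 addr0.
have -> : E1 (fun k => (k + z) i 0) = t * (i == j)%:R.
  transitivity (E1 (fun k : V => k i 0 + z i 0)).
    by apply: eq_E1 => k; rewrite mxE.
  rewrite E1D; [|exact: tc|exact: tame_cst].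
  by rewrite E1_coord E1_cst add0r zE.
by move=> h; rewrite mulrBr distrC [leRHS]mulrC.
Qed.

(** The partial derivative of [OU a f] after integration by parts, hence meaningful for
    nondifferentiable f. The prefactor converts a translation of x into one of the Gaussian
    variable. *)
Definition dOU (a : R) f j x :=
  a / cosin a * E1 (fun k => f (a *: x + cosin a *: k) * k j 0).

(** Covers both regimes of [OU_taylor]: the first term serves small displacements, the other two
    serve large ones. *)
Definition Ct : R := E1 (fun k : V => N1 k * cm_rem k) + 1 + E1 (fun k : V => N1 k ^+ 2).
Definition Cm : R := E1 (fun k : V => N1 k ^+ 2).

Lemma Cm_ge0 : 0 <= Cm. Proof. by apply: E1_ge0 => x; exact: sqr_ge0. Qed.

Lemma Ct_ge0 : 0 <= Ct.
Proof.
by rewrite !addr_ge0 ?Cm_ge0//; apply: E1_ge0 => x; rewrite mulr_ge0 ?N1_ge0 ?cm_rem_ge0.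
Qed.

(** Coordinates have mean zero, so a constant may be subtracted; the Lipschitz bound on the
    difference then brings a factor [cosin a] that cancels the denominator. *)
Lemma dOU_center L a f j x : lipf L f -> dOU a f j x =
  a / cosin a * E1 (fun k => (f (a *: x + cosin a *: k) - f (a *: x)) * k j 0).
Proof.
move=> fL; have tf := tame1_affine (a *: x) (cosin a) (tame_lip fL).
congr (_ * _); transitivity (E1 (fun k => f (a *: x + cosin a *: k) * k j 0 - f (a *: x) * k j 0)).
  rewrite E1B; [|exact: tame_fcoord|by apply: tameZ; exact: tame_coord].
  by rewrite E1Z ?E1_coord ?mulr0 ?subr0//; exact: tame_coord.
by apply: eq_E1 => k; rewrite mulrBl.
Qed.

Lemma cosin_gt0 a : 0 <= a < 1 -> 0 < cosin a :> R.
Proof. by move=> /andP[a0 a1]; rewrite sqrtr_gt0 subr_gt0 expr_lt1. Qed.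

Lemma dOU_le L a f j x : lipf L f -> 0 <= L -> 0 <= a < 1 -> `|dOU a f j x| <= a * L * Cm.
Proof.
move=> fL L0 a01; have b0 := cosin_gt0 a01; have /andP[a0 a1] := a01.
rewrite (dOU_center _ _ _ fL) normrM ger0_norm ?divr_ge0 ?cosin_ge0//.
have tf : tame1 (fun k => f (a *: x + cosin a *: k) - f (a *: x)).
  by apply: tameB; [exact: tame1_affine (tame_lip fL)|exact: tame_cst].
have h : `|E1 (fun k => (f (a *: x + cosin a *: k) - f (a *: x)) * k j 0)| <=
    L * cosin a * Cm.
  rewrite /Cm -E1Z; last exact: tame_N1n.
  apply: E1_norm_le; [exact: tame_fcoord|by apply: tameZ; exact: tame_N1n|].
  move=> k; rewrite normrM expr2 mulrA; apply: ler_pM => //; last exact: coord_le_N1.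
  apply: le_trans (fL _ _) _; rewrite addrAC subrr add0r N1Z ger0_norm ?mulrA//.
  exact: ltW.
apply: le_trans (ler_wpM2l (divr_ge0 a0 (ltW b0)) h) _.
rewrite le_eqVlt; apply/orP; left; apply/eqP; field; exact: lt0r_neq0.
Qed.

Lemma dOU_lip L a f j : lipf L f -> 0 <= L -> 0 <= a < 1 ->
  lipf (a / cosin a * (L * a * E1 (fun k : V => N1 k))) (dOU a f j).
Proof.
move=> fL L0 a01 x x'; have b0 := cosin_gt0 a01; have /andP[a0 a1] := a01.
rewrite /dOU -mulrBr normrM ger0_norm ?divr_ge0 ?cosin_ge0// -[leRHS]mulrA.
rewrite ler_wpM2l ?divr_ge0 ?cosin_ge0//.
have tf y := tame_fcoord j (tame1_affine (a *: y) (cosin a) (tame_lip fL)).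
rewrite -E1B//.
rewrite (_ : L * a * _ * _ = L * a * N1 (x - x') * E1 (fun k : V => N1 k)); last by ring.
rewrite -E1Z; last exact: tame_N1.
apply: E1_norm_le; [exact: (tameB (tf x) (tf x'))|by apply: tameZ; exact: tame_N1|move=> k].
rewrite -mulrBl normrM; apply: ler_pM => //; last exact: coord_le_N1.
apply: le_trans (fL _ _) _.
by rewrite opprD addrACA subrr addr0 -scalerBr N1Z ger0_norm// mulrA.
Qed.

Lemma tame_dOU L a f j : lipf L f -> 0 <= L -> 0 <= a < 1 -> tame1 (dOU a f j).
Proof. by move=> fL L0 a01; apply: tame_lip (dOU_lip j fL L0 a01). Qed.

(** Translating x by y translates the Gaussian variable by z = (a / cosin a) y. If N1 z <= 1 the
    density is expanded; otherwise each term is bounded linearly in y, and a further factor N1 z > 1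
    makes the bound quadratic. *)
Lemma OU_taylor L a f x y : lipf L f -> 0 <= L -> 0 <= a < 1 ->
  `|OU a f (x + y) - OU a f x - \sum_j dOU a f j x * y j 0| <=
  L * (a ^+ 2 / cosin a) * Ct * N1 y ^+ 2.
Proof.
move=> fL L0 a01; have b0 := cosin_gt0 a01; have /andP[a0 a1] := a01.
set b := cosin a in b0 *.
pose fx k := f (a *: x + b *: k) - f (a *: x).
have tfx : tame1 fx.
  by apply: tameB; [exact: tame1_affine (tame_lip fL)|exact: tame_cst].
have tN : tame1 (fun k : V => L * b * N1 k) by apply: tameZ; exact: tame_N1.
have fxN k : `|fx k| <= L * b * N1 k.
  apply: le_trans (fL _ _) _; rewrite addrAC subrr add0r N1Z ger0_norm ?mulrA//.
  exact: ltW.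
have ab0 : 0 <= a / b by rewrite divr_ge0// ltW.
pose z := (a / b) *: y.
have Nz : N1 z = a / b * N1 y by rewrite N1Z ger0_norm.
have S : \sum_j dOU a f j x * y j 0 = \sum_j z j 0 * E1 (fun k => fx k * k j 0).
  apply: eq_bigr => j _; rewrite (dOU_center _ _ _ fL) /z mxE -/b -/fx.
  by rewrite mulrAC.
have y0 := N1_ge0 y.
have CN : 0 <= E1 (fun k : V => N1 k * cm_rem k).
  by apply: E1_ge0 => k; rewrite mulr_ge0 ?N1_ge0 ?cm_rem_ge0.
have [z1|z1] := leP (N1 z) 1.
- have dE : OU a f (x + y) - OU a f x = E1 (fun k => fx (k + z)) - E1 fx.
    have tf u := tame1_affine (a *: u) b (tame_lip fL).
    have e1 : E1 fx = OU a f x - f (a *: x).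
      by rewrite /fx (E1B (tf x) (tame_cst _)) E1_cst.
    have e2 : E1 (fun k => fx (k + z)) = OU a f (x + y) - f (a *: x).
      rewrite -[X in _ - X](@E1_cst R p) -(E1B (tf (x + y)) (tame_cst _)).
      apply: eq_E1 => k; rewrite /fx; congr (f _ - _).
      rewrite !scalerDr /z scalerA [b * _]mulrC divfK ?gt_eqF//.
      by rewrite -!addrA; congr (_ + _); rewrite addrC.
    by rewrite e1 e2; ring.
  rewrite dE S; apply: le_trans (E1_taylor tfx tN fxN z1) _.
  have -> : E1 (fun k : V => L * b * N1 k * cm_rem k) = L * b * E1 (fun k : V => N1 k * cm_rem k).
    rewrite -E1Z; last by apply: tameM; [exact: tame_N1|exact: tame_cm_rem].
    by apply: eq_E1 => k; rewrite mulrA.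
  rewrite Nz (_ : (a / b * N1 y) ^+ 2 * (L * b * _) =
     L * (a ^+ 2 / b) * N1 y ^+ 2 * E1 (fun k : V => N1 k * cm_rem k)); last first.
    by move: (E1 _) (N1 y) => u n; field; exact: lt0r_neq0.
  rewrite [leRHS]mulrAC ler_wpM2l//.
    by rewrite !mulr_ge0 ?sqr_ge0// invr_ge0 ltW.
  by rewrite /Ct -addrA lerDl addr_ge0// Cm_ge0.
- apply: (@le_trans _ _ (a * L * N1 y + a * L * Cm * N1 y)).
    apply: le_trans (ler_normB _ _) _; apply: lerD.
      apply: le_trans (lip_OU a fL _ _) _; rewrite ger0_norm// addrAC subrr add0r//.
    apply: le_trans (ler_norm_sum _ _ _) _; rewrite /N1 mulr_sumr.
    apply: ler_sum => j _; rewrite normrM ler_wpM2r//; exact: dOU_le.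
  apply: (@le_trans _ _ (a * L * (1 + Cm) * N1 y * N1 z)).
    rewrite (_ : _ + _ = a * L * (1 + Cm) * N1 y); last by ring.
    apply: ler_peMr; last exact: ltW.
    by rewrite !mulr_ge0// addr_ge0// Cm_ge0.
  rewrite Nz (_ : _ * (a / b * N1 y) = L * (a ^+ 2 / b) * (1 + Cm) * N1 y ^+ 2); last first.
    by field; exact: lt0r_neq0.
  rewrite ler_wpM2r ?sqr_ge0// ler_wpM2l//.
    by rewrite !mulr_ge0 ?sqr_ge0// invr_ge0 ltW.
  by rewrite /Ct -addrA lerDr.
Qed.
End gaussian_taylor.

(** * One-sided derivatives on an interval *)

Section difference_quotients.
Context {R : realType}.
Implicit Types (A B : set R) (f g F D : R -> R).

(** Derivative l of f at x relative to A, without a quotient: y = x need not be excluded, and unions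
    of sets and linear combinations are handled directly. *)
Definition dq A f x l := forall e, 0 < e -> exists2 d, 0 < d &
  forall y, A y -> `|y - x| < d -> `|f y - f x - l * (y - x)| <= e * `|y - x|.

Lemma dq_lin A f g x l m (a b : R) : dq A f x l -> dq A g x m ->
  dq A (fun y => a * f y + b * g y) x (a * l + b * m).
Proof.
move=> fl gm e e0.
pose k := `|a| + `|b| + 1.
have k0 : 0 < k by rewrite ltr_pwDr// addr_ge0.
have [d1 d10 h1] := fl (e / k) (divr_gt0 e0 k0).
have [d2 d20 h2] := gm (e / k) (divr_gt0 e0 k0).
exists (Num.min d1 d2); first by rewrite lt_min d10.
move=> y Ay; rewrite lt_min => /andP[/(h1 y Ay) {}h1 /(h2 y Ay) {}h2].
have -> : a * f y + b * g y - (a * f x + b * g x) - (a * l + b * m) * (y - x) =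
  a * (f y - f x - l * (y - x)) + b * (g y - g x - m * (y - x)) by ring.
apply: le_trans (ler_normD _ _) _; rewrite !normrM.
apply: le_trans (lerD (ler_wpM2l (normr_ge0 a) h1) (ler_wpM2l (normr_ge0 b) h2)) _.
rewrite -mulrDl mulrA ler_wpM2r// mulrA ler_pdivrMr// [leLHS]mulrC.
by rewrite ler_wpM2l ?lerDl// ltW.
Qed.

Lemma dq_opp A f x l : dq A f x l -> dq [set y | A (- y)] (fun y => f (- y)) (- x) (- l).
Proof.
move=> fl e /fl[d d0 h]; exists d => // y Ay; rewrite !opprK => yx.
have := h _ Ay; rewrite -opprD normrN => /(_ yx).
by rewrite mulrN mulNr.
Qed.

Lemma dq_setU A B f x l : dq A f x l -> dq B f x l -> dq (A `|` B) f x l.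
Proof.
move=> fA fB e e0; have [d1 d10 h1] := fA e e0; have [d2 d20 h2] := fB e e0.
exists (Num.min d1 d2); first by rewrite lt_min d10.
by move=> y [Ay|By]; rewrite lt_min => /andP[? ?]; [exact: h1|exact: h2].
Qed.

Lemma dq_sub A B f x l : B `<=` A -> dq A f x l -> dq B f x l.
Proof. by move=> BA fl e /fl[d d0 h]; exists d => // y /BA; exact: h. Qed.

Lemma dq_eq A f g x l : {in A, f =1 g} -> A x -> dq A f x l -> dq A g x l.
Proof.
move=> fg Ax fl e /fl[d d0 h]; exists d => // y Ay yx.
by rewrite -!fg ?inE//; exact: h.
Qed.

Lemma dq_local A B f x l r : 0 < r -> (forall y, A y -> `|y - x| < r -> B y) ->
  dq B f x l -> dq A f x l.
Proof.
move=> r0 AB fl e /fl[d d0 h]; exists (Num.min d r); first by rewrite lt_min d0.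
by move=> y Ay; rewrite lt_min => /andP[yd yr]; apply: h => //; exact: AB.
Qed.

Lemma dq_derivable_within A f :
  (forall x, A x -> exists l, dq A f x l) -> derivable_within A f.
Proof.
move=> h x /h[l fl]; apply/cvg_ex; exists l; apply/cvgrPdist_le => e e0.
have [d d0 hd] := fl e e0.
rewrite near_withinE; near=> y => Ay.
have yx : y != x by near: y; exact: nbhs_dnbhs_neq.
have yd : `|y - x| < d.
  near: y; apply: nbhs_dnbhs; exists d => // z /=; rewrite distrC//.
have := hd y Ay yd; rewrite -ler_pdivrMr ?normr_gt0 ?subr_eq0//.
rewrite -normfV -normrM distrC; congr (`| _ | <= e).
by rewrite mulrBl mulfK ?subr_eq0.
Unshelve. all: by end_near.
Qed.

(** The form in which correlations are expanded: the slope is taken at the right end point y,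
    because x = r y with r <= 1, and the error of order 3/2 is the cube of [cosin r]. Nothing is
    said about continuity of D. *)
Definition left_est F D lo hi := exists2 C, 0 <= C & forall x y, lo <= x ->
  x < y -> y <= hi -> `|F y - F x - (y - x) * D y| <= C * ((y - x) * Num.sqrt (y - x)).

(** On the left of z the estimate is the claim. For y = z + t, the estimates on [z - t, z],
    [z, z + t] and [z - t, z + t] combine so that D y drops out, which spares continuity of D. *)
Lemma left_est_dq F D lo hi z : left_est F D lo hi -> lo < z < hi -> dq setT F z (D z).
Proof.
move=> [C C0 h] /andP[loz zhi] e e0.
(* The three estimates contribute 2 C, C and 4 C; the excess over 7 C keeps k positive. *)
pose k := 8 * C + 1.
have k0 : 0 < k by rewrite /k; lra.
pose d := Num.min (Num.min (z - lo) (hi - z)) ((e / k) ^+ 2).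
have d0 : 0 < d by rewrite !lt_min !subr_gt0 loz zhi exprn_gt0// divr_gt0.
exists d => // y _; rewrite !lt_min => /andP[/andP[y1 y2] y3].
have ek0 : 0 <= e / k by rewrite divr_ge0// ltW.
have sq : Num.sqrt `|y - z| * k <= e.
  rewrite -ler_pdivlMr// -[leRHS](ger0_norm ek0) -[leRHS]sqrtr_sqr ler_sqrt ?sqr_ge0//.
  exact: ltW.
have [yz|yz|->] := ltgtP y z; last first.
- by rewrite !subrr normr0 mulr0 mulr0 subrr normr0.
- rewrite gtr0_norm ?subr_gt0// in sq y1 y2 *.
  set t := y - z in sq y1 y2 *.
  have t0 : 0 < t by rewrite subr_gt0.
  pose x := z - t.
  have e1 := h x y; have e2 := h z y; have e3 := h x z.
  have {}e1 := e1 ltac:(rewrite /x; lra) ltac:(rewrite /x; lra) ltac:(move: y2; rewrite /t; lra).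
  have {}e2 := e2 (ltW loz) yz ltac:(move: y2; rewrite /t; lra).
  have {}e3 := e3 ltac:(rewrite /x; lra) ltac:(rewrite /x; lra) (ltW zhi).
  have yx : y - x = 2 * t by rewrite /x /t; ring.
  have zx : z - x = t by rewrite /x; ring.
  rewrite yx in e1; rewrite zx in e3; rewrite -/t in e2.
  have s2 : Num.sqrt (2 * t) <= 2 * Num.sqrt t.
    rewrite (_ : 2 * _ = Num.sqrt (2 ^+ 2 * t)).
      by rewrite ler_sqrt ?mulr_ge0 ?sqr_ge0 ?ltW//; lra.
    by rewrite sqrtrM ?sqr_ge0// sqrtr_sqr ger0_norm.
  have e1' : `|F y - F x - 2 * t * D y| <= C * (4 * (t * Num.sqrt t)).
    apply: le_trans e1 _; rewrite ler_wpM2l// (_ : 4 * _ = 2 * t * (2 * Num.sqrt t)); last by ring.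
    by rewrite ler_wpM2l// mulr_ge0// ltW.
  have -> : F y - F z - D z * t = 2 * (F y - F z - t * D y)
     + (F z - F x - t * D z) - (F y - F x - 2 * t * D y) by ring.
  apply: le_trans (ler_normB _ _) _.
  apply: le_trans (lerD (ler_normD _ _) (lexx _)) _; rewrite normrM ger0_norm//.
  apply: (@le_trans _ _ (7 * C * (t * Num.sqrt t))); first lra.
  rewrite mulrCA mulrC ler_pM2r//; apply: le_trans sq; rewrite mulrC.
  by rewrite ler_wpM2l ?sqrtr_ge0// /k; lra.
- rewrite ltr0_norm ?subr_lt0// opprB in sq y1 y2 *.
  have := h y z ltac:(lra) yz (ltW zhi).
  set t := z - y in sq *.
  have t0 : 0 < t by rewrite subr_gt0.
  move=> e1; have -> : F y - F z - D z * (y - z) = - (F z - F y - t * D z).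
    by rewrite /t; ring.
  rewrite normrN; apply: le_trans e1 _; rewrite mulrCA mulrC ler_pM2r//.
  by apply: le_trans sq; rewrite mulrC ler_wpM2l ?sqrtr_ge0// /k; lra.
Qed.

(** Over m steps of length w = t / m, each step loses at most C w^(3/2), in total C t sqrt w, which
    tends to 0 as m grows. *)
Lemma left_est_le F D lo hi : left_est F D lo hi ->
  (forall y, lo <= y <= hi -> 0 <= D y) ->
  forall x y, lo <= x -> x <= y -> y <= hi -> F x <= F y.
Proof.
move=> [C C0 h] D0 x y lox; rewrite le_eqVlt => /orP[/eqP ->//|xy yhi].
apply/ler_addgt0Pr => e e0; set t := y - x.
have t0 : 0 < t by rewrite subr_gt0.
have step u v : lo <= u -> u < v -> v <= hi -> F u <= F v + C * ((v - u) * Num.sqrt (v - u)).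
  move=> lou uv vhi; have /ler_normlP[+ _] := h u v lou uv vhi.
  have Dv : 0 <= D v by apply: D0; rewrite vhi (le_trans lou) ?ltW.
  have uv0 : 0 <= v - u by rewrite subr_ge0 ltW.
  have := mulr_ge0 uv0 Dv; lra.
pose s := Num.sqrt t.
pose m := (Num.truncn ((C * t * s / e) ^+ 2)).+1.
have m0 : 0 < m%:R :> R by rewrite ltr0n.
have mb : (C * t * s / e) ^+ 2 < m%:R by rewrite truncnS_gt.
pose w := t / m%:R.
have w0 : 0 < w by rewrite divr_gt0.
have tw : t = m%:R * w by rewrite /w mulrC divfK// gt_eqF.
have chain (k : nat) : (k <= m)%N -> F x <= F (x + k%:R * w) + k%:R * (C * (w * Num.sqrt w)).
  elim: k => [_|k IH km]; first by rewrite !mul0r !addr0.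
  apply: le_trans (IH (ltnW km)) _.
  have km' : k.+1%:R * w <= t by rewrite tw ler_wpM2r ?ler_nat// ltW.
  have kw0 : 0 <= k%:R * w by rewrite mulr_ge0// ltW.
  have eS : x + k.+1%:R * w = x + k%:R * w + w by rewrite -natr1; ring.
  have := step (x + k%:R * w) (x + k.+1%:R * w).
  have -> : x + k.+1%:R * w - (x + k%:R * w) = w by rewrite eS; ring.
  move=> /(_ ltac:(lra) ltac:(rewrite eS; lra)) st.
  have {}st := st ltac:(move: km'; rewrite /t; lra).
  apply: le_trans (lerD st (lexx _)) _.
  by rewrite -addrA lerD2l -natr1 mulrDl mul1r addrC.
have := chain m (leqnn m).
rewrite -tw (_ : x + t = y); last by rewrite /t; ring.
move=> hF; apply: le_trans hF _; rewrite lerD2l.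
have -> : m%:R * (C * (w * Num.sqrt w)) = C * t * Num.sqrt w by rewrite tw; ring.
have -> : Num.sqrt w = s / Num.sqrt m%:R by rewrite sqrtrM ?ltW// sqrtrV ?ltW.
have sm0 : 0 < Num.sqrt (m%:R : R) by rewrite sqrtr_gt0.
rewrite mulrA ler_pdivrMr// [e * _]mulrC -ler_pdivrMr//.
have q0 : 0 <= C * t * s / e by rewrite divr_ge0 ?mulr_ge0 ?sqrtr_ge0// ltW.
by rewrite -[leLHS](ger0_norm q0) -[leLHS]sqrtr_sqr ler_sqrt ?ltW.
Qed.

Lemma left_est_affine F D lo hi a b : left_est F D lo hi ->
  left_est (fun y => a * F y + b * y) (fun y => a * D y + b) lo hi.
Proof.
move=> [C C0 h]; exists (`|a| * C); first exact: mulr_ge0.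
move=> x y lox xy yhi.
have -> : a * F y + b * y - (a * F x + b * x) - (y - x) * (a * D y + b) =
  a * (F y - F x - (y - x) * D y) by ring.
by rewrite normrM -mulrA ler_wpM2l// h.
Qed.

Lemma left_est_sum (I : Type) (r : seq I) (F D : I -> R -> R) lo hi :
  (forall i, left_est (F i) (D i) lo hi) ->
  left_est (fun y => \sum_(i <- r) F i y) (fun y => \sum_(i <- r) D i y) lo hi.
Proof.
move=> h; elim: r => [|i r [C C0 IH]].
  exists 0 => // x y _ _ _; rewrite !big_nil mulr0 mul0r !subr0 normr0//.
have [C' C'0 hi'] := h i.
exists (C' + C); first exact: addr_ge0.
move=> x y lox xy yhi; rewrite !big_cons.
have -> : F i y + \sum_(j <- r) F j y - (F i x + \sum_(j <- r) F j x) -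
    (y - x) * (D i y + \sum_(j <- r) D j y) =
  (F i y - F i x - (y - x) * D i y) + (\sum_(j <- r) F j y - \sum_(j <- r) F j x -
    (y - x) * \sum_(j <- r) D j y) by ring.
rewrite [leRHS]mulrDl; apply: le_trans (ler_normD _ _) _; apply: lerD; first exact: hi'.
exact: IH.
Qed.

(** Slopes of chords from index 0 are nondecreasing, multiplied out to avoid division. *)
Lemma discrete_convex (a : nat -> R) : (forall j, 2 * a j.+1 <= a j + a j.+2) ->
  forall n j, (j <= n)%N -> n%:R * (a j - a 0) <= j%:R * (a n - a 0).
Proof.
move=> h.
have sl j : a j - a 0 <= j%:R * (a j.+1 - a j).
  elim: j => [|j IH]; first by rewrite subrr mul0r.
  have hj : 0 <= a j + a j.+2 - 2 * a j.+1 by have := h j; lra.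
  have := mulr_ge0 (ler0n R j) hj; rewrite -natr1; lra.
elim=> [|n IH] j; first by rewrite leqn0 => /eqP ->; rewrite !mul0r.
rewrite leq_eqVlt => /predU1P[->//|jn].
have := IH j jn; have := sl n; have [n0|n0] := posnP n.
  by move: jn; rewrite n0 ltnS leqn0 => /eqP ->; rewrite subrr mulr0 mul0r.
have n0' : 0 < n%:R :> R by rewrite ltr0n.
have j0 := ler0n R j.
rewrite -natr1; move: n0' j0; move: (n%:R) (j%:R) => u v u0 v0.
move: (a j - a 0) => X; rewrite (_ : a n.+1 - a 0 = (a n.+1 - a n) + (a n - a 0)); last by ring.
move: (a n - a 0) (a n.+1 - a n) => Y Z h1 h2.
rewrite -(ler_pM2l u0).
have : (u + 1) * (u * X) <= (u + 1) * (v * Y) by rewrite ler_wpM2l//; lra.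
have : v * Y <= v * (u * Z) by rewrite ler_wpM2l.
lra.
Qed.

(* Convexity in the variable - ln x makes the difference quotients at 1 monotone. *)
Lemma log_convex_dq1 (F : R -> R) (K : R) :
  (forall a b, 0 <= a <= 1 -> 0 <= b <= 1 -> 2 * F (a * b) <= F (a ^+ 2) + F (b ^+ 2)) ->
  (forall x y, 0 <= x <= 1 -> 0 <= y <= 1 -> `|F x - F y| <= K * `|x - y|) ->
  exists l, dq [set y | 0 <= y <= 1] F 1 l.
Proof.
move=> hc hK.
have K0 : 0 <= K.
  by have := hK 0 1; rewrite !lexx ler01 sub0r normrN normr1 mulr1 => /(_ isT isT); exact: le_trans.
pose Psi t := F (expR (- t)).
have e01 (t : R) : 0 <= t -> 0 <= expR (- t) <= 1.
  by move=> t0; rewrite expR_ge0/= -expR0 ler_expR; lra.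
have PsiK t u : 0 <= t -> t <= u -> `|Psi t - Psi u| <= K * (u - t).
  move=> t0 tu; apply: le_trans (hK _ _ (e01 _ _) (e01 _ _)) _ => //; first lra.
  rewrite ler_wpM2l// ger0_norm ?subr_ge0 ?ler_expR ?lerN2//.
  have -> : expR (- u) = expR (- t) * expR (- (u - t)) by rewrite -expRD; congr expR; ring.
  have /andP[a0 a1] := e01 t t0.
  have := expR_ge1Dx (- (u - t)); have := expR_ge0 (- (u - t)).
  have ut : 0 <= u - t by lra.
  move: (expR (- t)) (expR (- (u - t))) (u - t) a0 a1 ut => x y z *; nra.
have P0 : Psi 0 = F 1 by rewrite /Psi oppr0 expR0.
pose S t := (F 1 - Psi t) / t.
have SK t : 0 < t -> `|S t| <= K.
  move=> t0; rewrite /S normrM normfV (gtr0_norm t0) ler_pdivrMr// -P0.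
  by have := PsiK 0 t (lexx _) (ltW t0); rewrite subr0.
have grid t n j : 0 < t -> (0 < j)%N -> (j <= n)%N -> S t <= S (j%:R / n%:R * t).
  move=> t0 j0 jn; have n0 : (0 < n)%N by exact: leq_trans jn.
  have n0' : 0 < n%:R :> R by rewrite ltr0n.
  have j0' : 0 < j%:R :> R by rewrite ltr0n.
  pose h := t / n%:R.
  have h0 : 0 <= h by rewrite divr_ge0// ltW.
  pose a i := Psi (i%:R * h).
  have ca i : 2 * a i.+1 <= a i + a i.+2.
    have i0 := ler0n R i.
    have i1 : i.+1%:R = i%:R + 1 :> R by rewrite natr1.
    have i2 : i.+2%:R = i%:R + 2 :> R by rewrite -addn2 natrD.
    (* The hypothesis is applied to the square roots of the outer grid values, whose product is the
       middle one. *)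
    have := hc (expR (- (i%:R * h / 2))) (expR (- (i.+2%:R * h / 2))).
    rewrite -expRD -!expRM_natl.
    have -> : - (i%:R * h / 2) - i.+2%:R * h / 2 = - (i.+1%:R * h).
      by rewrite i1 i2; clearbody h; field.
    have -> : 2%:R * - (i%:R * h / 2) = - (i%:R * h) by move: (i%:R * h) => z; field.
    have -> : 2%:R * - (i.+2%:R * h / 2) = - (i.+2%:R * h) by move: (i.+2%:R * h) => z; field.
    by apply; apply: e01; rewrite divr_ge0// mulr_ge0.
  have := discrete_convex ca jn; rewrite /a mul0r P0.
  rewrite (_ : n%:R * h = t); last by rewrite /h mulrC divfK// gt_eqF.
  rewrite (_ : j%:R * h = j%:R / n%:R * t); last by rewrite /h; ring.
  move=> hd.
  have q0 : 0 < j%:R / n%:R * t by rewrite mulr_gt0// divr_gt0.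
  rewrite /S ler_pdivlMr// mulrACA mulVf ?gt_eqF// mulr1.
  rewrite mulrA ler_pdivrMr//; lra.
(* [grid] only compares S at rational multiples. A rational multiple v of u lying above t by at most
   u / n, and the Lipschitz bound between t and v, settle the general case. *)
have mono t u : 0 < t -> t <= u -> S u <= S t.
  move=> t0; rewrite le_eqVlt => /predU1P[<-//|tu].
  have u0 : 0 < u by exact: lt_trans tu.
  apply/ler_addgt0Pr => e e0.
  pose c := 2 * K * u / (t * e).
  pose n := (Num.truncn c).+1.
  have n0 : 0 < n%:R :> R by rewrite ltr0n.
  have nc : c < n%:R by rewrite truncnS_gt.
  pose x := n%:R * t / u.
  pose j := (Num.truncn x).+1.
  have x0 : 0 <= x by rewrite divr_ge0 ?mulr_ge0// ltW.
  have /andP[j1 j2] := truncn_itv x0.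
  rewrite -/j in j2.
  have j3 : j%:R <= x + 1 by rewrite -natr1 lerD2r.
  have jn : (j <= n)%N.
    rewrite -(ltr_nat R); apply: le_lt_trans j1 _.
    by rewrite /x ltr_pdivrMr// ltr_pM2l.
  have /(_ u0) := grid u n j; move=> /(_ isT jn) h.
  apply: le_trans h _; set v := j%:R / n%:R * u.
  have un0 : 0 < u / n%:R by rewrite divr_gt0.
  have tE : t = x * (u / n%:R).
    by rewrite /x; move: (n%:R) n0 => m m0; field; rewrite !gt_eqF.
  have vE : v = j%:R * (u / n%:R) by rewrite /v mulrAC mulrA.
  have vt : t < v by rewrite tE vE ltr_pM2r.
  have vt' : v - t <= u / n%:R.
    rewrite tE vE -mulrBl; apply: ler_piMl; [exact: ltW|lra].
  have v0 : 0 < v by exact: lt_trans vt.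
  have := SK v v0 => /ler_normlP[Sv1 Sv2].
  have := PsiK t v (ltW t0) (ltW vt) => /ler_normlP[_ P1].
  have St : t * (S v - S t) = - (v - t) * S v + (Psi t - Psi v).
    rewrite /S; move: (Psi t) (Psi v) (F 1) t0 v0 => X Y Z t0 v0.
    by field; rewrite !gt_eqF.
  rewrite -lerBlDl -(ler_pM2l t0) St.
  apply: (@le_trans _ _ (2 * K * (v - t))).
    have : - (v - t) * S v <= (v - t) * K.
      by rewrite mulNr -mulrN ler_wpM2l//; lra.
    lra.
  apply: (@le_trans _ _ (2 * K * (u / n%:R))).
    by rewrite ler_wpM2l// mulr_ge0.
  rewrite mulrA ler_pdivrMr//; move: nc; rewrite /c ltr_pdivrMr ?mulr_gt0//.
  by rewrite [t * e * _]mulrC => /ltW.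
(* S is nonincreasing, so its supremum over (0, 1] is its limit at 0. *)
pose A := [set S t | t in [set t | 0 < t <= 1]].
have supA : has_sup A.
  split; first by exists (S 1); exists 1 => //=; rewrite ltr01 lexx.
  exists K => _ [t /andP[t0 _] <-]; apply: le_trans (ler_norm _) _; exact: SK.
pose l := sup A.
have lS t : 0 < t <= 1 -> S t <= l by move=> t01; apply: ub_le_sup; [exact: supA.2|exists t].
have lK : `|l| <= K.
  rewrite ler_norml; apply/andP; split.
    apply: le_trans (lS 1 _); last by rewrite ltr01 lexx.
    by have := SK 1 ltr01 => /ler_normlP[? _]; lra.
  apply: ge_sup; first exact: supA.1.
  by move=> _ [t /andP[t0 _] <-]; apply: le_trans (ler_norm _) _; exact: SK.
exists l => e e0.
have e4 : 0 < e / 4 by rewrite divr_gt0.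
have [_ [t0 /andP[t00 t01] <-] lt0] := sup_adherent e4 supA.
rewrite -/l in lt0.
have K1 : 0 < 4 * K + 1 by lra.
(* For t = - ln y the three bounds give respectively t <= 2 (1 - y) <= 1, then t <= t0, and an error
   K |t - (1 - y)| of at most e / 2 times 1 - y. *)
pose d := Num.min (Num.min 2^-1 (t0 / 2)) (e / (4 * K + 1)).
have d0 : 0 < d by rewrite !lt_min invr_gt0 ltr0n !divr_gt0.
exists d => // y /andP[y0 y1].
rewrite ler0_norm ?subr_le0// opprB => yd.
have [->|yn1] := eqVneq y 1; first by rewrite !subrr mulr0 mulr0 subrr normr0.
have z0 : 0 < 1 - y by rewrite subr_gt0 lt_def eq_sym yn1.
move: yd; rewrite !lt_min => /andP[/andP[d1 d2] d3].
have yp : 0 < y by lra.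
pose t := - ln y.
have yt : expR (- t) = y by rewrite opprK lnK.
have ty : expR t = y^-1 by rewrite -[t]opprK expRN yt.
have h1 : 1 - y <= t by have := expR_ge1Dx (- t); rewrite yt; lra.
have h2 : t * y <= 1 - y.
  have := expR_ge1Dx t; rewrite ty -div1r ler_pdivlMr//; lra.
have y2 : 2^-1 <= y by lra.
have t2 : t <= 2 * (1 - y).
  have : 2^-1 * t <= t * y by rewrite mulrC ler_wpM2l//; lra.
  lra.
have t3 : t - (1 - y) <= 2 * (1 - y) ^+ 2.
  have : t * (1 - y) <= 2 * (1 - y) * (1 - y) by rewrite ler_pM2r.
  rewrite expr2; lra.
have tt : 0 < t <= 1 by apply/andP; split; lra.
have /andP[tp _] := tt.
have St1 := lS t tt.
have St2 : S t0 <= S t by apply: mono => //; lra.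
have Py : F y - F 1 = - (S t * t).
  by rewrite /S divfK ?gt_eqF// /Psi yt opprB.
have -> : F y - F 1 - l * (y - 1) = (l - S t) * t - l * (t - (1 - y)).
  by rewrite Py; ring.
apply: le_trans (ler_normB _ _) _; rewrite !normrM.
have a1 : `|l - S t| * `|t| <= e / 4 * (2 * (1 - y)).
  rewrite (gtr0_norm tp); apply: ler_pM => //; first exact: ltW.
  by rewrite ger0_norm ?subr_ge0//; lra.
have a2 : `|l| * `|t - (1 - y)| <= K * (2 * (1 - y) ^+ 2).
  by apply: ler_pM => //; rewrite ger0_norm ?subr_ge0.
have a3 : K * (2 * (1 - y) ^+ 2) <= e / 2 * (1 - y).
  have h3 : 4 * (K * (1 - y)) + (1 - y) < e.
    by move: d3; rewrite ltr_pdivlMr// mulrC mulrDl mul1r mulrA.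
  rewrite (_ : K * _ = 2 * (K * (1 - y)) * (1 - y)); last by ring.
  rewrite ler_pM2r//; move: (K * (1 - y)) h3 => q *; lra.
lra.
Qed.
End difference_quotients.

(** * Derivative of the correlation inside (0, 1) *)

Section incr.
Context {R : realType}.

Lemma sqrt_lt1 (y : R) : y < 1 -> 0 <= Num.sqrt y < 1.
Proof. by move=> y1; rewrite sqrtr_ge0/= -[ltRHS]sqrtr1 ltr_sqrt. Qed.

(** Each increment is s times a linear part plus an error of order s^2; the product of the linear
    parts is kept and the rest is of order s^3. The final bound holds because the difference of the
    two sides is a polynomial with nonnegative coefficients. *)
Lemma product_expand (s e n A1 B1 sA sB D D' K K' : R) :
  0 <= s <= 1 -> 0 <= n -> 0 <= D -> 0 <= D' -> 0 <= K -> 0 <= K' ->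
  `|A1| <= D * n -> `|B1| <= D' * n ->
  `|sA| <= s ^+ 2 * (D * n + K * n ^+ 2) ->
  `|sB| <= s ^+ 2 * (D' * n + K' * n ^+ 2) ->
  `|(s * A1 + sA) * (s * B1 + sB) - s ^+ 2 * (A1 * B1)| <=
  s ^+ 3 * (3 * (D + K) * (D' + K')) * (n ^+ 2 + n ^+ 3 + n ^+ 4).
Proof.
move=> /andP[s0 s1] n0 D0 D'0 K0 K'0 hA hB hsA hsB.
have -> : (s * A1 + sA) * (s * B1 + sB) - s ^+ 2 * (A1 * B1) =
  s * A1 * sB + sA * (s * B1) + sA * sB by ring.
set a := D * n + K * n ^+ 2 in hsA *; set b := D' * n + K' * n ^+ 2 in hsB *.
have n20 : 0 <= n ^+ 2 by exact: sqr_ge0.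
have a0 : 0 <= a by rewrite addr_ge0 ?mulr_ge0.
have b0 : 0 <= b by rewrite addr_ge0 ?mulr_ge0.
have t1 : `|s * A1 * sB| <= s * (D * n) * (s ^+ 2 * b).
  by rewrite !normrM (ger0_norm s0); apply: ler_pM; rewrite ?mulr_ge0// ler_wpM2l.
have t2 : `|sA * (s * B1)| <= (s ^+ 2 * a) * (s * (D' * n)).
  by rewrite !normrM (ger0_norm s0); apply: ler_pM; rewrite ?mulr_ge0// ler_wpM2l.
have t3 : `|sA * sB| <= s ^+ 3 * (a * b).
  rewrite normrM; apply: (@le_trans _ _ ((s ^+ 2 * a) * (s ^+ 2 * b))).
    exact: ler_pM.
  rewrite (_ : _ * _ = s ^+ 3 * (a * b) * s); last by ring.
  by rewrite ler_piMr// !mulr_ge0// exprn_ge0.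
apply: le_trans (ler_normD _ _) _; apply: le_trans (lerD (ler_normD _ _) (lexx _)) _.
apply: le_trans (lerD (lerD t1 t2) t3) _.
rewrite (_ : s * (D * n) * (s ^+ 2 * b) + s ^+ 2 * a * (s * (D' * n)) + s ^+ 3 * (a * b) =
  s ^+ 3 * (D * n * b + a * (D' * n) + a * b)); last by ring.
rewrite -[leRHS]mulrA ler_wpM2l ?exprn_ge0//.
rewrite -subr_ge0 /a /b.
rewrite (_ : _ - _ = 3 * (D * K' + K * D' + K * K') * n ^+ 2 +
   (3 * (D * D') + D * K' + K * D' + 3 * (K * K')) * n ^+ 3 +
   (3 * (D * D') + 3 * (D * K') + 3 * (K * D') + 2 * (K * K')) * n ^+ 4); last by ring.
by rewrite !addr_ge0 ?mulr_ge0 ?addr_ge0 ?mulr_ge0 ?exprn_ge0.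
Qed.
End incr.

Section expansion.
Context {R : realType} {p : nat}.
Local Notation V := 'cV[R]_p.
Local Notation Ct := (@Ct R p).
Local Notation Cm := (@Cm R p).
Implicit Types (f g W : V -> R).

(** All that the expansion of increments uses of a smoothed function: a bounded differential M and a
    uniform quadratic remainder. *)
Record taylor (K D : R) W (M : 'I_p -> V -> R) : Prop := Taylor {
  taylorK : 0 <= K;
  taylorD : 0 <= D;
  taylorW : tame1 W;
  taylorM : forall j, tame1 (M j);
  taylor_le : forall j x, `|M j x| <= D;
  taylor_exp : forall x y : V,
    `|W (x + y) - W x - \sum_j M j x * y j 0| <= K * N1 y ^+ 2 }.

Lemma sumM_le K D W M : taylor K D W M -> forall x y : V,
  `|\sum_j M j x * y j 0| <= D * N1 y.
Proof.
case=> _ D0 _ _ MD _ x y; apply: le_trans (ler_norm_sum _ _ _) _.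
by rewrite /N1 mulr_sumr; apply: ler_sum => j _; rewrite normrM ler_wpM2r.
Qed.

Definition Cg : R := E2 (fun x y : V => (N1 x + N1 y) ^+ 2 + (N1 x + N1 y) ^+ 3 + (N1 x + N1 y) ^+ 4).

Lemma tame_N1DX n : tame (fun x y : V => (N1 x + N1 y) ^+ n).
Proof.
elim: n => [|n IH]; first exact: tame_cst.
rewrite (_ : (fun x _ => _) = (fun (x y : V) => (N1 x + N1 y) * (N1 x + N1 y) ^+ n)).
  apply: tameM => //; apply: tameD; first exact: tame_N1.
  exact: (tame_snd (f := @N1 R p) tame_N1).
by apply/funext => x; apply/funext => y; rewrite exprS.
Qed.

Lemma tame_Cg : tame (fun x y : V => (N1 x + N1 y) ^+ 2 + (N1 x + N1 y) ^+ 3 + (N1 x + N1 y) ^+ 4).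
Proof. by apply: tameD; [apply: tameD|]; exact: tame_N1DX. Qed.

Lemma Cg_ge0 : 0 <= Cg.
Proof.
apply: E2_ge0 => x y; have := addr_ge0 (N1_ge0 x) (N1_ge0 y).
by move: (N1 x + N1 y) => n n0; rewrite !addr_ge0 ?exprn_ge0.
Qed.

(** Since y is independent of x and has identity covariance, only the diagonal terms survive. *)
Lemma E2_bilinear K D W M K' D' W' M' : taylor K D W M -> taylor K' D' W' M' ->
  E2 (fun x y : V => (\sum_j M j x * y j 0) * (\sum_j M' j x * y j 0)) =
  \sum_j E1 (fun x => M j x * M' j x).
Proof.
move=> T T'.
have tM i j : tame1 (fun x => M i x * M' j x).
  by apply: tameM; [exact: (taylorM T)|exact: (taylorM T')].
have tc i j : tame1 (fun y : V => y i 0 * y j 0).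
  by apply: tameM; exact: tame_coord.
have tt i j : tame (fun x y : V => (M i x * M' j x) * (y i 0 * y j 0)).
  by apply: tameM; [exact: tM|exact: (tame_snd (tc i j))].
transitivity (E2 (fun x y : V => \sum_i \sum_j (M i x * M' j x) * (y i 0 * y j 0))).
  apply: eq_E2 => x y; rewrite mulr_suml; apply: eq_bigr => i _.
  by rewrite mulr_sumr; apply: eq_bigr => j _; rewrite mulrACA.
rewrite E2_sum => [|i]; last by apply: tame_sum => j.
apply: eq_bigr => i _; rewrite E2_sum// (bigD1 i)//= big1 => [|j ji].
  by rewrite (E2_prod (tM i i) (tc i i)) E1_coord2 eqxx mulr1 addr0.
by rewrite (E2_prod (tM i j) (tc i j)) E1_coord2 eq_sym (negbTE ji) mulr0.
Qed.

(** With s = cosin r, h - x = s y - (1 - r) x and 1 - r <= s^2, so to first order in s an increment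
    is the differential at x applied to the independent vector s y. *)
Lemma incr_expand K D W M K' D' W' M' r : taylor K D W M -> taylor K' D' W' M' ->
  0 <= r <= 1 ->
  `|E2 (fun x y => let h := r *: x + cosin r *: y in (W x - W h) * (W' x - W' h))
    - cosin r ^+ 2 * \sum_j E1 (fun x => M j x * M' j x)| <=
  cosin r ^+ 3 * (3 * (D + K) * (D' + K')) * Cg.
Proof.
move=> T T' r01; have /andP[r0 r1] := r01.
have r11 : -1 <= r <= 1 by apply/andP; split; lra.
set s := cosin r.
have s0 : 0 <= s by exact: cosin_ge0.
have s2 : s ^+ 2 = 1 - r ^+ 2 by exact: cosin_sqr.
have s1 : s <= 1.
  by rewrite -(@expr_le1 _ 2)// s2; have := sqr_ge0 r; lra.
have es : 1 - r <= s ^+ 2 by rewrite s2 lerB// expr2 ler_piMr.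
have ess : 1 - r <= s by apply: le_trans es _; rewrite expr2 ler_piMr.
have tS : tame (fun x y : V => (\sum_j M j x * y j 0) * (\sum_j M' j x * y j 0)).
  apply: tameM; apply: tame_sum => j; apply: tameM.
  - exact: (taylorM T).
  - exact: (tame_snd (tame_coord j)).
  - exact: (taylorM T').
  - exact: (tame_snd (tame_coord j)).
have tW := taylorW T; have tW' := taylorW T'.
have tWh := tame_lin r s tW; have tWh' := tame_lin r s tW'.
have tP : tame (fun x y => (W x - W (r *: x + s *: y)) * (W' x - W' (r *: x + s *: y))).
  exact: (tameM (tameB tW tWh) (tameB tW' tWh')).
rewrite -(E2_bilinear T T') -E2Z// -E2B//; last exact: tameZ.
rewrite /Cg -E2Z; last exact: tame_Cg.
apply: E2_norm_le.
- exact: (tameB tP (tameZ _ tS)).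
- exact: (tameZ _ tame_Cg).
move=> x y; set h := r *: x + s *: y.
pose n := N1 x + N1 y.
have n0 : 0 <= n by rewrite addr_ge0 ?N1_ge0.
pose d := h - x.
have dE : d = s *: y - (1 - r) *: x by apply/colP => i; rewrite !mxE; ring.
have hE : h = x + d by rewrite /d addrC subrK.
have Nd : N1 d <= s * n.
  rewrite dE; apply: le_trans (N1B _ _) _; rewrite !N1Z !ger0_norm ?subr_ge0//.
  rewrite /n mulrDr addrC lerD2r ler_wpM2r ?N1_ge0//.
pose step (N : 'I_p -> V -> R) := \sum_j N j x * y j 0.
have main k c w N (H : taylor k c w N) : exists sA, [/\ `|step N| <= c * n,
    `|sA| <= s ^+ 2 * (c * n + k * n ^+ 2) & w h - w x = s * step N + sA].
  exists (w h - w x - s * step N); split; last by ring.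
    apply: le_trans (sumM_le H x y) _; rewrite ler_wpM2l ?(taylorD H)// /n.
    by rewrite lerDr N1_ge0.
  have -> : w h - w x - s * step N =
      (w (x + d) - w x - \sum_j N j x * d j 0) - (1 - r) * \sum_j N j x * x j 0.
    rewrite -hE; set X := w h - w x; rewrite -!addrA; congr (_ + _).
    have -> : \sum_j N j x * d j 0 = s * step N - (1 - r) * \sum_j N j x * x j 0.
      rewrite /step !mulr_sumr -sumrB; apply: eq_bigr => j _.
      by rewrite dE !mxE; ring.
    by ring.
  apply: le_trans (ler_normB _ _) _; rewrite mulrDr [leRHS]addrC; apply: lerD.
    apply: le_trans (taylor_exp H x d) _; rewrite [leRHS]mulrCA ler_wpM2l ?(taylorK H)//.
    by rewrite -exprMn lerXn2r ?nnegrE ?N1_ge0// mulr_ge0.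
  rewrite normrM ger0_norm ?subr_ge0//; apply: ler_pM; rewrite ?subr_ge0//.
  apply: le_trans (sumM_le H x x) _; rewrite ler_wpM2l ?(taylorD H)// /n.
  by rewrite lerDl N1_ge0.
have [sA [A1 A2 A3]] := main _ _ _ _ T.
have [sB [B1 B2 B3]] := main _ _ _ _ T'.
have -> : (W x - W h) * (W' x - W' h) = (W h - W x) * (W' h - W' x) by ring.
rewrite A3 B3; apply: product_expand => //; rewrite ?s0//.
- exact: taylorD T.
- exact: taylorD T'.
- exact: taylorK T.
- exact: taylorK T'.
Qed.

Lemma OU_taylorP L a f : lipf L f -> 0 <= L -> 0 <= a < 1 ->
  taylor (L * (a ^+ 2 / cosin a) * Ct) (a * L * Cm) (OU a f) (dOU a f).
Proof.
move=> fL L0 a01; have /andP[a0 a1] := a01; split.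
- by rewrite !mulr_ge0 ?sqr_ge0 ?invr_ge0 ?cosin_ge0 ?Ct_ge0.
- by rewrite !mulr_ge0 ?Cm_ge0.
- exact: tame_OU fL.
- by move=> j; apply: tame_dOU fL L0 a01.
- by move=> j x; exact: dOU_le.
- by move=> x y; exact: OU_taylor.
Qed.

(** The factor eta^-1 comes from 1 - r = (eta - x) / eta for x = r eta, while the 2^-1 of
    [corr_incr] is absorbed by 1 - r^2, which is about 2 (1 - r). *)
Definition dcorr f g (eta : R) :=
  eta^-1 * \sum_j E1 (fun x => dOU (Num.sqrt eta) f j x * dOU (Num.sqrt eta) g j x).

Lemma corr_left_est L L' f g lo hi : lipf L f -> lipf L' g -> 0 <= L -> 0 <= L' ->
  0 < lo -> hi < 1 -> left_est (corr f g) (dcorr f g) lo hi.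
Proof.
move=> fL gL L0 L'0 lo0 hi1.
have [hilo|lohi] := leP hi lo.
  exists 0 => // x y lx xy yh; exfalso; have := le_lt_trans lx xy; have := le_trans yh hilo; lra.
have b0 : 0 < cosin (Num.sqrt hi).
  exact/cosin_gt0/sqrt_lt1.
set b := cosin (Num.sqrt hi) in b0.
pose Q := (L * (1 / b) * Ct + L * Cm) *
          (L' * (1 / b) * Ct + L' * Cm).
pose S := p%:R * (L * Cm * (L' * Cm)).
(* s^2 <= 2 (1 - r) = 2 (y - x) / y <= k^2 (y - x). The constants are uniform because y stays above
   lo here and below hi in [b]. *)
pose k := Num.sqrt (2 / lo).
have Ct0 := @Ct_ge0 R p; have Cm0 := @Cm_ge0 R p.
have Cg0 := Cg_ge0.
have S0 : 0 <= S by rewrite /S !mulr_ge0.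
have Q0 : 0 <= Q.
  have ib0 : 0 <= 1 / b by rewrite divr_ge0// ltW.
  by apply: mulr_ge0; apply: addr_ge0; do 2?[apply: mulr_ge0 => //].
have QS0 : 0 <= 3 * Q * Cg / 2 + S / 2.
  by apply: addr_ge0; apply: divr_ge0 => //; apply: mulr_ge0 => //; apply: mulr_ge0.
pose C := k ^+ 3 * (3 * Q * Cg / 2 + S / 2).
have C0 : 0 <= C.
  exact: mulr_ge0 (exprn_ge0 _ (sqrtr_ge0 _)) QS0.
exists C => // x y lox xy yhi.
have y0 : 0 < y by apply: lt_trans xy; exact: lt_le_trans lox.
have x0 : 0 < x by exact: lt_le_trans lox.
have y1 : y < 1 by exact: le_lt_trans hi1.
set a := Num.sqrt y.
have a01 : 0 <= a < 1 by exact: sqrt_lt1.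
have /andP[a0 a1] := a01.
pose r := x / y.
have r01 : 0 <= r <= 1.
  apply/andP; split; first by rewrite divr_ge0// ltW.
  by rewrite /r ler_pdivrMr// mul1r ltW.
have /andP[r0 r1] := r01.
have r11 : -1 <= r <= 1 by apply/andP; split; lra.
have xE : x = r * y by rewrite /r divfK// gt_eqF.
have y01 : 0 <= y <= 1 by rewrite !ltW.
have := corr_incr_scale fL gL y01 r11; rewrite -xE -/a => ->.
have T := OU_taylorP fL L0 a01; have T' := OU_taylorP gL L'0 a01.
have := incr_expand T T' r01.
set s := cosin r; set X := E2 _; set SD := \sum_j _.
have s2 : s ^+ 2 = 1 - r ^+ 2 by exact: cosin_sqr.
have s0 : 0 <= s by exact: cosin_ge0.
have SDS : `|SD| <= S.
  apply: le_trans (ler_norm_sum _ _ _) _.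
  apply: (@le_trans _ _ (\sum_(j < p) (L * Cm * (L' * Cm)))); last first.
    by rewrite sumr_const card_ord -mulr_natl.
  apply: ler_sum => j _; rewrite -[leRHS](@E1_cst R p).
  apply: E1_norm_le; [exact: (tameM (taylorM T j) (taylorM T' j))|exact: tame_cst|].
  move=> z; rewrite normrM; apply: ler_pM => //.
    apply: le_trans (taylor_le T _ _) _; by rewrite -mulrA; apply: ler_piMl; [exact: mulr_ge0|exact: ltW].
  apply: le_trans (taylor_le T' _ _) _; by rewrite -mulrA; apply: ler_piMl; [exact: mulr_ge0|exact: ltW].
have ab : b <= cosin a.
  rewrite /b /cosin ler_sqrt ?subr_ge0; last first.
    by rewrite expr_le1// ltW.
  by rewrite !sqr_sqrtr; [lra|exact: ltW|apply: ltW; exact: lt_trans lohi].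
have ca : 0 < cosin a by exact: cosin_gt0.
have abK : a ^+ 2 / cosin a <= 1 / b.
  apply: ler_pM; rewrite ?sqr_ge0 ?invr_ge0 ?cosin_ge0//.
    by rewrite expr_le1// ltW.
  by rewrite lef_pV2 ?posrE.
have KDQ : 3 * (a * L * Cm + L * (a ^+ 2 / cosin a) * Ct) *
    (a * L' * Cm + L' * (a ^+ 2 / cosin a) * Ct) <= 3 * Q.
  rewrite -mulrA ler_wpM2l// /Q.
  have le (l : R) : 0 <= l -> 0 <= a * l * Cm + l * (a ^+ 2 / cosin a) * Ct <=
      l * (1 / b) * Ct + l * Cm.
    move=> l0; apply/andP; split.
      by apply: addr_ge0; apply: mulr_ge0 => //; apply: mulr_ge0 => //; rewrite ?divr_ge0 ?sqr_ge0 ?cosin_ge0.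
    rewrite addrC; apply: lerD.
      by rewrite ler_wpM2r// ler_wpM2l.
    by rewrite -mulrA; apply: ler_piMl; [exact: mulr_ge0|exact: ltW].
  have /andP[? ?] := le L L0; have /andP[? ?] := le L' L'0.
  exact: ler_pM.
have s1 : s <= 1.
  by rewrite -(@expr_le1 _ 2)// s2; have := sqr_ge0 r; lra.
move=> hX.
have t0 : 0 < y - x by rewrite subr_gt0.
have rE : 1 - r = (y - x) / y.
  by rewrite /r mulrBl divff// gt_eqF.
have es : 1 - r <= s ^+ 2 by rewrite s2 lerB// expr2 ler_piMr.
have s3 : s ^+ 3 <= k ^+ 3 * ((y - x) * Num.sqrt (y - x)).
  have sk : s <= k * Num.sqrt (y - x).
    have l0 : 0 <= 2 / lo by rewrite divr_ge0// ltW.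
    rewrite /k -sqrtrM// /s /cosin ler_sqrt; last by rewrite mulr_ge0// ltW.
    apply: (@le_trans _ _ (2 * (1 - r))).
      by rewrite (_ : 1 - r ^+ 2 = (1 + r) * (1 - r)) ?ler_wpM2r//; [lra|lra|ring].
    rewrite rE mulrCA [leRHS]mulrC; apply: ler_wpM2l; first exact: ltW.
    by apply: ler_wpM2l => //; rewrite lef_pV2 ?posrE//; lra.
  have : s ^+ 3 <= (k * Num.sqrt (y - x)) ^+ 3.
    by rewrite lerXn2r ?nnegrE ?mulr_ge0 ?sqrtr_ge0.
  rewrite exprMn [X in _ <= _ * X -> _]exprSr sqr_sqrtr//; exact: ltW.
have dE : (y - x) * dcorr f g y = (1 - r) * SD by rewrite /dcorr -/a -/SD mulrA -rE.
rewrite dE.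
(* Replacing 2^-1 s^2 = 2^-1 (1 - r^2) by 1 - r costs only 2^-1 (1 - r)^2, of order s^4. *)
have -> : 2^-1 * X - (1 - r) * SD =
    2^-1 * (X - s ^+ 2 * SD) - 2^-1 * (1 - r) ^+ 2 * SD.
  by rewrite s2; clearbody X SD; field.
apply: le_trans (ler_normB _ _) _.
apply: (@le_trans _ _ (s ^+ 3 * (3 * Q * Cg / 2 + S / 2))); last first.
  by rewrite /C [leRHS]mulrAC; apply: ler_wpM2r.
rewrite [leRHS]mulrDr; apply: lerD.
  rewrite normrM ger0_norm ?invr_ge0//.
  rewrite [leRHS](_ : _ = 2^-1 * (s ^+ 3 * (3 * Q) * Cg)); last by clearbody Q; ring.
  apply: ler_wpM2l; first by rewrite invr_ge0.
  apply: le_trans hX _; apply: ler_wpM2r => //; apply: ler_wpM2l => //.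
  exact: exprn_ge0.
rewrite normrM; apply: (@le_trans _ _ (2^-1 * s ^+ 3 * S)); last first.
  by rewrite le_eqVlt; apply/orP; left; apply/eqP; ring.
apply: ler_pM => //.
have i2 : 0 <= 2^-1 :> R by rewrite invr_ge0.
rewrite ger0_norm; last by apply: mulr_ge0 => //; exact: sqr_ge0.
apply: ler_wpM2l => //.
apply: (@le_trans _ _ (s ^+ 2 * s ^+ 2)).
  by rewrite expr2; apply: ler_pM => //; lra.
by rewrite -exprD (exprSr s 3) ler_piMr ?exprn_ge0.
Qed.
End expansion.

(** * Derivative of the correlation at -1, 0 and 1 *)

Section corr_derivative.
Context {R : realType} {p : nat}.
Local Notation V := 'cV[R]_p.
Local Notation Cm := (@Cm R p).
Local Notation K2 := (@K2 R p).
Implicit Types (f g w : V -> R).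

(** The coefficient of f on the degree-one Hermite polynomial k_j. *)
Definition chaos1 f j := E1 (fun k : V => f k * k j 0).
Definition N1mean : R := E1 (fun k : V => N1 k).
Definition dev (x : V) : R := N1 x * N1mean + Cm.

Lemma N1mean_ge0 : 0 <= N1mean. Proof. by apply: E1_ge0 => k; exact: N1_ge0. Qed.

Lemma dev_ge0 x : 0 <= dev x.
Proof. by rewrite addr_ge0 ?mulr_ge0 ?N1_ge0 ?N1mean_ge0 ?Cm_ge0. Qed.

Lemma tame_dev : tame1 dev.
Proof.
apply: tameD; last exact: tame_cst.
rewrite (_ : (fun x _ => _) = (fun (x _ : V) => N1mean * N1 x)).
  by apply: tameZ; exact: tame_N1.
by apply/funext => x; apply/funext => y; exact: mulrC.
Qed.

Lemma smooth_chaos1_le L f a j x : lipf L f -> 0 <= L -> 0 <= a <= 1 ->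
  `|E1 (fun k => f (a *: x + cosin a *: k) * k j 0) - chaos1 f j| <= L * a * dev x.
Proof.
move=> fL L0 /andP[a0 a1].
have a11 : -1 <= a <= 1 by apply/andP; split; lra.
have b0 := cosin_ge0 a; have b2 := cosin_sqr a11.
set b := cosin a in b0 b2 *.
have b1 : b <= 1 by rewrite -(@expr_le1 _ 2)// b2; have := sqr_ge0 a; lra.
(* 1 - b <= 1 - b^2 = a^2 <= a. *)
have ba : 1 - b <= a.
  have : b ^+ 2 <= b by rewrite expr2 ler_piMr.
  have : a ^+ 2 <= a by rewrite expr2 ler_piMr.
  lra.
have tf1 := tame_fcoord j (tame1_affine (a *: x) b (tame_lip fL)).
have tf2 := tame_fcoord j (tame_lip fL).
rewrite /chaos1 -(E1B tf1 tf2).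
pose D (k : V) := L * a * (N1 x * N1 k + N1 k ^+ 2).
have tD : tame1 D.
  apply: tameZ; apply: tameD; last exact: tame_N1n.
  by apply: tameZ; exact: tame_N1.
have -> : L * a * dev x = E1 D.
  rewrite /D E1Z; last first.
    by apply: tameD; [apply: tameZ; exact: tame_N1|exact: tame_N1n].
  congr (_ * _); rewrite E1D; [|by apply: tameZ; exact: tame_N1|exact: tame_N1n].
  by rewrite E1Z//; exact: tame_N1.
apply: E1_norm_le => //; first exact: (tameB tf1 tf2).
move=> k; rewrite -mulrBl normrM.
have h1 : `|f (a *: x + b *: k) - f k| <= L * (a * (N1 x + N1 k)).
  apply: le_trans (fL _ _) _; apply: ler_wpM2l => //.
  have -> : a *: x + b *: k - k = a *: x - (1 - b) *: k.
    by apply/colP => i; rewrite !mxE; ring.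
  apply: le_trans (N1B _ _) _; rewrite !N1Z !ger0_norm ?subr_ge0// mulrDr lerD2l.
  by apply: ler_wpM2r => //; exact: N1_ge0.
have -> : D k = L * (a * (N1 x + N1 k)) * N1 k by rewrite /D; ring.
apply: ler_pM => //; exact: coord_le_N1.
Qed.

Lemma chaos1_le L f j : lipf L f -> 0 <= L -> `|chaos1 f j| <= L * Cm.
Proof.
move=> fL L0.
have tf := tame_lip fL.
have -> : chaos1 f j = E1 (fun k => (f k - f 0) * k j 0).
  transitivity (E1 (fun k => f k * k j 0 - f 0 * k j 0)).
    rewrite E1B; [|exact: tame_fcoord|by apply: tameZ; exact: tame_coord].
    by rewrite E1Z ?E1_coord ?mulr0 ?subr0//; exact: tame_coord.
  by apply: eq_E1 => k; rewrite mulrBl.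
rewrite /Cm -E1Z; last exact: tame_N1n.
apply: E1_norm_le.
- by apply: tame_fcoord; apply: tameB => //; exact: tame_cst.
- by apply: tameZ; exact: tame_N1n.
move=> k; rewrite normrM expr2 mulrA; apply: ler_pM => //; last exact: coord_le_N1.
by apply: le_trans (fL _ _) _; rewrite subr0.
Qed.

(** The two prefactors a / cosin a with a^2 = eta cancel eta^-1 up to (1 - eta)^-1, and what remains
    of each [dOU] tends to a Hermite coefficient at rate a = sqrt eta. *)
Lemma dcorr0_le L L' f g : lipf L f -> lipf L' g -> 0 <= L -> 0 <= L' ->
  exists2 C, 0 <= C & forall eta, 0 < eta <= 2^-1 ->
  `|dcorr f g eta - \sum_j chaos1 f j * chaos1 g j| <= C * Num.sqrt eta.
Proof.
move=> fL gL L0 L'0.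
set m := \sum_j _.
pose c2 (x : V) := dev x * dev x + 2 * Cm * dev x.
have tc2 : tame1 c2.
  apply: tameD; first by apply: tameM; exact: tame_dev.
  by apply: tameZ; exact: tame_dev.
have c20 x : 0 <= c2 x by rewrite addr_ge0 ?mulr_ge0 ?dev_ge0 ?Cm_ge0.
pose C1 := p%:R * (L * L' * E1 c2).
have C10 : 0 <= C1.
  by rewrite /C1 mulr_ge0// mulr_ge0 ?mulr_ge0//; exact: E1_ge0.
exists (2 * C1 + 2 * `|m|).
  by rewrite addr_ge0// mulr_ge0.
move=> eta /andP[eta0 eta1].
set a := Num.sqrt eta.
have a0 : 0 < a by rewrite sqrtr_gt0.
have a2 : a ^+ 2 = eta by rewrite sqr_sqrtr// ltW.
have a1 : a <= 1 by rewrite -(@expr_le1 _ 2) ?ltW// a2; lra.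
have a11 : -1 <= a <= 1 by apply/andP; split; lra.
have b2 : cosin a ^+ 2 = 1 - eta by rewrite cosin_sqr// a2.
pose mf h j (x : V) := E1 (fun k : V => h (a *: x + cosin a *: k) * k j 0).
have a01 : 0 <= a < 1 by apply: sqrt_lt1; lra.
have ca : 0 < cosin a by exact: cosin_gt0.
have tm h l j : lipf l h -> 0 <= l -> tame1 (mf h j).
  move=> hl l0; have := tame_dOU j hl l0 a01.
  move=> /(tameZ (cosin a / a)); rewrite /dOU /tame1 /mf.
  under eq_fun do under eq_fun do rewrite mulrA.
  have -> : cosin a / a * (a / cosin a) = 1.
    by rewrite mulrA divfK ?divff// gt_eqF.
  by under eq_fun do under eq_fun do rewrite mul1r.
have e1 : dcorr f g eta = (1 - eta)^-1 * \sum_j E1 (fun x => mf f j x * mf g j x).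
  rewrite /dcorr -/a !mulr_sumr; apply: eq_bigr => j _.
  transitivity (eta^-1 * E1 (fun x => (eta / (1 - eta)) * (mf f j x * mf g j x))).
    congr (_ * _); apply: eq_E1 => x; rewrite /dOU -b2 -a2 -/(mf f j x) -/(mf g j x).
    by rewrite mulrACA -expr2 exprMn exprVn.
  rewrite E1Z; last by apply: tameM; [exact: (tm _ _ j fL L0)|exact: (tm _ _ j gL L'0)].
  by rewrite mulrA mulrA mulVf ?mul1r// gt_eqF.
have h1 : `|\sum_j E1 (fun x => mf f j x * mf g j x) - m| <= a * C1.
  rewrite /m -sumrB; apply: le_trans (ler_norm_sum _ _ _) _.
  apply: (@le_trans _ _ (\sum_(j < p) a * (L * L' * E1 c2))); last first.
    by rewrite sumr_const card_ord -mulr_natl /C1 mulrCA.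
  apply: ler_sum => j _.
  have tmm : tame1 (fun x => mf f j x * mf g j x).
    by apply: tameM; [exact: (tm _ _ j fL L0)|exact: (tm _ _ j gL L'0)].
  rewrite -[X in _ - X](@E1_cst R p) -(E1B tmm (tame_cst _)).
  rewrite [leRHS]mulrA -(E1Z _ tc2); apply: E1_norm_le.
  - exact: (tameB tmm (tame_cst _)).
  - exact: tameZ.
  move=> x; have a01' : 0 <= a <= 1 by rewrite ltW.
  have := smooth_chaos1_le j x fL L0 a01'; have := smooth_chaos1_le j x gL L'0 a01'.
  rewrite -/(mf f j x) -/(mf g j x).
  have := chaos1_le j fL L0; have := chaos1_le j gL L'0.
  move: (mf f j x) (mf g j x) (chaos1 f j) (chaos1 g j) => F G u v hv hu hG hF.
  have -> : F * G - u * v = (F - u) * (G - v) + (F - u) * v + u * (G - v) by ring.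
  apply: le_trans (ler_normD _ _) _; apply: le_trans (lerD (ler_normD _ _) (lexx _)) _.
  rewrite !normrM.
  have d0 := dev_ge0 x; have Cm0 := @Cm_ge0 R p.
  have q1 : `|F - u| * `|G - v| <= L * a * dev x * (L' * dev x).
    apply: ler_pM => //; apply: le_trans hG _.
    by rewrite -mulrA; apply: ler_wpM2l => //; rewrite ler_piMl.
  have q2 : `|F - u| * `|v| <= L * a * dev x * (L' * Cm) by exact: ler_pM.
  have q3 : `|u| * `|G - v| <= L * Cm * (L' * a * dev x) by exact: ler_pM.
  apply: le_trans (lerD (lerD q1 q2) q3) _.
  by rewrite le_eqVlt /c2; apply/orP; left; apply/eqP; ring.
rewrite e1; set S := \sum_j _ in h1 *.
have eb : 0 < 1 - eta by lra.
have i2 : (1 - eta)^-1 <= 2.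
  by rewrite -(invrK 2) lef_pV2 ?posrE ?invr_gt0//; lra.
have -> : (1 - eta)^-1 * S - m = (1 - eta)^-1 * (S - m) + (1 - eta)^-1 * eta * m.
  by field; rewrite gt_eqF.
apply: le_trans (ler_normD _ _) _; rewrite mulrDl.
have i0 : 0 <= (1 - eta)^-1 by rewrite invr_ge0 ltW.
apply: lerD.
  rewrite normrM (ger0_norm i0) -mulrA; apply: ler_pM => //.
  by rewrite [C1 * _]mulrC.
rewrite normrM ger0_norm; last by rewrite mulr_ge0// ltW.
rewrite [leRHS]mulrAC; apply: ler_wpM2r => //.
apply: ler_pM => //; first exact: ltW.
by rewrite -a2 expr2 ler_piMr// ltW.
Qed.

(** The derivative is known on (0, 1) only. Its closeness to m bounds increments over [x, y] with x
    > 0, through monotonicity of F corrected by linear terms; Lipschitz continuity then lets x tend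
    to 0. *)
Lemma corr_dq0_right L L' f g : lipf L f -> lipf L' g -> 0 <= L -> 0 <= L' ->
  dq [set y | 0 <= y <= 1] (corr f g) 0 (\sum_j chaos1 f j * chaos1 g j).
Proof.
move=> fL gL L0 L'0.
have [C C0 hC] := dcorr0_le fL gL L0 L'0.
set m := \sum_j _ in hC *.
pose F := corr f g.
have inc x y : 0 < x -> x <= y -> y <= 2^-1 ->
    `|F y - F x - m * (y - x)| <= C * Num.sqrt y * (y - x).
  move=> x0 xy y2.
  have y1 : y < 1 by lra.
  have LE := corr_left_est fL gL L0 L'0 x0 y1.
  have DD z : x <= z <= y -> `|dcorr f g z - m| <= C * Num.sqrt y.
    move=> /andP[xz zy]; apply: (le_trans (hC z _)).
      by rewrite (lt_le_trans x0 xz)/= (le_trans zy).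
    by apply: ler_wpM2l => //; rewrite ler_sqrt// (le_trans (ltW x0)).
  have m1 := left_est_le (left_est_affine 1 (C * Num.sqrt y - m) LE) _ (lexx x) xy (lexx y).
  have m2 := left_est_le (left_est_affine (-1) (C * Num.sqrt y + m) LE) _ (lexx x) xy (lexx y).
  have {}m1 := m1 ltac:(by move=> z /DD /ler_normlP[]; move: (dcorr f g z) (C * Num.sqrt y) => u q; clearbody m; clear; lra).
  have {}m2 := m2 ltac:(by move=> z /DD /ler_normlP[]; move: (dcorr f g z) (C * Num.sqrt y) => u q; clearbody m; clear; lra).
  rewrite ler_norml -/F in m1 m2 *.
  move: m1 m2; move: (F x) (F y) (C * Num.sqrt y) => u v q; clear => m1 m2.
  by apply/andP; split; lra.
have inc0 y : 0 < y -> y <= 2^-1 -> `|F y - F 0 - m * y| <= C * Num.sqrt y * y.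
  move=> y0 y2; apply/ler_addgt0Pr => e e0.
  pose k := L * L' * K2 + `|m| + 1.
  have K20 : 0 <= K2.
    by rewrite /K2 mulr_ge0//; apply: E2_ge0 => *; rewrite addr_ge0 ?sqr_ge0.
  have LLK := mulr_ge0 (mulr_ge0 L0 L'0) K20.
  have k0 : 0 < k by apply: ltr_pwDr => //; exact: addr_ge0.
  pose x := Num.min y (e / k).
  have x0 : 0 < x by rewrite lt_min y0 divr_gt0.
  have xy : x <= y by rewrite ge_min lexx.
  have xk : x * k <= e by rewrite -ler_pdivlMr// ge_min lexx orbT.
  have := inc x y x0 xy y2.
  have F0 : `|F x - F 0| <= L * L' * K2 * x.
    have := @corr_lipschitz R p L L' f g x 0 L0 L'0 fL gL.
    rewrite subr0 (gtr0_norm x0); apply; apply/andP; split; lra.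
  have -> : F y - F 0 - m * y = (F y - F x - m * (y - x)) + ((F x - F 0) - m * x).
    by move: (F y) (F 0) (F x) => u v z; ring.
  move=> h; apply: le_trans (ler_normD _ _) _.
  apply: lerD.
    apply: le_trans h _; apply: ler_wpM2l; first by rewrite mulr_ge0 ?sqrtr_ge0.
    lra.
  apply: le_trans (ler_normB _ _) _; rewrite normrM (gtr0_norm x0).
  apply: le_trans xk; rewrite /k; lra.
move=> e e0.
pose d := Num.min 2^-1 ((e / (C + 1)) ^+ 2).
have C1 : 0 < C + 1 by lra.
exists d; first by rewrite lt_min invr_gt0 ltr0n exprn_gt0// divr_gt0.
move=> y /andP[y0 y1]; rewrite !subr0 (ger0_norm y0) lt_min => /andP[y2 y3].
move: y0; rewrite le_eqVlt => /predU1P[<-|y0].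
  by rewrite !mulr0 subr0 subrr normr0.
apply: le_trans (inc0 y y0 (ltW y2)) _; apply: ler_wpM2r; first exact: ltW.
have ec : 0 <= e / (C + 1) by rewrite divr_ge0// ltW.
have sy : Num.sqrt y <= e / (C + 1).
  by rewrite -[leRHS](ger0_norm ec) -[leRHS]sqrtr_sqr ler_sqrt ?sqr_ge0// ltW.
have := sqrtr_ge0 y; move: sy; rewrite ler_pdivlMr//; lra.
Qed.

Lemma corr_opp2 f g a : tame1 f -> tame1 g ->
  corr f (fun x => g (- x)) (- a) = corr f g a.
Proof.
move=> tf tg; have := corr_opp (- a) tf tg; rewrite opprK => ->//.
Qed.

Lemma corr_dq_opp L' f g x l : tame1 f -> lipf L' g ->
  dq [set y | -1 <= y <= 1] (corr f (fun x => g (- x))) (- x) l ->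
  dq [set y | -1 <= y <= 1] (corr f g) x (- l).
Proof.
move=> tf gL /dq_opp; rewrite opprK => h.
have tg := tame_lip gL.
have e : (fun y => corr f (fun x => g (- x)) (- y)) = corr f g.
  by apply/funext => y; exact: corr_opp2.
rewrite e in h; apply: dq_sub h => y /= /andP[? ?]; apply/andP; split; lra.
Qed.

Lemma chaos1_opp g j : tame1 g -> chaos1 (fun x => g (- x)) j = - chaos1 g j.
Proof.
move=> tg; have t1 := tame_fcoord j tg.
have := E1_opp (f := fun k => - (g k * k j 0)) (tameN t1).
rewrite /chaos1 => h.
transitivity (E1 (fun k : V => - (g (- k) * (- k) j 0))).
  by apply: eq_E1 => k; rewrite mxE mulrN opprK.
rewrite h -mulN1r -E1Z//; apply: eq_E1 => k; exact/esym/mulN1r.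
Qed.

Lemma corr_dq0 L L' f g : lipf L f -> lipf L' g -> 0 <= L -> 0 <= L' ->
  dq [set y | -1 <= y <= 1] (corr f g) 0 (\sum_j chaos1 f j * chaos1 g j).
Proof.
move=> fL gL L0 L'0; have tf := tame_lip fL; have tg := tame_lip gL.
have h1 := corr_dq0_right fL gL L0 L'0.
have := dq_opp (corr_dq0_right fL (lip_opp gL) L0 L'0).
rewrite oppr0 (_ : - \sum_j _ = \sum_j chaos1 f j * chaos1 g j); last first.
  by rewrite -sumrN; apply: eq_bigr => j _; rewrite (chaos1_opp j tg) mulrN opprK.
have e : (fun y => corr f (fun x => g (- x)) (- y)) = corr f g.
  by apply/funext => y; exact: corr_opp2.
rewrite e => h2; apply: dq_sub (dq_setU h1 h2) => y /= /andP[y0 y1].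
by have [y2|y2] := leP 0 y; [left|right]; apply/andP; split; lra.
Qed.

(** Reduces to diagonal correlations, for which convexity in log eta is available. *)
Lemma corr_polar f g a : tame1 f -> tame1 g -> -1 <= a <= 1 ->
  corr f g a = 4^-1 * corr (fun x => f x + g x) (fun x => f x + g x) a
    + (- 4^-1) * corr (fun x => f x - g x) (fun x => f x - g x) a.
Proof.
move=> tf tg a1.
have tfh := tame_lin a (cosin a) tf; have tgh := tame_lin a (cosin a) tg.
have t1 := tameD tf tg; have t2 := tameB tf tg.
have t3 := tameD tfh tgh; have t4 := tameB tfh tgh.
rewrite mulNr -mulrBr /corr -E2B; [|exact: tameM|exact: tameM].
transitivity (4^-1 * E2 (fun x y => 2 * (f x * g (a *: x + cosin a *: y) +
   g x * f (a *: x + cosin a *: y)))); last first.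
  by congr (_ * _); apply: eq_E2 => x y; ring.
rewrite E2Z; last by apply: tameD; exact: tameM.
rewrite E2D; [|exact: tameM|exact: tameM].
rewrite -/(corr f g a) -/(corr g f a) (corr_sym tg tf a1).
by move: (corr f g a) => u; field.
Qed.

(** [corr w w] at a b is the inner product of [OU a w] and [OU b w], so 2 u v <= u^2 + v^2 is
    midpoint convexity in log eta. *)
Lemma corr_diag_dq1 L w : lipf L w -> 0 <= L ->
  exists l, dq [set y | 0 <= y <= 1] (corr w w) 1 l.
Proof.
move=> wL L0; apply: (@log_convex_dq1 _ _ (L * L * K2)).
- move=> a b /andP[a0 a1] /andP[b0 b1].
  have a11 : -1 <= a <= 1 by apply/andP; split; lra.
  have b11 : -1 <= b <= 1 by apply/andP; split; lra.
  rewrite (corr_split wL wL a11 b11) !expr2.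
  rewrite (corr_split wL wL a11 a11) (corr_split wL wL b11 b11).
  have ta := tame_OU a wL; have tb := tame_OU b wL.
  have taa : tame1 (fun x => OU a w x * OU a w x) by exact: (tameM ta ta).
  have tbb : tame1 (fun x => OU b w x * OU b w x) by exact: (tameM tb tb).
  have tab : tame1 (fun x => OU a w x * OU b w x) by exact: (tameM ta tb).
  rewrite -(E1Z 2 tab) -(E1D taa tbb).
  apply: E1_le; [exact: (tameZ 2 tab)|exact: (tameD taa tbb)|].
  move=> x; move: (OU a w x) (OU b w x) => u v.
  have := sqr_ge0 (u - v); rewrite sqrrB; lra.
- move=> x y /andP[x0 x1] /andP[y0 y1].
  by apply: corr_lipschitz => //; apply/andP; split; lra.
Qed.

Lemma corr_dq1 L L' f g : lipf L f -> lipf L' g -> 0 <= L -> 0 <= L' ->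
  exists l, dq [set y | -1 <= y <= 1] (corr f g) 1 l.
Proof.
move=> fL gL L0 L'0; have tf := tame_lip fL; have tg := tame_lip gL.
have LL0 : 0 <= L + L' by exact: addr_ge0.
have l1 : lipf (L + L') (fun x => f x + g x).
  move=> x y; rewrite opprD addrACA mulrDl; apply: le_trans (ler_normD _ _) _.
  exact: lerD.
have l2 : lipf (L + L') (fun x => f x - g x).
  move=> x y; have -> : f x - g x - (f y - g y) = (f x - f y) - (g x - g y) by ring.
  rewrite mulrDl; apply: le_trans (ler_normB _ _) _.
  exact: lerD.
have [u hu] := corr_diag_dq1 l1 LL0; have [v hv] := corr_diag_dq1 l2 LL0.
exists (4^-1 * u + (- 4^-1) * v).
apply: (@dq_local _ _ [set y | 0 <= y <= 1] _ _ _ 1) => //.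
  move=> y /andP[y1 y2]; rewrite ler0_norm; last lra.
  by move=> ?; apply/andP; split; lra.
apply: dq_eq (dq_lin (4^-1) (- 4^-1) hu hv); last by rewrite /= ler01 lexx.
move=> y; rewrite inE/= => /andP[y0 y1]; apply/esym/corr_polar => //.
by apply/andP; split; lra.
Qed.

Lemma corr_dq L L' f g x : lipf L f -> lipf L' g -> 0 <= L -> 0 <= L' ->
  -1 <= x <= 1 -> exists l, dq [set y | -1 <= y <= 1] (corr f g) x l.
Proof.
move=> fL gL L0 L'0.
wlog: x g gL / 0 <= x => [hw|x0] /andP[xm x1].
  have [x0|x0] := leP 0 x; first by apply: hw => //; apply/andP.
  have [||l hl] := hw (- x) (fun x => g (- x)) (lip_opp gL).
  - lra.
  - by apply/andP; split; lra.
  by exists (- l); exact: corr_dq_opp (tame_lip fL) gL hl.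
move: x0; rewrite le_eqVlt => /predU1P[<-|x0].
  by eexists; exact: corr_dq0 fL gL L0 L'0.
move: x1; rewrite le_eqVlt => /predU1P[->|x1].
  exact: corr_dq1 fL gL L0 L'0.
exists (dcorr f g x).
have lo0 : 0 < x / 2 by rewrite divr_gt0.
have hi1 : (1 + x) / 2 < 1 by rewrite ltr_pdivrMr//; lra.
apply: (@dq_sub _ setT) => //.
apply: (left_est_dq (corr_left_est fL gL L0 L'0 lo0 hi1)).
by apply/andP; split; lra.
Qed.
End corr_derivative.

(** * Monotonicity for gradients of convex functions *)

Section psd.
Context {R : realType} {p : nat}.
Local Notation V := 'cV[R]_p.
Implicit Types (u v x y : V) (M N : 'M[R]_p).

Lemma dotvE u v : dotv u v = \sum_i u i 0 * v i 0.
Proof. by rewrite /dotv mxE; apply: eq_bigr => i _; rewrite mxE. Qed.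

Lemma dotvC u v : dotv u v = dotv v u.
Proof. by rewrite !dotvE; apply: eq_bigr => i _; rewrite mulrC. Qed.

Lemma dotvDr u v w : dotv u (v + w) = dotv u v + dotv u w.
Proof. by rewrite /dotv mulmxDr mxE. Qed.

Lemma dotvDl u v w : dotv (v + w) u = dotv v u + dotv w u.
Proof. by rewrite dotvC dotvDr !(dotvC u). Qed.

Lemma dotvZr a u v : dotv u (a *: v) = a * dotv u v.
Proof. by rewrite /dotv -scalemxAr mxE. Qed.

Lemma dotvZl a u v : dotv (a *: u) v = a * dotv u v.
Proof. by rewrite dotvC dotvZr dotvC. Qed.

Lemma dotvNr u v : dotv u (- v) = - dotv u v.
Proof. by rewrite -scaleN1r dotvZr mulN1r. Qed.

Lemma dotvNl u v : dotv (- u) v = - dotv u v.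
Proof. by rewrite dotvC dotvNr dotvC. Qed.

Lemma dotv_mulmx M u v : dotv u (M *m v) = dotv (M^T *m u) v.
Proof. by rewrite /dotv trmx_mul trmxK mulmxA. Qed.

Lemma dotv_delta u i : dotv u (delta_mx i 0) = u i 0.
Proof.
rewrite dotvE (bigD1 i)//= big1 => [|j ji]; rewrite mxE.
  by rewrite !eqxx mulr1 addr0.
by rewrite (negbTE ji) mulr0.
Qed.

Lemma dotvv_ge0 u : 0 <= dotv u u.
Proof. by rewrite dotvE; apply: sumr_ge0 => i _; rewrite -expr2 sqr_ge0. Qed.

Definition psdmx M := M^T = M /\ forall v, 0 <= dotv v (M *m v).

Lemma psdmx_sym M u v : psdmx M -> dotv u (M *m v) = dotv v (M *m u).
Proof. by case=> Ms _; rewrite dotv_mulmx Ms dotvC. Qed.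

Lemma psdmx_quad M x y t : psdmx M ->
  dotv (x + t *: y) (M *m (x + t *: y)) =
  dotv x (M *m x) + 2 * t * dotv x (M *m y) + t ^+ 2 * dotv y (M *m y).
Proof.
move=> hM; rewrite mulmxDr -scalemxAr !dotvDl !dotvDr !dotvZl !dotvZr.
rewrite (psdmx_sym y x hM); ring.
Qed.

Lemma dotv_delta_mx M i j : dotv (delta_mx i 0) (M *m delta_mx j 0) = M i j.
Proof.
rewrite dotvC dotv_delta mxE (bigD1 j)//= big1 => [|k kj].
  by rewrite mxE !eqxx mulr1 addr0.
by rewrite mxE (negbTE kj) mulr0.
Qed.

(** With M i i = 0 the form at e_j + t e_i is affine in t; were its slope nonzero, the chosen t
    would give it the value -1. *)
Lemma psdmx_ker M i j : psdmx M -> M i i = 0 -> M j i = 0.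
Proof.
move=> hM Mii; apply/eqP; apply: contraT => Mji.
pose t := - (M j j + 1) / (2 * M j i).
have := hM.2 (delta_mx j 0 + t *: delta_mx i 0).
rewrite psdmx_quad// !dotv_delta_mx Mii mulr0 addr0.
have -> : 2 * t * M j i = - (M j j + 1) by rewrite /t; field.
lra.
Qed.

(** The form of the Schur complement at v is the minimum of the form of M along the line v + t
    e_i. *)
Lemma psdmx_schur M i : psdmx M -> M i i != 0 ->
  psdmx (M - (M i i)^-1 *: (col i M *m (col i M)^T)).
Proof.
move=> hM Mii; have [Ms _] := hM; split.
  by rewrite linearB/= linearZ/= trmx_mul trmxK Ms.
move=> v.
have colE : col i M = M *m delta_mx i 0 by rewrite -colE.
pose s := dotv v (M *m delta_mx i 0).
have := hM.2 (v + (- (s / M i i)) *: delta_mx i 0).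
rewrite psdmx_quad// -/s dotv_delta_mx.
rewrite mulmxBl dotvDr dotvNr -scalemxAl dotvZr -mulmxA.
have -> : dotv v (col i M *m ((col i M)^T *m v)) = s * s.
  rewrite [(col i M)^T *m v]mx11_scalar mul_mx_scalar dotvZr colE -/s; congr (_ * _).
  by rewrite -/(dotv (M *m delta_mx i 0) v) dotvC.
move=> h; apply: le_trans h _; rewrite le_eqVlt; apply/orP; left; apply/eqP.
by move: (dotv v _) s => A s; field.
Qed.

(* Symmetric elimination writes N as a nonnegative combination of rank-one matrices. *)
Lemma psdmx_trace_ge0 M N : psdmx M -> psdmx N -> 0 <= \sum_i \sum_j M i j * N i j.
Proof.
move=> hM; have [Ms M0] := hM.
(* Induction on the size n of a leading block supporting K: eliminating the last pivot shrinks the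
   block by one. *)
suff H n (K : 'M[R]_p) : psdmx K ->
    (forall i j : 'I_p, (n <= i)%N || (n <= j)%N -> K i j = 0) ->
    0 <= \sum_i \sum_j M i j * K i j.
  by move=> hN; apply: (H p) => // i j; rewrite leqNgt ltn_ord/= leqNgt ltn_ord.
elim: n K => [|n IH] K hK Kn.
  by apply: sumr_ge0 => i _; apply: sumr_ge0 => j _; rewrite Kn// mulr0.
have [pn|np] := leqP p n.
  apply: IH => // i j; rewrite leqNgt (leq_trans (ltn_ord i) pn)/=.
  by rewrite leqNgt (leq_trans (ltn_ord j) pn).
pose i0 := Ordinal np.
have [Ks K0] := hK.
have Ksym i j : K i j = K j i by rewrite -[in LHS]Ks mxE.
have ge (i : 'I_p) : (n <= i)%N -> i = i0 \/ (n.+1 <= i)%N.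
  by rewrite leq_eqVlt => /predU1P[e|]; [left; apply: ord_inj|right].
have [Kz|Kz] := eqVneq (K i0 i0) 0.
  apply: IH => // i j /orP[] /ge[->|h]; try by rewrite Kn// h ?orbT.
    by rewrite Ksym (psdmx_ker _ hK).
  by rewrite (psdmx_ker _ hK).
have hS := psdmx_schur hK Kz.
have d0 : 0 < K i0 i0.
  by rewrite lt_def Kz/= -dotv_delta_mx K0.
set c := col i0 K in hS.
have -> : \sum_i \sum_j M i j * K i j =
   \sum_i \sum_j M i j * (K - (K i0 i0)^-1 *: (c *m c^T)) i j +
   (K i0 i0)^-1 * dotv c (M *m c).
  rewrite dotvE mulr_sumr -big_split; apply: eq_bigr => i _ /=.
  rewrite [(M *m c) i 0]mxE mulr_sumr mulr_sumr -big_split; apply: eq_bigr => j _ /=.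
  by rewrite !mxE big_ord1 !mxE; ring.
apply: addr_ge0; last by rewrite mulr_ge0 ?M0// invr_ge0 ltW.
apply: IH => // i j h.
have -> : (K - (K i0 i0)^-1 *: (c *m c^T)) i j =
    K i j - (K i0 i0)^-1 * (K i i0 * K j i0).
  by rewrite !mxE big_ord1 !mxE.
case/orP: h => /ge[->|h].
- by rewrite (Ksym j); field.
- by rewrite (Kn i j) ?h// (Kn i i0) ?h// mul0r mulr0 subrr.
- by field.
- by rewrite (Kn i j) ?h ?orbT// (Kn j i0) ?h// !mulr0 subrr.
Qed.
End psd.

(** * Gradients of smooth convex functions and the monotonicity of their correlations *)

Section gradient_maps.
Context {R : realType} {p : nat}.
Local Notation V := 'cV[R]_p.
Implicit Types (K : R) (a : V -> R) (u : V -> V).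

(* [u] is the gradient of the convex function [a], with a Lipschitz bound in
   the form of a quadratic upper estimate. *)
Record smooth_convex K a u : Prop := SmoothConvex {
  sc_pos : 0 < K;
  sc_lower : forall x w, a x + dotv (u x) w <= a (x + w);
  sc_upper : forall x w, a (x + w) <= a x + dotv (u x) w + K * dotv w w }.

Lemma dotvv_le_N1 (w : V) : dotv w w <= N1 w ^+ 2.
Proof. by apply: le_trans (sum_sqr_le w); rewrite dotvE ler_sum// => i _; rewrite expr2. Qed.

Lemma sc_mono K a u x y : smooth_convex K a u -> 0 <= dotv (u y - u x) (y - x).
Proof.
move=> H; have := sc_lower H x (y - x); have := sc_lower H y (x - y).
have -> : x + (y - x) = y by rewrite subrKC.
have -> : y + (x - y) = x by rewrite subrKC.
have -> : dotv (u y) (x - y) = - dotv (u y) (y - x) by rewrite -dotvNr opprB.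
rewrite dotvDl dotvNl; lra.
Qed.

(** A gradient step: with D = u x - u y, the value of a at x - l D is bounded below from y and above
    from x, which controls |D|^2 by |x - y|^2. *)
Lemma sc_lip K a u i : smooth_convex K a u -> lipf (2 * K) (fun x => u x i 0).
Proof.
move=> H x y; have K0 := sc_pos H.
pose D := u x - u y; pose w := x - y.
have DD : dotv D D <= 4 * K ^+ 2 * dotv w w.
  (* This value maximizes l - K l^2, the coefficient of |D|^2. *)
  pose l := (2 * K)^-1.
  have h1 := sc_lower H y (w - l *: D).
  have h2 := sc_upper H x (- (l *: D)).
  have h3 := sc_upper H y w.
  have e : y + (w - l *: D) = x - l *: D by rewrite addrA subrKC.
  have e2 : y + w = x by rewrite subrKC.
  rewrite e in h1; rewrite e2 in h3.
  have := le_trans h1 (le_trans h2 (lerD (lerD h3 (lexx _)) (lexx _))).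
  have -> : dotv (u y) (w - l *: D) = dotv (u y) w - l * dotv (u y) D.
    by rewrite dotvDr dotvNr dotvZr.
  rewrite !dotvNr dotvNl dotvZr dotvZl dotvZr opprK.
  have -> : dotv (u x) D = dotv (u y) D + dotv D D.
    by rewrite -dotvDl subrKC.
  move=> h.
  have : l * dotv D D - K * (l * (l * dotv D D)) <= K * dotv w w by lra.
  have -> : l * dotv D D - K * (l * (l * dotv D D)) = dotv D D / (4 * K).
    by rewrite /l; field; rewrite gt_eqF.
  by rewrite ler_pdivrMr ?mulr_gt0//; lra.
have Di : `|u x i 0 - u y i 0| ^+ 2 <= dotv D D.
  rewrite real_normK ?num_real// dotvE (bigD1 i)//= /D !mxE -expr2 lerDl.
  by apply: sumr_ge0 => j _; rewrite -expr2 sqr_ge0.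
have KN : 0 <= 2 * K * N1 (x - y).
  by apply: mulr_ge0 (N1_ge0 _); apply: mulr_ge0 => //; exact: ltW.
rewrite -(@ler_pXn2r _ 2) ?nnegrE//.
apply: le_trans Di _; apply: le_trans DD _.
rewrite exprMn exprMn (_ : 2 ^+ 2 = 4); last by rewrite expr2; ring.
apply: ler_wpM2l; first by rewrite mulr_ge0// sqr_ge0.
exact: dotvv_le_N1.
Qed.

Lemma dotv_le_N1 (x y : V) : `|dotv x y| <= N1 x * N1 y.
Proof. by rewrite dotvE; exact: sum_coord_le. Qed.

Lemma sc_cont K a u x w : smooth_convex K a u ->
  `|a (x + w) - a x| <= (N1 (u x) + K * N1 w) * N1 w.
Proof.
move=> H; have := sc_lower H x w; have := sc_upper H x w.
have /ler_normlP[d1 d2] := dotv_le_N1 (u x) w.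
have := ler_wpM2l (ltW (sc_pos H)) (dotvv_le_N1 w).
have KN : 0 <= K * N1 w ^+ 2 by rewrite mulr_ge0 ?sqr_ge0// ltW// (sc_pos H).
move=> h1 h2 h3; rewrite mulrDl -mulrA -expr2 ler_norml; apply/andP; split; lra.
Qed.

Lemma sc_tame K a u : smooth_convex K a u -> tame1 a.
Proof.
move=> H; have K0 := sc_pos H.
apply: (@tame_dom _ _ _ (fun x _ => `|a 0| + (N1 (u 0) * N1 x + K * (N1 x * N1 x)))).
- apply: mfun2_continuous => x e e0.
  have k0 : 0 < N1 (u x) + K + 1.
    by rewrite ltr_pwDr// addr_ge0 ?N1_ge0// ltW.
  exists (Num.min 1 (e / (N1 (u x) + K + 1))); first by rewrite lt_min ltr01 divr_gt0.
  move=> y; rewrite lt_min => /andP[y1 y2].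
  have := sc_cont x (y - x) H; rewrite subrKC.
  move: (N1 (y - x)) (N1_ge0 (y - x)) y1 y2 => n n0 n1; rewrite ltr_pdivlMr// => n2 h.
  apply: le_lt_trans h _; apply: le_lt_trans n2; rewrite mulrC; apply: ler_wpM2l => //.
  have : K * n <= K by rewrite ler_piMr// ltW.
  lra.
- apply: tameD; first exact: tame_cst.
  apply: tameD; first by apply: tameZ; exact: tame_N1.
  by apply: tameZ; apply: tameM; exact: tame_N1.
- move=> x _; have := sc_cont 0 x H; rewrite add0r mulrDl -mulrA => h.
  rewrite -[a x](subrKC (a 0)); apply: le_trans (ler_normD _ _) _.
  by rewrite lerD2l.
Qed.

(** The Gaussian mean of the Jacobian of u, integrated by parts because u is merely Lipschitz. *)
Definition chaosM u : 'M[R]_p := \matrix_(i, j) E1 (fun k : V => u k i 0 * k j 0).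

(** A second integration by parts, moving the derivative from a to the density; the result is
    symmetric in i and j, which replaces the symmetry of second derivatives. The mean of a (k + z)
    (k + z)_j at z = t e_i is expanded in t twice: through the density, and through the smoothness
    of a. *)
Lemma sc_chaos_formula K a u i j : smooth_convex K a u ->
  E1 (fun k => u k i 0 * k j 0) =
  E1 (fun k => a k * k j 0 * k i 0) - (i == j)%:R * E1 a.
Proof.
move=> H; have K0 := sc_pos H.
have ta := sc_tame H.
have tu := tame_lip (sc_lip i H).
have taj := tame_fcoord j ta.
have tuj := tame_fcoord j tu.
have taji : tame1 (fun k => a k * k j 0 * k i 0) by exact: (tame_fcoord i taj).
pose d : R := (i == j)%:R.
apply/eqP; rewrite -subr_eq0 opprB addrA; apply/eqP.
pose g (k : V) := `|a k * k j 0|.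
have tg : tame1 g by exact: (tame1_abs taj).
pose h (k : V) := K * (N1 k + 1) + `|u k i 0|.
have th : tame1 h.
  apply: tameD; last exact: (tame1_abs tu).
  by apply: tameZ; apply: tameD; [exact: tame_N1|exact: tame_cst].
apply: (@small_quadratic _ _ (E1 (fun k => g k * cm_rem k) + E1 h)) => t /andP[t0 t1].
pose z : V := t *: delta_mx i 0.
have zE l : z l 0 = t * (l == i)%:R by rewrite !mxE eqxx andbT.
have Nz : N1 z = t.
  rewrite /N1 (bigD1 i)//= big1 => [|l li]; last by rewrite zE (negbTE li) mulr0 normr0.
  by rewrite zE eqxx mulr1 addr0 gtr0_norm.
have := @E1_taylor _ _ (fun k => a k * k j 0) g z taj tg (fun=> lexx _).
rewrite Nz => /(_ t1).
rewrite (bigD1 i)//= big1 => [|l li]; last by rewrite zE (negbTE li) mulr0 mul0r.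
rewrite zE eqxx mulr1 addr0 => e1.
have tazj : tame1 (fun k => a (k + z) * (k + z) j 0).
  have := tame1_affine z 1 taj; rewrite /tame1.
  by under eq_fun do under eq_fun do rewrite scale1r addrC.
have tlin : tame1 (fun k => a k * k j 0 + t * (u k i 0 * k j 0 + d * a k)).
  apply: tameD => //; apply: tameZ; apply: tameD => //; exact: tameZ.
have e2 : `|E1 (fun k => a (k + z) * (k + z) j 0) -
    E1 (fun k => a k * k j 0 + t * (u k i 0 * k j 0 + d * a k))| <= t ^+ 2 * E1 h.
  rewrite -(E1B tazj tlin) -(E1Z _ th); apply: E1_norm_le.
  - exact: (tameB tazj tlin).
  - exact: tameZ.
  move=> k.
  have := sc_lower H k z; have := sc_upper H k z.
  have dzz : dotv z z = t ^+ 2.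
    by rewrite /z dotvZl dotvZr dotv_delta mxE !eqxx mulr1 expr2.
  have duz : dotv (u k) z = t * u k i 0 by rewrite /z dotvZr dotv_delta.
  rewrite dzz duz => u1 u2.
  pose rho := a (k + z) - a k - t * u k i 0.
  have rho0 : 0 <= rho <= K * t ^+ 2 by rewrite /rho; apply/andP; split; lra.
  have d01 : 0 <= d <= 1 by rewrite /d; case: (i == j); rewrite ?lexx ?ler01.
  have -> : a (k + z) * (k + z) j 0 - (a k * k j 0 + t * (u k i 0 * k j 0 + d * a k)) =
    rho * (k j 0 + t * d) + t ^+ 2 * (d * u k i 0).
    rewrite mxE zE eq_sym -/d (_ : a (k + z) = rho + a k + t * u k i 0); last by rewrite /rho; ring.
    by ring.
  case/andP: rho0 => r0 r1; case/andP: d01 => d0 d1.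
  apply: le_trans (ler_normD _ _) _; rewrite /h [leRHS]mulrDr; apply: lerD.
    rewrite normrM (ger0_norm r0) [leRHS]mulrA [t ^+ 2 * K]mulrC; apply: ler_pM => //.
    apply: le_trans (ler_normD _ _) _; apply: lerD; first exact: coord_le_N1.
    by rewrite ger0_norm ?mulr_ge0 ?(ltW t0)// mulr_ile1// ltW.
  rewrite normrM ger0_norm ?sqr_ge0//; apply: ler_wpM2l; first exact: sqr_ge0.
  by rewrite normrM ger0_norm// ler_piMl.
have e3 : E1 (fun k => a k * k j 0 + t * (u k i 0 * k j 0 + d * a k)) =
   E1 (fun k => a k * k j 0) + t * (E1 (fun k => u k i 0 * k j 0) + d * E1 a).
  rewrite E1D//; last by apply: tameZ; apply: tameD => //; exact: tameZ.
  rewrite E1Z; last by apply: tameD => //; exact: tameZ.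
  by rewrite E1D// ?E1Z//; exact: tameZ.
rewrite e3 in e2.
set A := E1 (fun k => a (k + z) * (k + z) j 0) in e1 e2.
set B := E1 (fun k => a k * k j 0) in e1 e2.
set C := E1 (fun k => a k * k j 0 * k i 0) in e1 *.
set U := E1 (fun k => u k i 0 * k j 0) in e2 *.
rewrite -/d.
have -> : t * (U + d * E1 a - C) =
   (A - B - t * C) - (A - (B + t * (U + d * E1 a))) by ring.
apply: le_trans (ler_normB _ _) _; rewrite mulrDl; apply: lerD.
  by rewrite [leRHS]mulrC.
by rewrite [leRHS]mulrC.
Qed.

(** Positivity comes from monotonicity of u: the mean of f = (u, v) does not decrease when k is
    translated by t v, and the first-order term of that change is t times the quadratic form at
    v. *)
Lemma sc_chaos_psd K a u : smooth_convex K a u -> psdmx (chaosM u).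
Proof.
move=> H; split.
  apply/matrixP => i j; rewrite !mxE (sc_chaos_formula i j H) (sc_chaos_formula j i H).
  rewrite eq_sym; congr (_ - _); apply: eq_E1 => k; exact: mulrAC.
move=> v.
pose f (k : V) := dotv (u k) v.
have tu i := tame_lip (sc_lip i H).
have tf : tame1 f.
  rewrite /f /tame1; under eq_fun do under eq_fun do rewrite dotvE.
  apply: (@tame_sum R p _ _ (fun i (x _ : V) => u x i 0 * v i 0)) => i.
  by apply: tameM; [exact: tu|exact: tame_cst].
have qf : dotv v (chaosM u *m v) = \sum_j v j 0 * E1 (fun k => f k * k j 0).
  rewrite (_ : \sum_j v j 0 * E1 (fun k => f k * k j 0) =
    \sum_j \sum_i v j 0 * (v i 0 * chaosM u i j)); last first.
    apply: eq_bigr => j _; rewrite -mulr_sumr; congr (_ * _).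
    transitivity (E1 (fun k => \sum_i v i 0 * (u k i 0 * k j 0))).
      apply: eq_E1 => k; rewrite /f dotvE mulr_suml; apply: eq_bigr => i _; ring.
    rewrite E1_sum => [|i]; last by apply: tameZ; exact: tame_fcoord (tu i).
    by apply: eq_bigr => i _; rewrite E1Z ?mxE//; exact: tame_fcoord (tu i).
  rewrite exchange_big dotvE; apply: eq_bigr => i _ /=.
  by rewrite mxE mulr_sumr; apply: eq_bigr => j _; ring.
rewrite qf; set Q := \sum_j _.
pose g (k : V) := `|f k|.
have tg : tame1 g by exact: tame1_abs.
pose C := N1 v ^+ 2 * E1 (fun k => g k * cm_rem k).
have C0 : 0 <= C.
  apply: mulr_ge0; first exact: sqr_ge0.
  by apply: E1_ge0 => k; apply: mulr_ge0 (normr_ge0 _) (cm_rem_ge0 _).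
have v1 : 0 < N1 v + 1 by rewrite ltr_pwDr ?N1_ge0.
have main t : 0 < t -> t * (N1 v + 1) <= 1 -> - (C * t) <= Q.
  move=> t0 t1.
  have Nz : N1 (t *: v) <= 1.
    rewrite N1Z gtr0_norm//; apply: le_trans t1; rewrite ler_pM2l// lerDl//.
  have := @E1_taylor _ _ f g (t *: v) tf tg (fun=> lexx _) Nz.
  have -> : \sum_j (t *: v) j 0 * E1 (fun k => f k * k j 0) = t * Q.
    by rewrite /Q mulr_sumr; apply: eq_bigr => j _; rewrite mxE mulrA.
  have tfs : tame1 (fun k => f (k + t *: v)).
    have := tame1_affine (t *: v) 1 tf; rewrite /tame1.
    by under eq_fun do under eq_fun do rewrite scale1r addrC.
  have : E1 f <= E1 (fun k => f (k + t *: v)).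
    apply: E1_le => // k; rewrite /f -subr_ge0 -dotvNl -dotvDl.
    have := sc_mono k (k + t *: v) H.
    by rewrite [k + _ - k]addrAC subrr add0r dotvZr pmulr_rge0.
  rewrite N1Z (gtr0_norm t0) exprMn -mulrA -/C.
  move: (E1 f) (E1 _) => e1 e2 h1 /ler_normlP[_ h2].
  have h3 : - (t ^+ 2 * C) <= t * Q by move: (t * Q) (t ^+ 2 * C) h2 => X Y h2; lra.
  by rewrite -(ler_pM2l t0) mulrN mulrCA -expr2 mulrC.
rewrite -oppr_le0; apply/ler_addgt0Pr => e e0; rewrite add0r.
pose t := Num.min (N1 v + 1)^-1 (e / (C + 1)).
have C1 : 0 < C + 1 by rewrite ltr_pwDr.
have t0 : 0 < t by rewrite lt_min invr_gt0 v1 divr_gt0.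
have t1 : t * (N1 v + 1) <= 1 by rewrite -ler_pdivlMr// mul1r ge_min lexx.
have := main t t0 t1.
have : t * (C + 1) <= e by rewrite -ler_pdivlMr// ge_min lexx orbT.
lra.
Qed.

Lemma sc_affine K a u c b : 0 < b -> smooth_convex K a u ->
  smooth_convex (K * b) (fun x => b^-1 * a (c + b *: x)) (fun x => u (c + b *: x)).
Proof.
move=> b0 H; split.
- by rewrite mulr_gt0// (sc_pos H).
- move=> x w; have := sc_lower H (c + b *: x) (b *: w).
  rewrite dotvZr scalerDr addrA; move: (a _) (a _) (dotv _ _) => A B D h.
  by rewrite -(ler_pM2l b0) mulrDr !mulVKf ?gt_eqF.
- move=> x w; have := sc_upper H (c + b *: x) (b *: w).
  rewrite dotvZr dotvZl dotvZr scalerDr addrA.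
  move: (a _) (a _) (dotv _ _) (dotv w w) => A B D E h.
  rewrite -(ler_pM2l b0) mulVKf ?gt_eqF//; apply: le_trans h _.
  rewrite le_eqVlt; apply/orP; left; apply/eqP; field.
  by rewrite gt_eqF.
Qed.

Lemma sc_opp K a u : smooth_convex K a u ->
  smooth_convex K (fun x => a (- x)) (fun x => - u (- x)).
Proof.
move=> H; split; first exact: sc_pos H.
  by move=> x w; rewrite dotvNl -dotvNr opprD; exact: (sc_lower H).
move=> x w; rewrite dotvNl -dotvNr opprD.
by have := sc_upper H (- x) (- w); rewrite [dotv (- w) (- w)]dotvNl [dotv w (- w)]dotvNr opprK.
Qed.

Section monotone.
Variables (K K' : R) (a a' : V -> R) (u u' : V -> V).
Hypotheses (H : smooth_convex K a u) (H' : smooth_convex K' a' u').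

(** For fixed x the map k -> u (s x + cosin s k) is again a gradient, and the matrix of [dOU] at x
    is s / cosin s times its [chaosM]; the trace inequality thus applies pointwise in x. *)
Lemma dcorr_sum_ge0 eta : 0 < eta < 1 ->
  0 <= \sum_i dcorr (fun x => u x i 0) (fun x => u' x i 0) eta.
Proof.
move=> /andP[e0 e1]; rewrite /dcorr -mulr_sumr; apply: mulr_ge0; first by rewrite invr_ge0 ltW.
set s := Num.sqrt eta.
have s01 : 0 <= s < 1.
  exact: sqrt_lt1.
have c0 : 0 < cosin s by exact: cosin_gt0.
have K0 : 0 <= 2 * K by apply: mulr_ge0 => //; exact: ltW (sc_pos H).
have K'0 : 0 <= 2 * K' by apply: mulr_ge0 => //; exact: ltW (sc_pos H').
have tt i j : tame1 (fun x => dOU s (fun x => u x i 0) j x * dOU s (fun x => u' x i 0) j x).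
  by apply: tameM; [exact: tame_dOU (sc_lip i H) K0 s01|exact: tame_dOU (sc_lip i H') K'0 s01].
pose D (x : V) := \sum_i \sum_j dOU s (fun x => u x i 0) j x * dOU s (fun x => u' x i 0) j x.
have -> : \sum_i \sum_j E1 (fun x => dOU s (fun x => u x i 0) j x * dOU s (fun x => u' x i 0) j x)
    = E1 D.
  rewrite /D E1_sum => [|i]; last exact: tame_sum (tt i).
  by apply: eq_bigr => i _; rewrite E1_sum => [//|j]; exact: tt.
apply: E1_ge0 => x.
have := psdmx_trace_ge0 (sc_chaos_psd (sc_affine (s *: x) c0 H)) (sc_chaos_psd (sc_affine (s *: x) c0 H')).
move/(mulr_ge0 (sqr_ge0 (s / cosin s))); rewrite mulr_sumr => h; apply: le_trans h _.
rewrite le_eqVlt; apply/orP; left; apply/eqP.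
apply: eq_bigr => i _; rewrite mulr_sumr; apply: eq_bigr => j _.
by rewrite !mxE /dOU expr2 mulrACA.
Qed.

Definition corrs (u1 u2 : V -> V) (eta : R) :=
  \sum_i corr (fun x => u1 x i 0) (fun x => u2 x i 0) eta.

Lemma corrs_mono01 (x y : R) : 0 <= x -> x <= y -> y <= 1 -> corrs u u' x <= corrs u u' y.
Proof.
have K0 : 0 <= 2 * K by apply: mulr_ge0 => //; exact: ltW (sc_pos H).
have K'0 : 0 <= 2 * K' by apply: mulr_ge0 => //; exact: ltW (sc_pos H').
have inner (x' y' : R) : 0 < x' -> x' <= y' -> y' < 1 -> corrs u u' x' <= corrs u u' y'.
  move=> x0 xy y1.
  have le i := corr_left_est (sc_lip i H) (sc_lip i H') K0 K'0 x0 y1.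
  apply: (left_est_le (left_est_sum (index_enum _) le)) => // z /andP[z0 z1].
  by apply: dcorr_sum_ge0; rewrite (lt_le_trans x0 z0) (le_lt_trans z1 y1).
pose L := \sum_(i < p) (2 * K) * (2 * K') * @K2 R p.
have lip (s t : R) : -1 <= s <= 1 -> -1 <= t <= 1 -> corrs u u' s <= corrs u u' t + L * `|s - t|.
  move=> a1 b1; rewrite addrC -lerBlDr /corrs -sumrB /L mulr_suml; apply: ler_sum => i _.
  apply: le_trans (ler_norm _) _.
  exact: corr_lipschitz K0 K'0 (sc_lip i H) (sc_lip i H') a1 b1.
have L0 : 0 <= L.
  apply: sumr_ge0 => i _; apply: mulr_ge0; first exact: mulr_ge0.
  by apply: mulr_ge0 => //; apply: E2_ge0 => k l; apply: addr_ge0; exact: sqr_ge0.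
move=> x0 xy y1; apply/ler_addgt0Pr => e e0.
pose d := Num.min 4^-1 (e / (2 * (L + 1))).
have L1 : 0 < 2 * (L + 1) by lra.
have d0 : 0 < d by rewrite lt_min invr_gt0 divr_gt0//; lra.
have d1 : d <= 4^-1 by rewrite ge_min lexx.
have d2 : d * (2 * (L + 1)) <= e by rewrite -ler_pdivlMr// ge_min lexx orbT.
(* Contracts [0, 1] into (0, 1), where the derivative is available, moving each point by at most
   d. *)
pose sh (z : R) := d + (1 - 2 * d) * z.
have shE (z : R) : 0 <= z -> z <= 1 -> `|z - sh z| <= d.
  move=> z0 z1; rewrite ler_norml /sh; apply/andP; split; nra.
have sh1 (z : R) : 0 <= z -> z <= 1 -> 0 < sh z < 1.
  move=> z0 z1; rewrite /sh; apply/andP; split; nra.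
have bd (z : R) : 0 <= z -> z <= 1 -> -1 <= z <= 1.
  move=> z0 z1; rewrite z1 andbT; apply: le_trans z0; exact: lerN10.
have x1 := le_trans xy y1; have y0 := le_trans x0 xy.
have /andP[sx0 sx1] := sh1 x x0 x1; have /andP[sy0 sy1] := sh1 y y0 y1.
have sxy : sh x <= sh y by rewrite lerD2l ler_wpM2l//; lra.
have h1 := lip x (sh x) (bd _ x0 x1) (bd _ (ltW sx0) (ltW sx1)).
have h2 := lip (sh y) y (bd _ (ltW sy0) (ltW sy1)) (bd _ y0 y1).
have h3 := inner _ _ sx0 sxy sy1.
have h4 := ler_wpM2l L0 (shE x x0 x1).
have h5 := ler_wpM2l L0 (shE y y0 y1).
rewrite distrC in h5.
move: h1 h2 h3 h4 h5; move: (corrs u u' (sh x)) (corrs u u' (sh y)) (corrs u u' x) (corrs u u' y).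
move=> A B C D h1 h2 h3 h4 h5; lra.
Qed.
End monotone.

(** The map k -> - u' (- k) is again a gradient of a convex function, so monotonicity on [0, 1]
    transfers to [-1, 0]. *)
Lemma corrs_opp K K' a a' u u' (z : R) : smooth_convex K a u -> smooth_convex K' a' u' ->
  corrs u u' (- z) = - corrs u (fun k => - u' (- k)) z.
Proof.
move=> H H'; rewrite /corrs -sumrN; apply: eq_bigr => i _.
have tu := tame_lip (sc_lip i H); have tu' := tame_lip (sc_lip i H').
rewrite corr_opp// /corr -mulN1r -E2Z; last first.
  exact: tameM tu (tame_lin z (cosin z) (tame_lip (sc_lip i (sc_opp H')))).
by apply: eq_E2 => k l; rewrite mxE mulN1r mulrN opprK.
Qed.

Lemma corrs_mono K K' a a' u u' (x y : R) : smooth_convex K a u -> smooth_convex K' a' u' ->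
  -1 <= x -> x <= y -> y <= 1 -> corrs u u' x <= corrs u u' y.
Proof.
move=> H H' x1 xy y1.
have neg (s t : R) : -1 <= s -> s <= t -> t <= 0 -> corrs u u' s <= corrs u u' t.
  move=> s1 st t0; rewrite -(opprK s) -(opprK t) !(corrs_opp _ H H') lerN2.
  by apply: (corrs_mono01 H (sc_opp H')); rewrite ?oppr_ge0 ?lerN2// lerNl.
have [x0|x0] := leP 0 x; first exact: (corrs_mono01 H H').
have [y0|y0] := leP y 0; first exact: neg.
apply: le_trans (neg _ 0 _ _ _) _ => //; first exact: ltW.
by apply: (corrs_mono01 H H') => //; exact: ltW.
Qed.
End gradient_maps.

(** * Slope and size of correlations *)

Section corrs_theory.
Context {R : realType} {p : nat}.
Local Notation V := 'cV[R]_p.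
Implicit Types (K s : R) (a : V -> R) (u : V -> V).

(** The upper bound for a is the lower bound for its complement and conversely; the constant s / 2
    is normalized so that the complementary map is s x - u x. *)
Lemma sc_compl s a u : smooth_convex (s / 2) a u ->
  smooth_convex (s / 2) (fun x => s / 2 * dotv x x - a x) (fun x => s *: x - u x).
Proof.
move=> H; split; first exact: sc_pos H.
  move=> x w; have := sc_upper H x w.
  rewrite !dotvDl !dotvDr (dotvC w x) dotvNl dotvZl.
  move: (a _) (a _) (dotv _ _) (dotv _ _) (dotv _ _) (dotv _ _) => A B C D E F; lra.
move=> x w; have := sc_lower H x w.
rewrite !dotvDl !dotvDr (dotvC w x) dotvNl dotvZl.
move: (a _) (a _) (dotv _ _) (dotv _ _) (dotv _ _) (dotv _ _) => A B C D E F; lra.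
Qed.

Lemma corr_coord (g : V -> R) i eta : tame1 g -> -1 <= eta <= 1 ->
  corr (fun x => x i 0) g eta = eta * E1 (fun k => k i 0 * g k).
Proof.
move=> tg eta1; have tc := @tame_coord R p i.
rewrite corr_sym// /corr.
transitivity (E2 (fun x y => eta * (x i 0 * g x) + cosin eta * (g x * y i 0))).
  by apply: eq_E2 => x y; rewrite !mxE; ring.
have t1 : tame (fun x _ : V => x i 0 * g x) by exact: (tameM tc tg).
have t2 : tame (fun x y : V => g x * y i 0).
  exact: (tameM tg (tame_snd tc)).
rewrite (E2D (tameZ eta t1) (tameZ (cosin eta) t2)) (E2Z eta t1) (E2Z _ t2).
rewrite (E2_prod tg tc) E1_coord mulr0 mulr0 addr0.
by rewrite (E2_E1 t1.1).
Qed.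

Definition lipv K u := forall i, lipf K (fun x => u x i 0).

Lemma sc_lipv K a u : smooth_convex K a u -> lipv (2 * K) u.
Proof. by move=> H i; exact: sc_lip H. Qed.

Lemma sc_K0 K a u : smooth_convex K a u -> 0 <= 2 * K.
Proof. by move=> /sc_pos K0; apply: mulr_ge0 => //; exact: ltW. Qed.

Lemma corrs_sym K K' u u' eta : lipv K u -> lipv K' u' -> -1 <= eta <= 1 ->
  corrs u u' eta = corrs u' u eta.
Proof.
move=> uK u'K eta1; apply: eq_bigr => i _.
exact: corr_sym (tame_lip (uK i)) (tame_lip (u'K i)) eta1.
Qed.

Lemma corrs_id K u eta : lipv K u -> -1 <= eta <= 1 ->
  corrs (fun x => x) u eta = eta * E1 (fun k => dotv k (u k)).
Proof.
move=> uK eta1; rewrite /corrs.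
transitivity (\sum_i eta * E1 (fun k : V => k i 0 * u k i 0)).
  by apply: eq_bigr => i _; exact: corr_coord (tame_lip (uK i)) eta1.
rewrite -mulr_sumr; congr (_ * _); rewrite -E1_sum => [|i]; last first.
  exact: tameM (tame_coord i) (tame_lip (uK i)).
by apply: eq_E1 => k; rewrite dotvE.
Qed.

Lemma corrs_lin K K' u u' s eta : lipv K u -> lipv K' u' -> -1 <= eta <= 1 ->
  corrs (fun x => s *: x - u x) u' eta =
  s * (eta * E1 (fun k => dotv k (u' k))) - corrs u u' eta.
Proof.
move=> uK u'K eta1; rewrite -(corrs_id u'K eta1) /corrs mulr_sumr -sumrB.
apply: eq_bigr => i _; rewrite /corr.
have t' := tame_lin eta (cosin eta) (tame_lip (u'K i)).
have t1 := tameM (tame_coord i) t'.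
have t2 := tameM (tame_lip (uK i)) t'.
rewrite -(E2Z s t1) -(E2B (tameZ s t1) t2).
by apply: eq_E2 => x y; rewrite !mxE mulrBl mulrA.
Qed.

Lemma corrs_lip s K' a a' u u' (x y : R) :
  smooth_convex (s / 2) a u -> smooth_convex K' a' u' ->
  -1 <= x -> x <= y -> y <= 1 ->
  corrs u u' y - corrs u u' x <= s * E1 (fun k => dotv k (u' k)) * (y - x).
Proof.
move=> H H' x1 xy y1.
have := corrs_mono (sc_compl H) H' x1 xy y1.
rewrite (corrs_lin s (sc_lipv H) (sc_lipv H')); last by rewrite x1 (le_trans xy).
rewrite (corrs_lin s (sc_lipv H) (sc_lipv H')); last by rewrite y1 (le_trans x1).
move: (corrs u u' x) (corrs u u' y) (E1 _) => A B C h; lra.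
Qed.

(** Young's inequality with a free weight l stands in for Cauchy-Schwarz; the optimal weight is
    inserted once the second moments are known. *)
Lemma corrs_bound K K' u u' (l eta : R) : lipv K u -> lipv K' u' -> 0 < l ->
  -1 <= eta <= 1 ->
  `|corrs u u' eta| <= 2^-1 * (l * E1 (fun k => dotv (u k) (u k)) +
                          l^-1 * E1 (fun k => dotv (u' k) (u' k))).
Proof.
move=> uK u'K l0 eta1.
have tu i := tame_lip (uK i); have tu' i := tame_lip (u'K i).
have h i : `|corr (fun x => u x i 0) (fun x => u' x i 0) eta| <=
   2^-1 * (l * E1 (fun k => u k i 0 * u k i 0) + l^-1 * E1 (fun k => u' k i 0 * u' k i 0)).
  have tt := tameM (tu i) (tame_lin eta (cosin eta) (tu' i)).
  have t1 : tame (fun x _ : V => u x i 0 * u x i 0) by exact: tameM (tu i) (tu i).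
  have t2' : tame1 (fun x : V => u' x i 0 * u' x i 0) by exact: tameM (tu' i) (tu' i).
  have t2 := tame_lin eta (cosin eta) t2'.
  rewrite -(E2_marginal t2' eta1) -(E2_E1 t1.1).
  rewrite -(E2Z l t1) -(E2Z l^-1 t2) -(E2D (tameZ l t1) (tameZ l^-1 t2)).
  have t3 := tameD (tameZ l t1) (tameZ l^-1 t2).
  rewrite -(E2Z 2^-1 t3); apply: E2_norm_le tt (tameZ _ t3) _ => x y.
  move: (u x i 0) (u' _ i 0) => A B.
  have ll : 0 < l^-1 by rewrite invr_gt0.
  have e : l * l^-1 = 1 by rewrite divff// gt_eqF.
  move: (l^-1) ll e => m m0 e.
  have h1 : 0 <= m * (l * A - B) ^+ 2 by rewrite mulr_ge0 ?sqr_ge0// ltW.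
  have h2 : 0 <= m * (l * A + B) ^+ 2 by rewrite mulr_ge0 ?sqr_ge0// ltW.
  have e1 : m * (l * A - B) ^+ 2 = (l * m) * l * A * A - 2 * (l * m) * (A * B) + m * B * B by ring.
  have e2 : m * (l * A + B) ^+ 2 = (l * m) * l * A * A + 2 * (l * m) * (A * B) + m * B * B by ring.
  rewrite e in e1 e2; rewrite ler_norml; apply/andP; split; lra.
have sums v K0 : lipv K0 v ->
    E1 (fun k => dotv (v k) (v k)) = \sum_i E1 (fun k : V => v k i 0 * v k i 0).
  move=> vK; rewrite -E1_sum => [|i]; last exact: tameM (tame_lip (vK i)) (tame_lip (vK i)).
  by apply: eq_E1 => k; rewrite dotvE.
rewrite (sums _ _ uK) (sums _ _ u'K) 2!mulr_sumr -big_split/= mulr_sumr.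
by apply: le_trans (ler_norm_sum _ _ _) _; apply: ler_sum => i _; exact: h.
Qed.

Lemma dq_sum (I : Type) (r : seq I) A (F : I -> R -> R) (l : I -> R) x :
  (forall i, dq A (F i) x (l i)) ->
  dq A (fun y => \sum_(i <- r) F i y) x (\sum_(i <- r) l i).
Proof.
move=> h; elim: r => [|i r IH].
  move=> e e0; exists 1 => // y _ _; rewrite !big_nil mul0r subrr subr0 normr0.
  by rewrite mulr_ge0// ltW.
have := dq_lin 1 1 (h i) IH; rewrite !mul1r big_cons.
by under eq_fun do rewrite !mul1r -(big_cons 0 +%R i r xpredT (fun i => F i _)).
Qed.

Lemma corrs_dq K K' u u' x : lipv K u -> lipv K' u' -> 0 <= K -> 0 <= K' ->
  -1 <= x <= 1 -> exists l, dq [set y | -1 <= y <= 1] (corrs u u') x l.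
Proof.
move=> uK u'K K0 K'0 x1.
have /choice[l hl] i := corr_dq (uK i) (u'K i) K0 K'0 x1.
exists (\sum_i l i); exact: dq_sum hl.
Qed.
End corrs_theory.

Lemma Rintegral_gt0 d (T : measurableType d) (R : realType) (P : probability T R) (f : T -> R) :
  P.-integrable setT (EFin \o f) -> (forall x, 0 < f x) -> 0 < \int[P]_x f x.
Proof.
move=> fi f0.
have I0 : 0 <= \int[P]_x f x by apply: Rintegral_ge0 => x _; exact: ltW.
rewrite lt_neqAle I0 andbT eq_sym; apply/negP => /eqP I00.
have mf := measurable_int _ fi.
have z : (\int[P]_x `|(EFin \o f) x|)%E = 0%E.
  under eq_integral do rewrite /= ger0_norm ?(ltW (f0 _))//.
  have fin := integrable_fin_num (@measurableT _ T) fi.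
  by rewrite -(fineK fin) -/(Rintegral _ _ _) I00.
have [/(_ z) + _] := ae_eq_integral_abs P (@measurableT _ T) mf.
move=> [N [mN N0 sN]].
have : P N = 1%E.
  rewrite (_ : N = setT) ?probability_setT//; apply/seteqP; split => // x _; apply: sN => /=.
  by move=> /(_ I) [] fx; have := f0 x; rewrite fx ltxx.
by rewrite N0 => /eqP; rewrite eq_sym onee_eq0.
Qed.

(** * Strict monotonicity in dimension one *)

Section positivity.
Context {R : realType} {p : nat}.
Local Notation V := 'cV[R]_p.
Implicit Types (f : V -> R) (z : V).

Lemma E1_gt0 f : tame1 f -> (forall x, 0 < f x) -> 0 < E1 f.
Proof.
move=> tf f0; rewrite -(E2_E1 tf.1).
exact: (Rintegral_gt0 (tame_integrable tf) (fun w => f0 (colt w.1))).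
Qed.

(* A nonnegative function of zero Gaussian mean has zero mean under every
   translate: Young's inequality for sqrt f * (sqrt f * density). *)
Lemma E1_shift_null f z : tame1 f -> (forall x, 0 <= f x) -> E1 f = 0 ->
  E1 (fun x => f (x + z)) <= 0.
Proof.
move=> tf f0 f00; rewrite (E1_shift z tf).
have tw := tame_cmw z.
have tfw : tame1 (fun x => f x * cmw z x) by exact: tameM tf tw.
have tfww : tame1 (fun x => f x * cmw z x * cmw z x) by exact: tameM tfw tw.
pose C := E1 (fun x => f x * cmw z x * cmw z x).
have C0 : 0 <= C.
  apply: E1_ge0 => x; rewrite -mulrA; apply: mulr_ge0 => //.
  by rewrite -expr2 sqr_ge0.
have h l : 0 < l -> E1 (fun x => f x * cmw z x) <= l * C.
  move=> l0.
  have -> : l * C = E1 (fun x => l^-1 * f x + l * (f x * cmw z x * cmw z x)).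
    by rewrite (E1D (tameZ _ tf) (tameZ _ tfww)) (E1Z _ tf) (E1Z _ tfww) f00 mulr0 add0r.
  apply: E1_le => //; first exact: tameD (tameZ _ tf) (tameZ _ tfww).
  move=> x; move: (f x) (f0 x) (cmw z x) => A A0 w.
  have ll : 0 < l^-1 by rewrite invr_gt0.
  have e : l * l^-1 = 1 by rewrite divff// gt_eqF.
  move: (l^-1) ll e => m m0 e.
  have h1 : 0 <= A * (m * (l * w - 2^-1) ^+ 2).
    by apply: mulr_ge0 => //; apply: mulr_ge0; [exact: ltW|exact: sqr_ge0].
  have e1 : m * (l * w - 2^-1) ^+ 2 = (l * m) * l * w * w - (l * m) * w + m * 4^-1.
    by field.
  have h3 : 0 <= A * m by apply: mulr_ge0 => //; exact: ltW.
  rewrite e1 e in h1; nra.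
apply/ler_addgt0Pr => e e0; rewrite add0r.
apply: le_trans (h (e / (C + 1)) _) _; first by rewrite divr_gt0// ltr_pwDr.
by rewrite mulrAC ler_pdivrMr ?ltr_pwDr// ler_pM2l// lerDl.
Qed.
End positivity.

Lemma mid_between {R : realType} (s t : R) : s < t -> s < (s + t) / 2 < t.
Proof. by move=> st; apply/andP; split; lra. Qed.

(** If F s = F t, monotonicity makes F constant on [s, t], against a positive derivative at the
    midpoint. *)
Lemma dq_strict {R : realType} (F : R -> R) (s t D : R) : s < t ->
  (forall c d, s <= c -> c <= d -> d <= t -> F c <= F d) ->
  dq setT F ((s + t) / 2) D -> 0 < D -> F s < F t.
Proof.
move=> st mn hd D0; have := mid_between st; move: hd; set m := (s + t) / 2.
clearbody m => hd /andP[sm mt].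
rewrite lt_neqAle (mn s t (lexx _) (ltW st) (lexx _)) andbT; apply/negP => /eqP eq.
have cst c : s <= c -> c <= t -> F c = F s.
  by move=> sc ct; apply: le_anti; rewrite {1}eq (mn c t)//=; exact: mn.
have D2 : 0 < D / 2 by exact: divr_gt0.
have [d d0 hdd] := hd _ D2.
pose h := Num.min (d / 2) (t - m).
have h0 : 0 < h by rewrite lt_min subr_gt0 mt divr_gt0.
have hd2 : h < d by apply: (@le_lt_trans _ _ (d / 2)); [rewrite ge_min lexx|lra].
have ht : m + h <= t by rewrite -lerBrDl ge_min lexx orbT.
have mh : m + h - m = h by rewrite addrAC subrr add0r.
have := hdd (m + h) I; rewrite mh gtr0_norm// => /(_ hd2).
rewrite (cst m (ltW sm) (ltW mt)) (cst (m + h)) //; last by rewrite (le_trans (ltW sm))// lerDl ltW.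
rewrite subrr sub0r normrN gtr0_norm ?mulr_gt0// ler_pM2r//; lra.
Qed.

Section strict.
Context {R : realType}.
Local Notation V := 'cV[R]_1.
Implicit Types (F : V -> R) (x y : V).

Definition mono1 F := forall x y, x 0 0 <= y 0 0 -> F x <= F y.

(** The coefficient is the mean of (F k - F 0) k >= 0. Were it zero, so would be the mean after
    translation by t + 2 with t = w 0 0. But the translated integrand dominates t (F w - F 0) (1 -
    k^2 / 4): for k >= -2 the argument exceeds w, and for k < -2 the bound is negative. The mean of
    that bound is 3/4 of a positive constant. *)
Lemma chaos1_gt0_pos L F (w : V) : lipf L F -> mono1 F -> 0 < w 0 0 -> F 0 != F w ->
  0 < chaos1 F 0.
Proof.
move=> FL Fm w0 F0w; have tF := tame_lip FL.
pose f (k : V) := (F k - F 0) * k 0 0.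
have tF0 : tame1 (fun k => F k - F 0) by exact: tameB tF (tame_cst _).
have tf : tame1 f by exact: tame_fcoord 0 tF0.
have f0 k : 0 <= f k.
  rewrite /f; have [k0|k0] := leP 0 (k 0 0).
    by apply: mulr_ge0 => //; rewrite subr_ge0; apply: Fm; rewrite mxE.
  apply: mulr_le0; last exact: ltW.
  by rewrite subr_le0; apply: Fm; rewrite mxE ltW.
have cE : chaos1 F 0 = E1 f.
  transitivity (E1 (fun k : V => F k * k 0 0 - F 0 * k 0 0)).
    rewrite E1B; [|exact: tame_fcoord|exact: tameZ (tame_coord 0)].
    by rewrite E1Z ?E1_coord ?mulr0 ?subr0//; exact: tame_coord.
  by apply: eq_E1 => k; rewrite /f mulrBl.
have c0 : 0 < F w - F 0.
  by rewrite subr_gt0 lt_neqAle F0w/=; apply: Fm; rewrite mxE ltW.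
rewrite cE lt_neqAle (E1_ge0 f0) andbT eq_sym; apply/negP => /eqP fz.
pose t := w 0 0; pose z : V := const_mx (t + 2).
have := E1_shift_null z tf f0 fz.
have tk : tame1 (fun k : V => k 0 0 * k 0 0) by exact: tameM (tame_coord 0) (tame_coord 0).
have tl : tame1 (fun k : V => t * (F w - F 0) * (1 - 4^-1 * (k 0 0 * k 0 0))).
  by apply: tameZ; exact: tameB (tame_cst _) (tameZ _ tk).
have tfz : tame1 (fun k => f (k + z)).
  have := tame1_affine z 1 tf; rewrite /tame1.
  by under eq_fun do under eq_fun do rewrite scale1r addrC.
have le : E1 (fun k : V => t * (F w - F 0) * (1 - 4^-1 * (k 0 0 * k 0 0))) <= E1 (fun k => f (k + z)).
  apply: E1_le => // k; have [k2|k2] := leP (-2) (k 0 0).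
    have h1 : F w - F 0 <= F (k + z) - F 0.
      rewrite lerB//; apply: Fm; rewrite !mxE -/t; move: (k 0 0) k2 => r k2; lra.
    have h2 : t <= (k + z) 0 0 by rewrite !mxE; move: (k 0 0) k2 => r k2; lra.
    rewrite /f; move: h1 h2 c0 w0; rewrite -/t.
    move: (F (k + z) - F 0) (F w - F 0) ((k + z) 0 0) => A B C h1 h2 B0 t0.
    have : t * B <= C * A by apply: ler_pM => //; exact: ltW.
    have : 0 <= t * B * (4^-1 * (k 0 0 * k 0 0)).
      by apply: mulr_ge0; apply: mulr_ge0 => //; rewrite -?expr2 ?sqr_ge0// ltW.
    move: (t * B) (k 0 0) => X r; lra.
  apply: le_trans (f0 _); apply: mulr_ge0_le0; first by apply: mulr_ge0; exact: ltW.
  by move: (k 0 0) k2 => r k2; nra.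
rewrite E1Z in le; last exact: tameB (tame_cst _) (tameZ _ tk).
rewrite (E1B (tame_cst _) (tameZ _ tk)) E1_cst (E1Z _ tk) E1_coord2 eqxx mulr1 in le.
have X0 : 0 < t * (F w - F 0) by exact: mulr_gt0.
move: X0 le; move: (t * _) (E1 (fun k => f (k + z))) => X Y X0 le Y0; lra.
Qed.

Lemma chaos1_gt0 L F x y : lipf L F -> mono1 F -> F x != F y -> 0 < chaos1 F 0.
Proof.
move=> FL Fm Fxy.
have [w F0w] : exists w : V, F 0 != F w.
  by have [e|] := eqVneq (F 0) (F x); [exists y; rewrite e|exists x].
have [w0|w0|w0] := ltgtP (w 0 0) 0; last first.
- have e : w = 0 by apply/colP => i; rewrite ord1 w0 mxE.
  by rewrite e eqxx in F0w.
- exact: chaos1_gt0_pos FL Fm w0 F0w.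
pose G (k : V) := - F (- k).
have GL : lipf L G.
  move=> a b; rewrite /G -opprD normrN; have := FL (- a) (- b).
  by rewrite -opprD N1N.
have Gm : mono1 G by move=> a b ab; rewrite lerN2; apply: Fm; rewrite !mxE lerN2.
have := @chaos1_gt0_pos L G (- w) GL Gm.
rewrite mxE oppr_gt0 => /(_ w0); rewrite /G !opprK oppr0 eqr_opp => /(_ F0w).
rewrite /chaos1 -(E1_opp (tame_fcoord 0 (tame_lip GL))) => h; apply: lt_le_trans h _.
rewrite le_eqVlt; apply/orP; left; apply/eqP; apply: eq_E1 => k.
by rewrite /G opprK mxE mulrNN.
Qed.

(** Up to a positive factor this is [chaos1] of k -> F (a z + cosin a k), which is still monotone
    and, since [cosin a] > 0, still takes the two values F x and F y. *)
Lemma dOU_gt0 L F x y (a : R) z : lipf L F -> 0 <= L -> mono1 F -> F x != F y ->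
  0 < a < 1 -> 0 < dOU a F 0 z.
Proof.
move=> FL L0 Fm Fxy /andP[a0 a1].
have b0 : 0 < cosin a by apply: cosin_gt0; rewrite a1 ltW.
rewrite /dOU; apply: mulr_gt0; first exact: divr_gt0.
pose b := cosin a.
apply: (@chaos1_gt0 (b * L) (fun k => F (a *: z + b *: k))
  (b^-1 *: (x - a *: z)) (b^-1 *: (y - a *: z))).
- move=> k l; apply: le_trans (FL _ _) _.
  rewrite [b * L]mulrC -mulrA; apply: ler_wpM2l => //.
  have -> : a *: z + b *: k - (a *: z + b *: l) = b *: (k - l).
    by rewrite opprD addrACA subrr add0r scalerBr.
  by rewrite N1Z gtr0_norm.
- by move=> k l kl; apply: Fm; rewrite !mxE lerD2l ler_pM2l.
- by rewrite /= 2!(scalerA b b^-1) (divff (lt0r_neq0 b0)) !scale1r !subrKC.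
Qed.

Lemma sc_mono1 K a u : smooth_convex K a u -> mono1 (fun x => u x 0 0).
Proof.
move=> H x y xy; have := sc_mono x y H.
rewrite dotvE big_ord1 !mxE; move: xy; rewrite le_eqVlt => /predU1P[e _|xy].
  by rewrite (_ : x = y)//; apply/colP => i; rewrite ord1.
by rewrite pmulr_lge0 ?subr_gt0// subr_ge0.
Qed.

(** In dimension one both [dOU] are positive everywhere, hence so is [dcorr] on (0, 1). Monotonicity
    allows [x, y] to be replaced by a subinterval [c, d] avoiding -1, 0 and 1. *)
Lemma corrs_strict K K' a a' u u' (x0 y0 x0' y0' : V) (x y : R) :
  smooth_convex K a u -> smooth_convex K' a' u' ->
  u x0 0 0 != u y0 0 0 -> u' x0' 0 0 != u' y0' 0 0 ->
  -1 <= x -> x < y -> y <= 1 -> corrs u u' x < corrs u u' y.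
Proof.
have inner u1 a1 K1 u2 a2 K2 (x1 y1 x2 y2 : V) (s t : R) :
    smooth_convex K1 a1 u1 -> smooth_convex K2 a2 u2 ->
    u1 x1 0 0 != u1 y1 0 0 -> u2 x2 0 0 != u2 y2 0 0 ->
    0 < s -> s < t -> t < 1 -> corrs u1 u2 s < corrs u1 u2 t.
  move=> H1 H2 n1 n2 s0 st t1.
  have mn (c d : R) : s <= c -> c <= d -> d <= t -> corrs u1 u2 c <= corrs u1 u2 d.
    move=> sc cd dt; apply: (corrs_mono H1 H2 _ cd); last by rewrite (le_trans dt)// ltW.
    by rewrite (le_trans (lerN10 _))// (le_trans (ltW s0)).
  pose m := (s + t) / 2.
  have /andP[sm mt] := mid_between st.
  have L1 := sc_K0 H1; have L2 := sc_K0 H2.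
  have le := corr_left_est (sc_lipv H1 0) (sc_lipv H2 0) L1 L2 s0 t1.
  have := left_est_dq le; move=> /(_ m); rewrite sm mt => /(_ isT) hd.
  have a01 : 0 < Num.sqrt m < 1.
    have m0 : 0 < m by exact: lt_trans sm.
    by rewrite sqrtr_gt0 m0/=; case/andP: (sqrt_lt1 (lt_trans mt t1)).
  have a01' : 0 <= Num.sqrt m < 1 by case/andP: a01 => /ltW-> ->.
  have D0 : 0 < dcorr (fun x => u1 x 0 0) (fun x => u2 x 0 0) m.
    rewrite /dcorr big_ord1; apply: mulr_gt0; first by rewrite invr_gt0 (lt_trans s0).
    apply: E1_gt0.
      exact: tameM (tame_dOU 0 (sc_lipv H1 0) L1 a01') (tame_dOU 0 (sc_lipv H2 0) L2 a01').
    move=> z; apply: mulr_gt0.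
      exact: dOU_gt0 (sc_lipv H1 0) L1 (sc_mono1 H1) n1 a01.
    exact: dOU_gt0 (sc_lipv H2 0) L2 (sc_mono1 H2) n2 a01.
  apply: (dq_strict st mn _ D0); rewrite /corrs.
  by under eq_fun do rewrite big_ord1.
move=> H H' n n' x1 xy y1.
have mn := corrs_mono H H'.
have [yp|yn] := ltP 0 y.
  pose s := Num.max x 0; have s0 : 0 <= s by rewrite le_max lexx orbT.
  have sx : x <= s by rewrite le_max lexx.
  have sy : s < y by rewrite gt_max xy.
  pose c := s + (y - s) / 3; pose d := s + (y - s) * 2 / 3.
  have c0 : s < c by rewrite /c; lra.
  have cd : c < d by rewrite /c /d; lra.
  have dy : d < y by rewrite /d; lra.
  have h1 : corrs u u' x <= corrs u u' c by apply: mn => //; lra.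
  have h2 : corrs u u' d <= corrs u u' y by apply: mn => //; lra.
  apply: le_lt_trans h1 _; apply: lt_le_trans h2.
  by apply: (inner _ _ _ _ _ _ _ _ _ _ _ _ H H' n n') => //; lra.
pose c := x + (y - x) / 3; pose d := x + (y - x) * 2 / 3.
have c0 : x < c by rewrite /c; lra.
have cd : c < d by rewrite /c /d; lra.
have dy : d < y by rewrite /d; lra.
have h1 : corrs u u' x <= corrs u u' c by apply: mn => //; lra.
have h2 : corrs u u' d <= corrs u u' y by apply: mn => //; lra.
apply: le_lt_trans h1 _; apply: lt_le_trans h2.
rewrite -(opprK c) -(opprK d) !(corrs_opp _ H H') ltrN2.
apply: (inner _ _ _ _ _ _ x0 y0 (- x0') (- y0') _ _ H (sc_opp H') n) => //; try lra.
by rewrite !opprK !mxE eqr_opp.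
Qed.
End strict.

(** * Infimal convolution with a quadratic form *)

Section subgradient.
Context {R : realType}.
Implicit Types (g : R -> R) (c t : R).

Definition convR g := forall x y t, 0 <= t <= 1 ->
  g (t * x + (1 - t) * y) <= t * g x + (1 - t) * g y.

(** The slope is the left derivative at 0: the supremum of the left difference quotients, each of
    which is at most every right one. *)
Lemma convR_subgradient g : convR g -> exists d, forall t, g 0 + d * t <= g t.
Proof.
move=> gc; pose A := [set r | exists2 s, 0 < s & r = (g 0 - g (- s)) / s].
have ub t r : 0 < t -> A r -> r <= (g t - g 0) / t.
  move=> t0 [s s0 ->].
  have st0 : 0 < s + t by exact: addr_gt0.
  have t01 : 0 <= t / (s + t) <= 1.
    apply/andP; split; first by apply: divr_ge0; exact: ltW.
    by rewrite ler_pdivrMr// mul1r lerDr ltW.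
  have := gc (- s) t _ t01.
  have -> : t / (s + t) * - s + (1 - t / (s + t)) * t = 0 by field; rewrite gt_eqF.
  have -> : t / (s + t) * g (- s) + (1 - t / (s + t)) * g t =
    (t * g (- s) + s * g t) / (s + t) by field; rewrite gt_eqF.
  rewrite ler_pdivlMr// => h.
  by rewrite ler_pdivrMr// mulrAC ler_pdivlMr//; lra.
have A0 : A !=set0 by exists ((g 0 - g (-1)) / 1); exists 1.
have Aub : has_ubound A by exists ((g 1 - g 0) / 1) => r /ub; apply.
exists (sup A) => t; have [t0|t0|->] := ltgtP t 0; last by rewrite mulr0 addr0.
- have h : (g 0 - g t) / - t <= sup A.
    by apply: ub_le_sup => //; exists (- t); rewrite ?opprK// oppr_gt0.
  by rewrite ler_pdivrMr ?oppr_gt0// in h; lra.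
- have : sup A <= (g t - g 0) / t by apply: ge_sup => // r; exact: ub.
  rewrite ler_pdivlMr//; lra.
Qed.

(** Subgradients d of g and d' of c t^2 - g satisfy (d + d') t <= c t^2 for all t of either sign, so
    d' = - d. *)
Lemma convR_smooth g c : convR g -> convR (fun t => c * t ^+ 2 - g t) ->
  exists d, forall t, g 0 + d * t <= g t <= g 0 + d * t + c * t ^+ 2.
Proof.
move=> /convR_subgradient[d hd] /convR_subgradient[d' hd'].
exists d => t; rewrite hd/=.
suff e : d' = - d by have := hd' t; rewrite e expr0n mulr0; lra.
apply/eqP; rewrite -subr_eq0 opprK addrC -normr_le0; apply/ler_addgt0Pr => e e0.
rewrite add0r.
have key s : (d + d') * s <= c * s ^+ 2.
  by have := hd s; have := hd' s; rewrite expr0n mulr0; lra.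
pose c' := `|c| + 1; have c'0 : 0 < c' by rewrite ltr_pwDr.
pose s := e / c'; have s0 : 0 < s by exact: divr_gt0.
have cs : c * s <= e.
  apply: le_trans (_ : c' * s <= e); last by rewrite /s mulrC divfK// gt_eqF.
  by rewrite ler_pM2r// (le_trans (ler_norm c))// lerDl.
rewrite ler_norml; apply/andP; split.
  have := key (- s); rewrite mulrN sqrrN => h.
  have : - ((d + d') * s) <= (c * s) * s by rewrite -mulrA -expr2.
  by rewrite -mulNr ler_pM2r//; lra.
have := key s; rewrite expr2 mulrA ler_pM2r//; lra.
Qed.

Context (W : lmodType R) (q : W -> R) (e : W -> R) (P : W -> R -> Prop).

(* [e] is the infimal convolution of the quadratic form [q] with the function of
   epigraph [P]. *)
Record infconv : Prop := Infconv {
  q_ge0 : forall x, 0 <= q x;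
  q_hom : forall t x, q (t *: x) = t ^+ 2 * q x;
  q_quad : forall x y t, q (t *: x + (1 - t) *: y) =
    t * q x + (1 - t) * q y - t * (1 - t) * q (x - y);
  P_conv : forall x y r s t, 0 <= t <= 1 -> P x r -> P y s ->
    P (t *: x + (1 - t) *: y) (t * r + (1 - t) * s);
  e_le : forall v y r, P y r -> e v <= q (v - y) + r;
  e_approx : forall v eps, 0 < eps -> exists y r, P y r /\ q (v - y) + r <= e v + eps }.

Hypothesis H : infconv.

Lemma infconv_convex x y t : 0 <= t <= 1 ->
  e (t *: x + (1 - t) *: y) <= t * e x + (1 - t) * e y.
Proof.
move=> t01; have /andP[t0 t1] := t01; apply/ler_addgt0Pr => eps eps0.
have [a [r [Pa ha]]] := e_approx H x eps0.
have [b [s [Pb hb]]] := e_approx H y eps0.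
apply: le_trans (e_le H _ (P_conv H t01 Pa Pb)) _.
have -> : t *: x + (1 - t) *: y - (t *: a + (1 - t) *: b) =
    t *: (x - a) + (1 - t) *: (y - b).
  by rewrite opprD addrACA -!scalerBr.
rewrite (q_quad H).
have h1 := ler_wpM2l t0 ha.
have t1' : 0 <= 1 - t by rewrite subr_ge0.
have h2 := ler_wpM2l t1' hb.
have h3 : 0 <= t * (1 - t) * q (x - a - (y - b)) by rewrite !mulr_ge0 ?(q_ge0 H).
move: (q _) (q _) (q _) h1 h2 h3 => A B C h1 h2 h3; lra.
Qed.

(** This is convexity of q - e: an almost optimal point for the combination is a competitor at both
    x and y, and the quadratic form supplies the defect. *)
Lemma infconv_smooth x y t : 0 <= t <= 1 ->
  t * e x + (1 - t) * e y - t * (1 - t) * q (x - y) <= e (t *: x + (1 - t) *: y).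
Proof.
move=> /andP[t0 t1]; apply/ler_addgt0Pr => eps eps0.
have [a [r [Pa ha]]] := e_approx H (t *: x + (1 - t) *: y) eps0.
apply: le_trans ha.
have -> : t *: x + (1 - t) *: y - a = t *: (x - a) + (1 - t) *: (y - a).
  by rewrite !scalerBr addrACA -opprD -scalerDl subrKC scale1r.
rewrite (q_quad H).
have -> : x - a - (y - a) = x - y by rewrite opprB addrA addrNK.
have t1' : 0 <= 1 - t by rewrite subr_ge0.
have h1 := ler_wpM2l t0 (e_le H x Pa).
have h2 := ler_wpM2l t1' (e_le H y Pa).
move: (q _) (q _) (q _) h1 h2 => A B C h1 h2; lra.
Qed.

Lemma infconv_line x w : exists d, forall t,
  e x + d * t <= e (x + t *: w) <= e x + d * t + q w * t ^+ 2.
Proof.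
pose g t := e (x + t *: w).
have aff s t u : x + (u * s + (1 - u) * t) *: w = u *: (x + s *: w) + (1 - u) *: (x + t *: w).
  rewrite !scalerDr addrACA -scalerDl subrKC scale1r scalerDl !scalerA//.
have gc : convR g by move=> s t u u01; rewrite /g aff; exact: infconv_convex.
have gs : convR (fun t => q w * t ^+ 2 - g t).
  move=> s t u u01; have := infconv_smooth (x + s *: w) (x + t *: w) u01.
  rewrite -aff -[e (x + (_ + _) *: w)]/(g (u * s + (1 - u) * t)) -/(g s) -/(g t).
  have -> : x + s *: w - (x + t *: w) = (s - t) *: w by rewrite opprD addrACA subrr add0r scalerBl.
  rewrite (q_hom H); move: (g _) (g s) (g t) (q w) => A B C D h.
  have E : D * (u * s + (1 - u) * t) ^+ 2 = u * (D * s ^+ 2) + (1 - u) * (D * t ^+ 2)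
     - u * (1 - u) * ((s - t) ^+ 2 * D) by ring.
  rewrite E; move: (D * s ^+ 2) (D * t ^+ 2) (u * (1 - u) * _) h => X Y Z h; lra.
by have [d] := convR_smooth gc gs; rewrite /g scale0r addr0; exists d.
Qed.

Lemma line_slope_le (g : R -> R) (c d d' a : R) :
  (forall t, a + d * t <= g t) -> (forall t, g t <= a + d' * t + c * t ^+ 2) -> d <= d'.
Proof.
move=> h h'; apply/ler_addgt0Pr => eps e0.
pose c' := `|c| + 1; have c'0 : 0 < c' by rewrite ltr_pwDr.
pose s := eps / c'; have s0 : 0 < s by exact: divr_gt0.
have cs : c * s <= eps.
  apply: le_trans (_ : c' * s <= eps); last by rewrite /s mulrC divfK// gt_eqF.
  by rewrite ler_pM2r// (le_trans (ler_norm c))// lerDl.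
have k : (d - d') * s <= (c * s) * s by have := h s; have := h' s; rewrite expr2; lra.
by rewrite ler_pM2r// in k; lra.
Qed.

(** The two-sided estimate determines D w uniquely, hence homogeneity; convexity at the midpoint of
    x + 2 t w and x + 2 t w' gives subadditivity, which together with oddness is additivity. *)
Lemma infconv_linear x (D : W -> R) :
  (forall w t, e x + D w * t <= e (x + t *: w) <= e x + D w * t + q w * t ^+ 2) ->
  linear (D : W -> R^o).
Proof.
move=> hD.
have lo w t : e x + D w * t <= e (x + t *: w) by case/andP: (hD w t).
have hi w t : e (x + t *: w) <= e x + D w * t + q w * t ^+ 2 by case/andP: (hD w t).
have uniq w (d c : R) : (forall t, e x + d * t <= e (x + t *: w)) ->
    (forall t, e (x + t *: w) <= e x + d * t + c * t ^+ 2) -> D w = d.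
  move=> l u; apply/eqP; rewrite eq_le (line_slope_le (lo w) u).
  by rewrite (line_slope_le l (hi w)).
have homD k w : D (k *: w) = k * D w.
  apply: (uniq _ _ (k ^+ 2 * q w)) => t; rewrite scalerA.
    have -> : k * D w * t = D w * (t * k) by ring.
    exact: lo.
  have -> : k * D w * t = D w * (t * k) by ring.
  have -> : k ^+ 2 * q w * t ^+ 2 = q w * (t * k) ^+ 2 by ring.
  exact: hi.
have subD w w' : D (w + w') <= D w + D w'.
  apply: (line_slope_le (lo (w + w')) (c := 2 * q w + 2 * q w')) => t.
  have -> : x + t *: (w + w') =
      2^-1 *: (x + (2 * t) *: w) + (1 - 2^-1) *: (x + (2 * t) *: w').
    have e1 : 1 - 2^-1 = 2^-1 :> R by field.
    have e2 : 2^-1 * (2 * t) = t by field.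
    have e3 : 2^-1 + 2^-1 = 1 :> R by field.
    by rewrite e1 2!(scalerDr 2^-1) !scalerA e2 addrACA -scalerDl e3 scale1r scalerDr.
  apply: le_trans (infconv_convex _ _ _) _; first by apply/andP; split; lra.
  have := hi w (2 * t); have := hi w' (2 * t).
  rewrite !exprMn.
  move: (e (_ + _)) (e (_ + _)) (t ^+ 2) => A B T; lra.
move=> k u v; rewrite /GRing.scale/= -homD; apply/eqP; rewrite eq_le subD/=.
have := subD (- (k *: u)) (- v).
have NE w : D (- w) = - D w by rewrite -scaleN1r homD mulN1r.
rewrite -opprD !NE; lra.
Qed.
End subgradient.

(** * Moreau envelopes of convex functions *)

Section slopes.
Context {R : realType}.

Lemma slope_lim (g : R -> R) (a d C : R) :
  (forall t, a + d * t <= g t <= a + d * t + C * t ^+ 2) ->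
  lim ((fun t => t^-1 *: (g t - a : R^o)) @ 0^') = d :> R^o.
Proof.
move=> h; apply: cvg_lim => //; apply/cvgrPdist_le => e e0.
have C1 : 0 < `|C| + 1 by rewrite ltr_pwDr.
near=> t.
have t0 : t != 0 by near: t; exact: nbhs_dnbhs_neq.
have te : `|t| <= e / (`|C| + 1).
  near: t; apply: (@nbhs_dnbhs R^o); exists (e / (`|C| + 1)) => /=; first exact: divr_gt0.
  by move=> t /=; rewrite sub0r normrN => /ltW.
have := h t; move: (g t) => A /andP[h1 h2].
have -> : d - t^-1 *: (A - a) = t^-1 * (d * t - (A - a)).
  by rewrite /GRing.scale/=; field.
rewrite normrM normfV ler_pdivrMl ?normr_gt0//.
have hC : `|d * t - (A - a)| <= (`|C| + 1) * t ^+ 2.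
  have := ler_norm C; have := sqr_ge0 t; move: (t ^+ 2) h2 => T h2 T0 CC.
  have : C * T <= `|C| * T by exact: ler_wpM2r.
  move=> h3; have h4 : `|C| * T <= (`|C| + 1) * T by rewrite mulrDl mul1r lerDl.
  by rewrite ler_norml; apply/andP; split; lra.
apply: le_trans hC _; rewrite -real_normK ?num_real// expr2 mulrCA.
by rewrite ler_pM2l ?normr_gt0// mulrC -ler_pdivlMr.
Unshelve. all: by end_near. Qed.

Lemma derive_line (W : normedModType R) (f : W -> R) (x w : W) (d C : R) :
  (forall t, f x + d * t <= f (x + t *: w) <= f x + d * t + C * t ^+ 2) ->
  'D_w f x = d.
Proof. by move=> h; apply: (slope_lim (C := C)) => t /=; rewrite [t *: w + x]addrC. Qed.

(** [gradient] records partial derivatives only; linearity of the directional slopes recovers every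
    direction. *)
Lemma gradient_slope p (q : 'cV[R]_p -> R) (e : 'cV[R]_p -> R) P v w t :
  infconv q e P ->
  e v + dotv (gradient e v) w * t <= e (v + t *: w) <=
  e v + dotv (gradient e v) w * t + q w * t ^+ 2.
Proof.
move=> H; have /choice[D hD] := infconv_line H v.
have lD := infconv_linear H hD.
suff -> : dotv (gradient e v) w = D w by exact: hD.
have gE i : gradient e v i 0 = D (delta_mx i 0).
  by rewrite mxE; apply: derive_line (hD (delta_mx i 0)).
have D0 : D 0 = 0.
  by have := lD (-1) 0 0; rewrite scaler0 add0r /GRing.scale/= mulN1r addNr.
have -> : w = \sum_i w i 0 *: delta_mx i 0.
  by rewrite {1}(matrix_sum_delta w); apply: eq_bigr => i _; rewrite big_ord1.
rewrite (big_morph D (id1 := 0) (op1 := +%R)) => [|a b|//]; last first.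
  by have := lD 1 a b; rewrite scale1r => ->; rewrite /GRing.scale/= mul1r.
transitivity (\sum_i w i 0 * gradient e v i 0).
  rewrite dotvE; apply: eq_bigr => i _; rewrite mulrC summxE (bigD1 i)//= !mxE !eqxx.
  rewrite big1 => [|j ji]; first by rewrite mulr1 addr0.
  by rewrite !mxE eq_sym (negbTE ji) mulr0.
apply: eq_bigr => i _; have := lD (w i 0) (delta_mx i 0) 0.
by rewrite addr0 D0 addr0 gE => ->.
Qed.
End slopes.

Section moreau.
Context {R : realType} (ell : R -> R) (tau : R).
Hypotheses (hell : convex_function [set: R^o] (ell : R^o -> R^o)) (tau0 : 0 < tau).

Lemma convex_functionR : convR ell.
Proof.
move=> x y t /andP[t0 t1].
by have := hell (Itv01 t0 t1) (in_setT (x : R^o)) (in_setT (y : R^o)).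
Qed.

Lemma env_infconv : @infconv R R^o (fun x => (2 * tau)^-1 * x ^+ 2)
  (fun x => env ell x tau) (fun y r => ell y <= r).
Proof.
have k0 : 0 < (2 * tau)^-1 by rewrite invr_gt0 mulr_gt0.
rewrite /env; move: ((2 * tau)^-1) k0 => k k0.
have [d hd] := convR_subgradient convex_functionR.
have lb x : has_lbound (range (fun y : R => ell y + k * (x - y) ^+ 2)).
  (* A supporting line of [ell] and a completed square; the bound makes [inf] a true infimum rather
     than a default value. *)
  exists (ell 0 + d * x - k^-1 * d ^+ 2) => _ [y _ <-].
  have := hd y; move: (ell 0) (ell y) => A B h.
  have h1 : 0 <= k * ((x - y) - k^-1 / 2 * d) ^+ 2 by apply: mulr_ge0; [exact: ltW|exact: sqr_ge0].
  have e1 : k * ((x - y) - k^-1 / 2 * d) ^+ 2 =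
     k * (x - y) ^+ 2 - d * (x - y) + k^-1 / 4 * d ^+ 2 by field; rewrite gt_eqF.
  have h2 : 0 <= k^-1 * d ^+ 2 by apply: mulr_ge0; [rewrite invr_ge0 ltW|exact: sqr_ge0].
  by rewrite e1 in h1; lra.
split.
- by move=> x; apply: mulr_ge0; [exact: ltW|exact: sqr_ge0].
- by move=> t x; rewrite /GRing.scale/=; ring.
- by move=> x y t; rewrite /GRing.scale/=; ring.
- move=> x y r s t t01 xr ys; apply: le_trans (convex_functionR _ _ t01) _.
  case/andP: t01 => t0 t1; apply: lerD; apply: ler_wpM2l => //.
  by rewrite subr_ge0.
- move=> v y r yr; rewrite addrC; apply: le_trans (lerD yr (lexx _)).
  by apply: ge_inf => //; exists y; rewrite //.
- move=> v eps e0.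
  have [//|_ [y _ <-] hy] := @inf_adherent _ (range (fun y : R => ell y + k * (v - y) ^+ 2)) _ e0.
    by split => //; exists (ell 0 + k * (v - 0) ^+ 2); exists 0.
  by exists y, (ell y); split => //; rewrite addrC ltW.
Qed.

Lemma env'_slope x w :
  env ell x tau + env' ell x tau * w <= env ell (x + w) tau <=
  env ell x tau + env' ell x tau * w + (2 * tau)^-1 * w ^+ 2.
Proof.
have [d hd] := infconv_line env_infconv x (1 : R^o).
have -> : env' ell x tau = d.
  apply: (@slope_lim _ (fun h => env ell (h + x) tau) _ _ ((2 * tau)^-1)) => t.
  by rewrite /= [t + x]addrC; have := hd t; rewrite /GRing.scale/= mulr1 expr1n mulr1.
have := hd w; have -> : w *: (1 : R^o) = w by rewrite /GRing.scale/= mulr1.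
by rewrite expr1n mulr1.
Qed.

Lemma env_sc (z al : R) : 0 < al ->
  smooth_convex (al / tau / 2) (fun h : 'cV[R]_1 => al^-1 * env ell (z + al * h 0 0) tau)
    (fun h => const_mx (env' ell (z + al * h 0 0) tau)).
Proof.
move=> al0; split; first by rewrite !divr_gt0.
  move=> x w; rewrite dotvE big_ord1 !mxE mulrDr addrA.
  have := env'_slope (z + al * x 0 0) (al * w 0 0).
  move: (w 0 0) (env ell (z + al * x 0 0 + _) _) (env ell (z + al * x 0 0) _) (env' ell _ _).
  move=> D B A C /andP[h _].
  by rewrite -(ler_pM2l al0) mulrDr !mulVKf ?gt_eqF// mulrCA.
move=> x w; rewrite !dotvE !big_ord1 !mxE mulrDr addrA.
have := env'_slope (z + al * x 0 0) (al * w 0 0).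
move: (w 0 0) (env ell (z + al * x 0 0 + _) _) (env ell (z + al * x 0 0) _) (env' ell _ _).
move=> D B A C /andP[_ h].
rewrite -(ler_pM2l al0) !mulrDr !mulVKf ?gt_eqF// mulrCA; apply: le_trans h _.
rewrite le_eqVlt; apply/orP; left; apply/eqP; field.
by rewrite gt_eqF.
Qed.

(* Otherwise env ell would be the quadratic |x|^2/(2 tau) up to an affine function. *)
Lemma prox_nonconstant : exists x y, x / tau - env' ell x tau != y / tau - env' ell y tau.
Proof.
apply: contrapT => /forallNP h.
pose k := - env' ell 0 tau.
have hk x : env' ell x tau = x / tau - k.
  have /forallNP/(_ 0)/negP := h x; rewrite negbK => /eqP; rewrite mul0r sub0r -/k => <-; ring.
have eE x : env ell x tau = env ell 0 tau - k * x + (2 * tau)^-1 * x ^+ 2.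
  have /andP[_ h1] := env'_slope 0 x; have /andP[h2 _] := env'_slope x (- x).
  have /andP[_ h3] := env'_slope x (- x); have /andP[h4 _] := env'_slope 0 x.
  rewrite addrN add0r !hk mul0r sub0r in h1 h2 h3 h4.
  have e : x / tau * x = 2 * ((2 * tau)^-1 * x ^+ 2) by field; rewrite gt_eqF.
  move: h1 h2 h3; rewrite mulrN mulrBl e sqrrN; move: ((2 * tau)^-1 * _) => Q h1 h2 h3.
  apply: le_anti; apply/andP; split; lra.
have key y0 x : env ell 0 tau - k * x <= ell y0 - x * (y0 / tau) + (2 * tau)^-1 * y0 ^+ 2.
  have := e_le env_infconv x (lexx (ell y0)); rewrite eE.
  have -> : (2 * tau)^-1 * (x - y0) ^+ 2 =
    (2 * tau)^-1 * x ^+ 2 - x * (y0 / tau) + (2 * tau)^-1 * y0 ^+ 2 by field; rewrite gt_eqF.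
  move: ((2 * tau)^-1 * x ^+ 2) => Q h1; lra.
(* A linear function of x that is bounded above has slope zero; as y0 is arbitrary, k would take
   several values. *)
have lin y0 : k = y0 / tau.
  pose M := ell y0 + (2 * tau)^-1 * y0 ^+ 2 - env ell 0 tau.
  have hM x : (y0 / tau - k) * x <= M by have := key y0 x; rewrite /M; lra.
  apply/eqP; rewrite eq_sym -subr_eq0; apply: contraT => n0.
  have := hM ((M + 1) / (y0 / tau - k)); rewrite mulrC divfK//; lra.
have := lin 0; rewrite mul0r => k0; have := lin 1; rewrite k0 mul1r => /eqP.
by rewrite eq_sym invr_eq0 gt_eqF.
Qed.
End moreau.

(** * Moreau envelopes of regularizers and the residual as a gradient map *)

Section moreau_vector.
Context {R : realType} {p : nat}.
Local Notation V := 'cV[R]_p.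
Implicit Types (S Sigma : 'M[R]_p) (phi : V -> \bar R).

Lemma posdefmx_unit S : posdefmx S -> S \in unitmx.
Proof.
move=> [Ss S0]; rewrite -row_free_unit -kermx_eq0; apply/eqP/row_matrixP => i.
rewrite row0; apply/eqP; apply: contraT => n0.
pose v : V := (row i (kermx S))^T.
have v0 : v != 0 by rewrite -(trmx0 R 1 p) (inj_eq trmx_inj).
have := S0 v v0.
have -> : S *m v = 0.
  rewrite -Ss -trmx_mul; have -> : row i (kermx S) *m S = 0 by rewrite -row_mul mulmx_ker row0.
  exact: trmx0.
by rewrite dotvE big1 ?ltxx// => j _; rewrite !mxE mulr0.
Qed.

(** Plays the part of an affine minorant. Lower semicontinuity keeps phi above f0 - 1 on a ball
    around a point x0 of its domain, and convexity along the segment from x0 to y propagates this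
    with slope 2 / r. *)
Lemma regularizer_minorant phi : regularizer phi ->
  exists A B : R, [/\ 0 <= A, 0 <= B & forall y, ((- A - B * N1 y)%:E <= phi y)%E].
Proof.
move=> [[phiN [x0 phix0]] lsc conv].
have /fineK fx0 : phi x0 \is a fin_num by rewrite fin_numE phix0 phiN.
set f0 := fine (phi x0) in fx0.
have [|U Ux0 hU] := lsc x0 (f0 - 1); first by rewrite -fx0 lte_fin; lra.
have [r r0 hr] : exists2 r, 0 < r & forall y, N1 (y - x0) < r -> U y.
  move: Ux0 => /nbhs_ballP[r /= r0 hr]; exists r => // y yr; apply: hr.
  rewrite /ball/=; split => // i j; rewrite ord1 /ball/=; apply: le_lt_trans yr.
  by rewrite distrC (_ : _ - _ = (y - x0) i 0) ?coord_le_N1// !mxE.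
pose a := `|f0| + 1 + 2 / r * N1 x0.
have r2 : 0 <= 2 / r by apply: divr_ge0 => //; exact: ltW.
have b0 : 0 <= 2 / r * N1 x0 by exact: mulr_ge0 (N1_ge0 _).
exists a, (2 / r); split => //; first by rewrite /a !addr_ge0.
move=> y; case E : (phi y) => [s| |]; rewrite ?leey//; last first.
  by have := phiN y; rewrite E.
rewrite lee_fin.
have yN : N1 (y - x0) <= N1 y + N1 x0 by apply: le_trans (N1D _ _) _; rewrite N1N.
have := ler_wpM2l r2 yN; rewrite mulrDr.
suff : f0 - 1 - 2 / r * N1 (y - x0) <= s.
  have /ler_normlP[h1 _] := lexx `|f0|.
  rewrite /a; move: (N1 (y - x0)) (N1 y) (N1 x0) => A B C; lra.
have [ynear|yfar] := ltP (N1 (y - x0)) r.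
  have := hU y (hr y ynear); rewrite E lte_fin => h.
  have := mulr_ge0 r2 (N1_ge0 (y - x0)); lra.
have N0 : 0 < N1 (y - x0) by exact: lt_le_trans yfar.
(* Places the intermediate point at distance r / 2 from x0, inside the ball. *)
pose t := r / 2 / N1 (y - x0).
have t0 : 0 < t by rewrite !divr_gt0.
have t1 : t <= 1 by rewrite ler_pdivrMr// mul1r; apply: le_trans yfar; lra.
have near : U (t *: y + (1 - t) *: x0).
  apply: hr.
  have -> : t *: y + (1 - t) *: x0 - x0 = t *: (y - x0).
    by apply/colP => i; rewrite !mxE; ring.
  rewrite N1Z gtr0_norm// /t divfK ?gt_eqF//; lra.
have := lt_le_trans (hU _ near) (conv y x0 t _).
rewrite (ltW t0) t1 E -fx0 => /(_ isT); rewrite -!EFinM -EFinD lte_fin => h.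
have e : 2 / r * N1 (y - x0) = t^-1 by rewrite /t; field; rewrite !gt_eqF.
rewrite e; have : t * (f0 - s) < 1 by lra.
rewrite mulrC -ltr_pdivlMr// mul1r; lra.
Qed.

Lemma mulmx_coercive S : S \in unitmx ->
  exists2 m, 0 < m & forall w : V, m * N1 w ^+ 2 <= dotv (S *m w) (S *m w).
Proof.
move=> Su; pose C := 1 + \sum_i \sum_j `|invmx S i j|.
have C0 : 0 < C by rewrite ltr_pwDl// sumr_ge0// => i _; exact: sumr_ge0.
have hC (v : V) : N1 (invmx S *m v) <= C * N1 v.
  have -> : C * N1 v = N1 v + \sum_i \sum_j `|invmx S i j| * N1 v.
    rewrite mulrDl mul1r mulr_suml; congr (_ + _); apply: eq_bigr => i _.
    by rewrite mulr_suml.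
  apply: ler_wpDl; first exact: N1_ge0.
  apply: ler_sum => i _; rewrite mxE; apply: le_trans (ler_norm_sum _ _ _) _.
  by apply: ler_sum => j _; rewrite normrM ler_wpM2l// coord_le_N1.
(* Cauchy-Schwarz gives the factor p; p + 1 stays positive when p = 0. *)
have h2 (v : V) : N1 v ^+ 2 <= (p%:R + 1) * dotv v v.
  have CS (n : nat) (F : 'I_n -> R) : (\sum_i F i) ^+ 2 <= n%:R * \sum_i F i ^+ 2.
    elim: n F => [|n IH] F; first by rewrite !big_ord0 expr0n mul0r.
    rewrite !big_ord_recr/=; have := IH (fun i => F (widen_ord (leqnSn n) i)).
    set s := \sum_i F _; set t := \sum_i F _ ^+ 2; move: (F ord_max) => x h.
    have [n0|n0] := posnP n.
      have -> : s = 0 by rewrite /s; move: F s t h; rewrite n0 => F *; rewrite big_ord0.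
      have -> : t = 0 by rewrite /t; move: F s t h; rewrite n0 => F *; rewrite big_ord0.
      by rewrite n0 !add0r mul1r.
    have nn : 0 < n%:R :> R by rewrite ltr0n.
    rewrite -natr1; move: (n%:R) nn h => N N0 h.
    have : 0 <= (N * x - s) ^+ 2 by exact: sqr_ge0.
    have e : N * (t + N * x ^+ 2 - 2 * s * x) = (N * x - s) ^+ 2 + (N * t - s ^+ 2) by ring.
    have : 0 <= N * (t + N * x ^+ 2 - 2 * s * x) by rewrite e addr_ge0 ?sqr_ge0// subr_ge0.
    rewrite pmulr_rge0// sqrrD mulrDl mul1r mulrDr; lra.
  apply: le_trans (CS _ _) _; rewrite dotvE.
  rewrite (_ : \sum_i `|v i 0| ^+ 2 = \sum_i v i 0 * v i 0); last first.
    by apply: eq_bigr => i _; rewrite real_normK ?num_real// expr2.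
  rewrite mulrDl lerDl mul1r; apply: sumr_ge0 => i _; rewrite -expr2; exact: sqr_ge0.
have p0 : 0 < p%:R + 1 :> R by rewrite ltr_pwDr.
exists (((p%:R + 1) * C ^+ 2)^-1); first by rewrite invr_gt0 mulr_gt0// exprn_gt0.
move=> w; rewrite ler_pdivrMl ?mulr_gt0 ?exprn_gt0//.
have := hC (S *m w); rewrite mulKmx// => h.
apply: le_trans (_ : (C * N1 (S *m w)) ^+ 2 <= _).
  by rewrite ler_pXn2r// nnegrE ?N1_ge0//; apply: mulr_ge0 (N1_ge0 _); exact: ltW.
rewrite exprMn [(p%:R + 1) * _]mulrC -[leRHS]mulrA.
by rewrite ler_pM2l ?exprn_gt0.
Qed.

Context (phi : V -> \bar R) (Sigma S : 'M[R]_p) (nu : R).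
Hypotheses (hphi : regularizer phi) (hS : posdefmx S) (SS : S *m S = Sigma) (nu0 : 0 < nu).

Let Lam := nu^-1 *: invmx Sigma.
Let q (w : V) := nu / 2 * dotv (S *m w) (S *m w).

(** The inverse of [Lam] is nu S S with S symmetric, so the form is a multiple of |S w|^2. *)
Lemma quad_invmx w : 2^-1 * dotv w (invmx Lam *m w) = q w.
Proof.
have Su := posdefmx_unit hS.
have Sigu : Sigma \in unitmx by rewrite -SS unitmx_mul Su.
have Lu : nu^-1 *: invmx Sigma \in unitmx.
  by rewrite unitmxZ ?unitmx_inv// unitfE invr_eq0 gt_eqF.
rewrite /Lam (invmxZ Lu) invrK invmxK -SS -scalemxAl dotvZr /q -mulmxA (dotv_mulmx S w) hS.1.
by move: (dotv _ _) => A; field.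
Qed.

Lemma menv_infconv : infconv q (fun u => fine (menv phi u Lam)) (fun y r => (phi y <= r%:E)%E).
Proof.
have [[phiN [x0 phix0]] lsc conv] := hphi.
have [A [B [A0 B0 hAB]]] := regularizer_minorant hphi.
have [m m0 hm] := mulmx_coercive (posdefmx_unit hS).
have menvE u : menv phi u Lam = ereal_inf (range (fun y => ((q (u - y))%:E + phi y)%E)).
  by rewrite /menv; congr ereal_inf; apply: eq_imagel => y _ /=; rewrite quad_invmx.
have q0 x : 0 <= q x by apply: mulr_ge0 (dotvv_ge0 _); rewrite divr_ge0 ?(ltW nu0).
(* The coercive quadratic form outweighs the minorant of linear growth, by completing the square;
   this keeps the envelope away from -oo. *)
have lb u : exists c : R, (c%:E <= menv phi u Lam)%E.
  pose k := nu / 2 * m; have k0 : 0 < k by rewrite !mulr_gt0// divr_gt0.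
  exists (- A - B * N1 u - k^-1 * B ^+ 2); rewrite menvE; apply: le_ereal_inf_tmp => _ [y _ <-].
  apply: le_trans (leeD (lexx _) (hAB y)); rewrite -EFinD lee_fin.
  have h1 : k * N1 (u - y) ^+ 2 <= q (u - y).
    by rewrite /k /q -mulrA ler_pM2l ?divr_gt0//; exact: hm.
  have h2 : N1 y <= N1 (u - y) + N1 u.
    have -> : y = - (u - y) + u by rewrite opprB addrNK.
    by apply: le_trans (N1D _ _) _; rewrite N1N -opprB opprK opprB addrNK.
  have h3 := ler_wpM2l B0 h2.
  move: (q (u - y)) (N1 (u - y)) (N1 y) (N1 u) h1 h3 => Q n ny nu' h1 h3.
  have h4 : 0 <= k * (n - k^-1 / 2 * B) ^+ 2 by apply: mulr_ge0; [exact: ltW|exact: sqr_ge0].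
  have e4 : k * (n - k^-1 / 2 * B) ^+ 2 = k * n ^+ 2 - B * n + 4^-1 * (k^-1 * B ^+ 2) by field; rewrite gt_eqF.
  have h5 : 0 <= k^-1 * B ^+ 2 by apply: mulr_ge0; [rewrite invr_ge0 ltW|exact: sqr_ge0].
  rewrite e4 in h4; rewrite mulrDr in h3.
  move: (k^-1 * B ^+ 2) (k * n ^+ 2) h4 h5 h1 => Y Z h4 h5 h1; lra.
have le u y r : (phi y <= r%:E)%E -> (menv phi u Lam <= (q (u - y) + r)%:E)%E.
  move=> yr; rewrite menvE EFinD; apply: le_trans (leeD (lexx _) yr).
  by apply: ereal_inf_lbound; exists y.
have fx0 : phi x0 = (fine (phi x0))%:E by rewrite fineK// fin_numE phix0 phiN.
have finE u : menv phi u Lam \is a fin_num.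
  have [c hc] := lb u; have := le u x0 (fine (phi x0)); rewrite -fx0 => /(_ (lexx _)) hle.
  by rewrite fin_numE; apply/andP; split; apply/eqP => e; [move: hc|move: hle]; rewrite e.
split => //.
- by move=> t x; rewrite /q -scalemxAr dotvZl dotvZr; ring.
- move=> x y t; rewrite /q mulmxBr mulmxDr -!scalemxAr.
  move: (S *m x) (S *m y) => {}x {}y.
  rewrite !dotvDl !dotvDr !dotvZl !dotvZr !dotvNl !dotvNr (dotvC y x).
  move: (dotv x x) (dotv x y) (dotv y y) => a b c; ring.
- move=> x y r s t t01 xr ys; apply: le_trans (conv x y t t01) _.
  case/andP: t01 => t0 t1.
  rewrite (EFinD (t * r)) !EFinM; apply: leeD; apply: lee_wpmul2l => //; rewrite lee_fin//.
  by rewrite subr_ge0.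
- by move=> v y r yr; rewrite -lee_fin fineK//; exact: le.
- move=> v eps e0.
  have := finE v; rewrite menvE => /(lb_ereal_inf_adherent e0) [_ [y _ <-]] hy.
  have fy : phi y \is a fin_num.
    rewrite fin_numE phiN/=; apply/eqP => e; move: hy; rewrite e addey//.
    by rewrite -menvE -(fineK (finE v)) -EFinD ltNge leey.
  exists y, (fine (phi y)); rewrite (fineK fy); split; first exact: lexx.
  by rewrite -lee_fin !EFinD (fineK fy) -menvE (fineK (finE v)) menvE ltW.
Qed.

(** By the chain rule the map is the gradient of beta^-1 times the envelope at theta + (beta / nu) T
    h, with T the inverse of S. The constant comes from q ((beta / nu) T w) = beta (beta / nu / 2)
    |w|^2. *)
Lemma residual_sqrt_sc theta (beta : R) : 0 < beta -> sqrtmx Sigma = S ->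
  exists a, smooth_convex (beta / nu / 2) a
    (fun h => (beta / nu) *: h + residual phi theta Sigma beta nu h).
Proof.
move=> beta0 sqS; pose E u := fine (menv phi u Lam).
pose T := invmx S; have Su := posdefmx_unit hS.
have Ts : T^T = T by rewrite /T trmx_inv hS.1.
have k0 : 0 < beta / nu by exact: divr_gt0.
have resE x : (beta / nu) *: x + residual phi theta Sigma beta nu x =
    nu^-1 *: (T *m grad_menv phi (theta + (beta / nu) *: (T *m x)) Lam).
  by rewrite /residual sqS addrC subrK.
exists (fun h => beta^-1 * E (theta + (beta / nu) *: (T *m h))).
have key x w : beta^-1 * E (theta + (beta / nu) *: (T *m x)) +
    dotv ((beta / nu) *: x + residual phi theta Sigma beta nu x) w <=
    beta^-1 * E (theta + (beta / nu) *: (T *m (x + w))) <=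
    beta^-1 * E (theta + (beta / nu) *: (T *m x)) +
    dotv ((beta / nu) *: x + residual phi theta Sigma beta nu x) w +
    beta / nu / 2 * dotv w w.
  have := gradient_slope (theta + (beta / nu) *: (T *m x)) ((beta / nu) *: (T *m w)) 1 menv_infconv.
  rewrite expr1n !mulr1 scale1r -addrA -scalerDr -mulmxDr.
  rewrite !resE.
  have -> : dotv (gradient E (theta + (beta / nu) *: (T *m x))) ((beta / nu) *: (T *m w)) =
    beta * dotv (nu^-1 *: (T *m grad_menv phi (theta + (beta / nu) *: (T *m x)) Lam)) w.
    rewrite dotvZr dotvZl dotv_mulmx Ts /grad_menv -/E; move: (dotv _ _) => A; field.
    by rewrite gt_eqF.
  have -> : q ((beta / nu) *: (T *m w)) = beta * (beta / nu / 2 * dotv w w).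
    rewrite /q -scalemxAr mulKVmx// dotvZl dotvZr; move: (dotv _ _) => A; field.
    by rewrite gt_eqF.
  rewrite -/(E (theta + (beta / nu) *: (T *m (x + w)))).
  rewrite -/(E (theta + (beta / nu) *: (T *m x))).
  move: (E _) (E _) (dotv _ _) (beta / nu / 2 * _) => A B C D /andP[h1 h2].
  have bK (z : R) : beta * (beta^-1 * z) = z by rewrite mulVKf// gt_eqF.
  by apply/andP; split; rewrite -(ler_pM2l beta0) !mulrDr !bK.
split; first by rewrite divr_gt0.
  by move=> x w; case/andP: (key x w).
by move=> x w; case/andP: (key x w).
Qed.
End moreau_vector.

(** A case split replaces the construction of the square root. Without a root [sqrtmx] takes its
    default 0, whose [invmx] is again 0 because p >= 1; the map then vanishes identically and is the
    gradient of a constant. *)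
Lemma residual_sc (R : realType) p (phi : 'cV[R]_p -> \bar R) theta Sigma (beta nu : R) :
  (1 <= p)%N -> regularizer phi -> 0 < beta -> 0 < nu ->
  exists a, smooth_convex (beta / nu / 2) a
    (fun h => (beta / nu) *: h + residual phi theta Sigma beta nu h).
Proof.
move=> p1 hphi b0 n0.
pose Q := [set S : 'M[R]_p | posdefmx S /\ S *m S = Sigma].
have [[S0 S0Q]|noS] := pselect (exists S, Q S).
  have [hS SS] : Q (sqrtmx Sigma) by exact: (xgetPex 0 (ex_intro _ S0 S0Q)).
  exact: residual_sqrt_sc hphi hS SS n0 theta beta b0 erefl.
have sq0 : sqrtmx Sigma = 0.
  by apply: xgetPN => S QS; apply: noS; exists S.
exists (fun=> 0); have k0 : 0 < beta / nu / 2 by rewrite !divr_gt0.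
have r0 h : (beta / nu) *: h + residual phi theta Sigma beta nu h = 0.
  have z : (0 : 'M[R]_p) \notin unitmx.
    by rewrite -row_free_unit /row_free mxrank0 eq_sym -lt0n.
  rewrite /residual sq0 /invmx (negbTE z) mul0mx scaler0 sub0r addrN//.
have kw (w : 'cV[R]_p) : 0 <= beta / nu / 2 * dotv w w.
  by apply: mulr_ge0 (dotvv_ge0 _); exact: ltW.
by split => // x w; rewrite r0 dotvE big1 ?addr0 ?add0r// => i _; rewrite mxE mul0r.
Qed.

(** * Joint laws with an independent variable *)

Section vector_law.
Context {R : realType} {p : nat}.
Local Notation V := 'cV[R]_p.
Local Notation RM := (measurableTypeR R).

Lemma expectation_binormal (Phi : V -> V -> R) (eta : R) : mfun2 Phi ->
  fine ('E_(iid_law (binormal eta) p)[(fun t =>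
    Phi (\col_j (tnth t j).1) (\col_j (tnth t j).2))%R])%E =
  E2 (fun x y => Phi x (eta *: x + cosin eta *: y)).
Proof.
move=> mPhi; pose Psi (w : p.-tuple RM * p.-tuple RM) := Phi (colt w.1) (colt w.2).
have -> : (fun t : p.-tuple (RM * RM) =>
    Phi (\col_j (tnth t j).1) (\col_j (tnth t j).2)) = fun t => Psi (fsts t, snds t).
  apply/funext => t; rewrite /Psi/=; congr Phi;
    by apply/colP => i; rewrite !mxE tnth_map.
have key (k : R -> R) : measurable_fun setT (k : RM -> RM) -> (forall r, 0 <= k r) ->
   (\int[iid_law (binormal eta) p]_t (k (Psi (fsts t, snds t)))%:E =
    \int[iid_law std_normal p \x iid_law std_normal p]_w
      (k (Phi (colt w.1) (eta *: colt w.1 + cosin eta *: colt w.2)))%:E)%E.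
  move=> mk k0.
  have m1 : measurable_fun setT (fun w : p.-tuple RM * p.-tuple RM => (k (Psi w))%:E).
    by apply/measurable_EFinP; exact: (measurableT_comp mk mPhi).
  rewrite (integral_iid_binormal eta m1); last by move=> w; rewrite lee_fin.
  have m2 : measurable_fun setT (fun w : p.-tuple RM * p.-tuple RM =>
      (k (Phi (colt w.1) (eta *: colt w.1 + cosin eta *: colt w.2)))%:E).
    have mt : measurable_fun setT (fun w : p.-tuple RM * p.-tuple RM =>
        (w.1, tlin eta (cosin eta) w.1 w.2)).
      by apply/measurable_fun_pair => //; exact: measurable_tlin.
    apply: eq_measurable_fun (measurableT_comp m1 mt) => w _.
    by rewrite /Psi/= colt_tlin.
  rewrite (fubini_tonelli1 _ m2); last by move=> w; rewrite lee_fin.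
  apply: eq_integral => x _; apply: eq_integral => y _.
  by rewrite /Psi/= colt_tlin.
rewrite unlock /E2 /Rintegral [in LHS]integralE [in RHS]integralE; congr (fine (_ - _)%E).
  transitivity (\int[iid_law (binormal eta) p]_t (Num.max (Psi (fsts t, snds t)) 0)%:E)%E.
    by apply: eq_integral => t _; rewrite funeposE/= -EFin_max.
  rewrite (key (fun r => Num.max r 0)); last 2 first.
  - exact: measurable_maxr.
  - by move=> r; rewrite le_max lexx orbT.
  by apply: eq_integral => t _; rewrite funeposE/= -EFin_max.
transitivity (\int[iid_law (binormal eta) p]_t (Num.max (- Psi (fsts t, snds t)) 0)%:E)%E.
  by apply: eq_integral => t _; rewrite funenegE/= -EFin_max.
rewrite (key (fun r => Num.max (- r) 0)); last 2 first.
- by apply: measurable_maxr => //; exact: measurable_oppr.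
- by move=> r; rewrite le_max lexx orbT.
by apply: eq_integral => t _; rewrite funenegE/= -EFin_max.
Qed.
End vector_law.

Section scalar_law.
Context {R : realType} (Fz : probability (measurableTypeR R) R).
Local Notation V := 'cV[R]_1.
Local Notation RM := (measurableTypeR R).
Local Notation T := (1.-tuple RM).
Local Notation gauss := (iid_law (@std_normal R) 1).
(** Scalar Gaussian variables are carried by 1-tuples, so that the vector theory applies in
    dimension one. *)
Definition gauss2 : probability (T * T)%type R := (gauss \x gauss)%E.

Lemma integral_gauss1 (h : RM -> \bar R) : measurable_fun setT h -> (forall x, (0 <= h x)%E) ->
  (\int[gauss]_t h (colt t 0%R 0%R) = \int[std_normal]_x h x)%E.
Proof.
move=> mh h0.
have mc : measurable_fun setT (fun t : T => colt t 0 0 : RM).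
  by under eq_fun do rewrite mxE; exact: measurable_tnth.
rewrite (integral_iid_law_cons std_normal (measurableT_comp mh mc) (fun t => h0 _)).
apply: eq_integral => x _.
transitivity (\int[iid_law std_normal 0]_t cst (h x) t)%E.
  by apply: eq_integral => t _; rewrite /= mxE.
exact: integral_probability_cst.
Qed.

Definition pairl (eta : R) (w : T * T) : RM * RM :=
  (colt w.1 0 0, eta * colt w.1 0 0 + cosin eta * colt w.2 0%R 0%R).

Lemma measurable_colt00 : measurable_fun setT (fun t : T => colt t 0 0 : RM).
Proof. by under eq_fun do rewrite mxE; exact: measurable_tnth. Qed.

Lemma measurable_pairl eta : measurable_fun setT (pairl eta).
Proof.
have m1 := measurableT_comp measurable_colt00 (@measurable_fst _ _ T T).
have m2 := measurableT_comp measurable_colt00 (@measurable_snd _ _ T T).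
apply/measurable_fun_pair => //; apply: measurable_funD; exact: measurable_funM.
Qed.

Lemma integral_binormal1 eta (Phi : RM * RM -> \bar R) :
  measurable_fun setT Phi -> (forall w, (0 <= Phi w)%E) ->
  (\int[binormal eta]_w Phi w = \int[gauss2]_w Phi (pairl eta w))%E.
Proof.
move=> mPhi Phi0; rewrite (integral_binormal eta mPhi Phi0) /gauss2.
rewrite (fubini_tonelli1 _ (measurableT_comp mPhi (measurable_pairl eta)) (fun w => Phi0 _)).
pose F (w : RM * RM) := Phi (w.1, eta * w.1 + cosin eta * w.2).
have mF : measurable_fun setT F.
  apply: (measurableT_comp mPhi); apply/measurable_fun_pair => //.
  by apply: measurable_funD; exact: measurable_funM.
have F0 w : (0 <= F w)%E by exact: Phi0.
transitivity (\int[std_normal]_x \int[gauss]_y F (x, colt y 0%R 0%R))%E.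
  apply: eq_integral => x _; apply/esym.
  apply: (integral_gauss1 (h := fun y => F (x, y))) => //.
  exact: measurableT_comp mF (pair1_measurable x).
apply/esym; apply: (integral_gauss1 (h := fun x => \int[gauss]_y F (x, colt y 0%R 0%R))%E) => [|x].
  apply: (measurable_fun_fubini_tonelli_F (fun w : RM * T => F (w.1, colt w.2 0%R 0%R))) => //.
  apply: measurableT_comp mF _; apply/measurable_fun_pair => //.
  exact: measurableT_comp measurable_colt00 _.
by apply: integral_ge0.
Qed.

Definition EZ (Psi : R -> V -> V -> R) : R :=
  \int[(Fz \x gauss2)%E]_w Psi w.1 (colt w.2.1) (colt w.2.2).

Lemma integral_Fz_binormal eta (Phi : RM * (RM * RM) -> \bar R) :
  measurable_fun setT Phi -> (forall w, (0 <= Phi w)%E) ->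
  (\int[Fz \x binormal eta]_w Phi w = \int[Fz \x gauss2]_w Phi (w.1, pairl eta w.2))%E.
Proof.
move=> mPhi Phi0.
have mp : measurable_fun setT (fun w : RM * (T * T) => (w.1, pairl eta w.2)).
  by apply/measurable_fun_pair => //; exact: measurableT_comp (measurable_pairl eta) _.
rewrite (fubini_tonelli1 _ mPhi Phi0).
rewrite (fubini_tonelli1 _ (measurableT_comp mPhi mp) (fun w => Phi0 _)).
apply: eq_integral => z _; apply: (integral_binormal1 eta (Phi := fun w => Phi (z, w))) => //.
exact: measurableT_comp mPhi (pair1_measurable z).
Qed.

Lemma integral_Fz_normal (Phi : RM * RM -> \bar R) :
  measurable_fun setT Phi -> (forall w, (0 <= Phi w)%E) ->
  (\int[Fz \x std_normal]_w Phi w = \int[Fz \x gauss2]_w Phi (w.1, colt w.2.1 0%R 0%R))%E.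
Proof.
move=> mPhi Phi0.
have mc : measurable_fun setT (fun w : T * T => colt w.1 0 0 : RM).
  exact: measurableT_comp measurable_colt00 _.
have mp : measurable_fun setT (fun w : RM * (T * T) => (w.1, colt w.2.1 0 0) : RM * RM).
  by apply/measurable_fun_pair => //; exact: measurableT_comp mc _.
rewrite (fubini_tonelli1 _ mPhi Phi0).
rewrite (fubini_tonelli1 _ (measurableT_comp mPhi mp) (fun w => Phi0 _)).
apply: eq_integral => z _.
have mz : measurable_fun setT (fun x => Phi (z, x)).
  exact: measurableT_comp mPhi (pair1_measurable z).
have mz2 : measurable_fun setT (fun w : T * T => Phi (z, colt w.1 0%R 0%R)).
  exact: measurableT_comp mz mc.
rewrite /fubini_F /= (fubini_tonelli1 _ mz2 (fun w => Phi0 _)).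
rewrite -(integral_gauss1 mz (fun x => Phi0 _)).
by apply: eq_integral => x _; rewrite /fubini_F/= integral_probability_cst.
Qed.

Lemma signed_transfer d1 d2 (T1 : measurableType d1) (T2 : measurableType d2)
    (P1 : {measure set T1 -> \bar R}) (P2 : {measure set T2 -> \bar R})
    (t : T2 -> T1) (f : T1 -> R) : measurable_fun setT (f : T1 -> RM) ->
  (forall Phi : T1 -> \bar R, measurable_fun setT Phi -> (forall w, (0 <= Phi w)%E) ->
    \int[P1]_w Phi w = \int[P2]_w Phi (t w))%E ->
  (\int[P1]_w (f w)%:E = \int[P2]_w (f (t w))%:E)%E.
Proof.
move=> /measurable_EFinP mf h; rewrite [LHS]integralE [RHS]integralE; congr (_ - _)%E.
  rewrite (h _ (measurable_funepos mf)) => [|w]; last exact: funepos_ge0.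
  by apply: eq_integral => w _; rewrite !funeposE.
rewrite (h _ (measurable_funeneg mf)) => [|w]; last exact: funeneg_ge0.
by apply: eq_integral => w _; rewrite !funenegE.
Qed.

Lemma EZ_fubini (Psi : R -> V -> V -> R) :
  (Fz \x gauss2)%E.-integrable setT
    (EFin \o (fun w : RM * (T * T) => Psi w.1 (colt w.2.1) (colt w.2.2))) ->
  (forall z, tame (Psi z)) ->
  Fz.-integrable setT (EFin \o (fun z => E2 (Psi z))) /\
  EZ Psi = \int[Fz]_z E2 (Psi z).
Proof.
move=> iPsi tPsi.
have e z : (\int[gauss2]_w (Psi z (colt w.1) (colt w.2))%:E)%E = (E2 (Psi z))%:E.
  by rewrite /E2 fineK//; exact: integrable_fin_num (tame_integrable (tPsi z)).
split.
  have := integrable_fubini_F iPsi.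
  by under [X in _.-integrable _ X]eq_fun do rewrite /fubini_F/= e.
rewrite /EZ /Rintegral -(integral12_prod_meas1 iPsi); congr fine.
by apply: eq_integral => z _; rewrite /fubini_F/= e.
Qed.
End scalar_law.

(** * Mixtures over the noise variable *)

Section mixture.
Context {R : realType} (Fz : probability (measurableTypeR R) R).
Local Notation V := 'cV[R]_1.
Local Notation RM := (measurableTypeR R).
Local Notation T := (1.-tuple RM).
Local Notation gauss2 := (@gauss2 R).
Local Notation I := [set y : R | -1 <= y <= 1].

Lemma lipschitz_measurable (f : R -> R) (L : R) :
  (forall x y, `|f x - f y| <= L * `|x - y|) -> measurable_fun setT (f : RM -> RM).
Proof.
move=> fL; apply: continuous_measurable_fun => x; apply/cvgrPdist_lt => e e0.
have L1 : 0 < `|L| + 1 by rewrite ltr_pwDr.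
near=> y.
have yx : `|x - y| < e / (`|L| + 1).
  near: y; apply: (@cvgr_dist_lt _ R^o) => //; exact: divr_gt0.
apply: le_lt_trans (fL _ _) _; apply: (@le_lt_trans _ _ ((`|L| + 1) * `|x - y|)).
  by apply: ler_wpM2r => //; rewrite (le_trans (ler_norm L))// lerDl.
by rewrite mulrC -ltr_pdivlMr.
Unshelve. all: by end_near. Qed.

Lemma EZ_nonneg (Psi : R -> V -> V -> R) :
  measurable_fun setT (fun w : RM * (T * T) => Psi w.1 (colt w.2.1) (colt w.2.2)) ->
  (forall z x y, 0 <= Psi z x y) -> (forall z, tame (Psi z)) ->
  (\int[Fz \x gauss2]_w (Psi w.1 (colt w.2.1) (colt w.2.2))%:E =
   \int[Fz]_z (E2 (Psi z))%:E)%E.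
Proof.
move=> /measurable_EFinP mPsi Psi0 tPsi; rewrite (fubini_tonelli1 _ mPsi) => [|w]; last by rewrite lee_fin.
apply: eq_integral => z _; rewrite /fubini_F/= /E2 fineK//.
exact: integrable_fin_num (tame_integrable (tPsi z)).
Qed.

(** What is used of [env'] for either loss: s bounds the slope in the Gaussian variable G, while a =
    E[f^2] and n = E[f G] are the values prescribed by the system. Only the noise z varies within a
    family. *)
Record family (f : R -> R) (al s a n : R) := Family {
  fam_al : 0 < al;
  fam_s : 0 < s;
  fam_lip : exists L, forall x y, `|f x - f y| <= L * `|x - y|;
  fam_sc : forall z, exists c, smooth_convex (s / 2) c (fun h : V => const_mx (f (z + al * h 0 0)));
  fam_sqr : ('E_(Fz \x std_normal)[(fun w => f (w.1 + al * w.2) ^+ 2)%R] = a%:E)%E;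
  fam_mean : ('E_(Fz \x std_normal)[(fun w => f (w.1 + al * w.2) * w.2)%R] = n%:E)%E }.

Definition slice (f : R -> R) (al z : R) : V -> V := fun h => const_mx (f (z + al * h 0 0)).

Section one_family.
Context (f : R -> R) (al s a n : R) (H : family f al s a n).

Lemma slice_lipv z : lipv s (slice f al z).
Proof.
have [c hc] := fam_sc H z; have := sc_lipv hc.
by rewrite (_ : 2 * (s / 2) = s)//; field.
Qed.

Lemma slice_tame z : tame1 (fun h : V => f (z + al * h 0 0)).
Proof.
have h : lipf s (fun x => slice f al z x 0 0) by exact: (slice_lipv z).
have := tame_lip h; rewrite /slice/tame1.
by under eq_fun do under eq_fun do rewrite mxE.
Qed.

Lemma measurable_f : measurable_fun setT (f : RM -> RM).
Proof. by have [L fL] := fam_lip H; exact: lipschitz_measurable fL. Qed.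

Lemma measurable_slice (b c : R) : measurable_fun setT (fun w : RM * (T * T) =>
  f (w.1 + al * (b * colt w.2.1 0 0 + c * colt w.2.2 0 0)) : RM).
Proof.
have m1 : measurable_fun setT (fun w : RM * (T * T) => colt w.2.1 0 0 : RM).
  by apply: measurableT_comp (@measurable_colt00 R) _; exact: measurableT_comp.
have m2 : measurable_fun setT (fun w : RM * (T * T) => colt w.2.2 0 0 : RM).
  by apply: measurableT_comp (@measurable_colt00 R) _; exact: measurableT_comp.
apply: measurableT_comp measurable_f _; apply: measurable_funD => //.
by apply: measurable_funM => //; apply: measurable_funD; exact: measurable_funM.
Qed.

Lemma measurable_slice1 : measurable_fun setT (fun w : RM * (T * T) =>
  f (w.1 + al * colt w.2.1 0 0) : RM).
Proof.
apply: eq_measurable_fun (measurable_slice 1 0) => w _.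
by rewrite mul1r mul0r addr0.
Qed.

Lemma slice_sqr_tame z : tame1 (fun h : V => f (z + al * h 0 0) ^+ 2).
Proof.
rewrite /tame1; under eq_fun do under eq_fun do rewrite expr2.
exact: tameM (slice_tame z) (slice_tame z).
Qed.

Lemma fam_sqrE : (\int[Fz]_z (E1 (fun h : V => f (z + al * h 0 0) ^+ 2))%:E = a%:E)%E.
Proof.
rewrite -(fam_sqr H) unlock.
have m0 : measurable_fun setT (fun w : RM * RM => (f (w.1 + al * w.2) ^+ 2)%:E).
  apply/measurable_EFinP; apply: measurable_funX; apply: measurableT_comp measurable_f _.
  by apply: measurable_funD => //; exact: measurable_funM.
rewrite (integral_Fz_normal Fz m0); last by move=> w; rewrite lee_fin sqr_ge0.
rewrite (EZ_nonneg (Psi := fun z x _ => f (z + al * x 0 0) ^+ 2)).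
- by apply: eq_integral => z _; rewrite (E2_E1 (slice_sqr_tame z).1).
- by apply: measurable_funX; exact: measurable_slice1.
- by move=> *; exact: sqr_ge0.
- by move=> z; exact: slice_sqr_tame.
Qed.

(** The combination b x + c y is standard Gaussian, so for each z the mean is that of the first
    marginal; both members of a correlated pair are covered. *)
Lemma fam_sqr_integrable (b c : R) : b ^+ 2 + c ^+ 2 = 1 ->
  (Fz \x gauss2)%E.-integrable setT (EFin \o (fun w : RM * (T * T) =>
  f (w.1 + al * (b * colt w.2.1 0 0 + c * colt w.2.2 0 0)) ^+ 2)).
Proof.
move=> bc; apply/integrableP; split.
  by apply/measurable_EFinP; apply: measurable_funX; exact: measurable_slice.
under eq_integral => w _ do rewrite /= ger0_norm ?sqr_ge0//.
have tl z : tame (fun x y : V => f (z + al * (b *: x + c *: y) 0 0) ^+ 2).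
  exact: (tame_lin b c (slice_sqr_tame z)).
rewrite (EZ_nonneg (Psi := fun z x y => f (z + al * (b * x 0 0 + c * y 0 0)) ^+ 2)).
- under eq_integral => z _.
    have -> : E2 (fun x y : V => f (z + al * (b * x 0 0 + c * y 0 0)) ^+ 2) =
       E1 (fun h : V => f (z + al * h 0 0) ^+ 2).
      rewrite -(E2_E1 (slice_sqr_tame z).1).
      rewrite -[RHS](@E2_reflection _ _ b c (fun h _ : V => f (z + al * h 0 0) ^+ 2) (slice_sqr_tame z).1 bc).
      by apply: eq_E2 => x y; rewrite !mxE.
    over.
  by rewrite fam_sqrE ltry.
- by apply: measurable_funX; exact: measurable_slice.
- by move=> *; exact: sqr_ge0.
- move=> z; have := tl z.
  by under eq_fun do under eq_fun do rewrite !mxE.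
Qed.

Lemma fam_sqr_Rint : Fz.-integrable setT (EFin \o (fun z => E1 (fun h : V => f (z + al * h 0 0) ^+ 2)))
  /\ \int[Fz]_z E1 (fun h : V => f (z + al * h 0 0) ^+ 2) = a.
Proof.
have e1 : (1:R) ^+ 2 + 0 ^+ 2 = 1 by rewrite expr1n expr0n addr0.
have h := fam_sqr_integrable e1.
have [|i1 i2] := @EZ_fubini R Fz (fun z x _ => f (z + al * x 0 0) ^+ 2) _ slice_sqr_tame.
  apply: eq_integrable h => // w _ /=.
  by rewrite mul1r mul0r addr0.
have e z : E2 (fun x _ : V => f (z + al * x 0 0) ^+ 2) = E1 (fun h : V => f (z + al * h 0 0) ^+ 2).
  exact: (E2_E1 (slice_sqr_tame z).1).
split; first by apply: eq_integrable i1 => // z _ /=; rewrite e.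
by rewrite /Rintegral fam_sqrE.
Qed.

Lemma fam_mean_Rint :
  Fz.-integrable setT (EFin \o (fun z => E1 (fun h => dotv h (slice f al z h)))) /\
  \int[Fz]_z E1 (fun h => dotv h (slice f al z h)) = n.
Proof.
have tx z : tame (fun (h _ : V) => f (z + al * h 0 0) * h 0 0).
  exact: tameM (slice_tame z) (tame_coord 0).
have mx : measurable_fun setT (fun w : RM * (T * T) => colt w.2.1 0 0 : RM).
  by apply: measurableT_comp (@measurable_colt00 R) _; exact: measurableT_comp.
have e1 : (1:R) ^+ 2 + 0 ^+ 2 = 1 by rewrite expr1n expr0n addr0.
have h := fam_sqr_integrable e1.
have i2 : (Fz \x gauss2)%E.-integrable setT (EFin \o (fun w : RM * (T * T) => colt w.2.1 0 0 ^+ 2)).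
  apply/integrableP; split; first by apply/measurable_EFinP; exact: measurable_funX.
  under eq_integral => w _ do rewrite /= ger0_norm ?sqr_ge0//.
  have t2 : tame (fun x _ : V => x 0 0 ^+ 2).
    under eq_fun do under eq_fun do rewrite expr2.
    exact: tameM (tame_coord 0) (tame_coord 0).
  rewrite (EZ_nonneg (Psi := fun _ x _ => x 0 0 ^+ 2)) //.
  - by rewrite integral_probability_cst ltry.
  - exact: measurable_funX.
  - by move=> *; exact: sqr_ge0.
have ix : (Fz \x gauss2)%E.-integrable setT
   (EFin \o (fun w : RM * (T * T) => f (w.1 + al * colt w.2.1 0 0) * colt w.2.1 0 0)).
  apply: (le_integrable measurableT _ _ (integrableD measurableT h i2)).
    by apply/measurable_EFinP; apply: measurable_funM => //; exact: measurable_slice1.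
  move=> w _; rewrite /= mul1r mul0r addr0 lee_fin.
  rewrite [leRHS]ger0_norm ?addr_ge0 ?sqr_ge0//.
  move: (colt _ 0 0) (f _) => y x.
  have := sqr_ge0 (x - y); have := sqr_ge0 (x + y).
  rewrite sqrrB sqrrD ler_norml => h1 h2; apply/andP; split; lra.
have [i3 i4] := @EZ_fubini R Fz (fun z x _ => f (z + al * x 0 0) * x 0 0) ix tx.
have e z : E1 (fun h => dotv h (slice f al z h)) = E2 (fun x _ : V => f (z + al * x 0 0) * x 0 0).
  rewrite (E2_E1 (tx z).1); apply: eq_E1 => x.
  by rewrite dotvE big_ord1 mxE mulrC.
split; first by apply: eq_integrable i3 => // z _ /=; rewrite e.
transitivity (EZ Fz (fun z x _ => f (z + al * x 0 0) * x 0 0)).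
  by rewrite i4; apply: eq_Rintegral => z _; exact: e.
rewrite /EZ /Rintegral -[RHS]/(fine n%:E) -(fam_mean H) unlock; congr fine; apply/esym.
have mX : measurable_fun setT (fun w : RM * RM => f (w.1 + al * w.2) * w.2 : RM).
  apply: measurable_funM => //; apply: measurableT_comp measurable_f _.
  by apply: measurable_funD => //; exact: measurable_funM.
have tr := integral_Fz_normal Fz.
have := @signed_transfer R _ _ _ _ (Fz \x std_normal)%E (Fz \x gauss2)%E
  (fun w : RM * (T * T) => (w.1, colt w.2.1 0 0)) _ mX tr.
exact.
Qed.
End one_family.
End mixture.

Section real_integrable.
Context d (T : measurableType d) (R : realType) (P : probability T R).
Local Notation integrableR h := (P.-integrable setT (EFin \o h)).
Implicit Types h : T -> R.

Lemma integrableRZ k h : integrableR h -> integrableR (fun z => k * h z).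
Proof. by move=> ih; exact: (integrableZl measurableT k ih). Qed.

Lemma integrableRD h1 h2 : integrableR h1 -> integrableR h2 -> integrableR (fun z => h1 z + h2 z).
Proof. by move=> i1 i2; exact: (integrableD measurableT i1 i2). Qed.

Lemma integrableRB h1 h2 : integrableR h1 -> integrableR h2 -> integrableR (fun z => h1 z - h2 z).
Proof. by move=> i1 i2; exact: (integrableB measurableT i1 i2). Qed.
End real_integrable.

Section two_families.
Context {R : realType} (Fz : probability (measurableTypeR R) R).
Local Notation V := 'cV[R]_1.
Local Notation RM := (measurableTypeR R).
Local Notation T := (1.-tuple RM).
Local Notation gauss2 := (@gauss2 R).
Local Notation I := [set y : R | -1 <= y <= 1].
Context (f g : R -> R) (al s a n al' s' b m : R).
Hypotheses (Hf : family Fz f al s a n) (Hg : family Fz g al' s' b m).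

Definition slice_corr (z eta : R) : R := corrs (slice f al z) (slice g al' z) eta.
Definition mix_corr (eta : R) : R := \int[Fz]_z slice_corr z eta.
Local Notation K := slice_corr.
Local Notation G := mix_corr.

Lemma mix_repr eta : -1 <= eta <= 1 -> Fz.-integrable setT (EFin \o K^~ eta) /\
  fine ('E_(Fz \x binormal eta)[(fun w =>
    f (w.1 + al * w.2.1) * g (w.1 + al' * w.2.2))%R])%E = G eta.
Proof.
move=> eta1.
pose Psi z (x y : V) := f (z + al * x 0 0) * g (z + al' * (eta * x 0 0 + cosin eta * y 0 0)).
have tPsi z : tame (Psi z).
  have := tameM (slice_tame Hf z) (tame_lin eta (cosin eta) (slice_tame Hg z)).
  by under eq_fun do under eq_fun do rewrite !mxE.
have KE z : K z eta = E2 (Psi z).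
  by rewrite /K /corrs big_ord1 /corr; apply: eq_E2 => x y; rewrite !mxE.
have e1 : (1:R) ^+ 2 + 0 ^+ 2 = 1 by rewrite expr1n expr0n addr0.
have i1 := fam_sqr_integrable Hf e1.
have i2 := fam_sqr_integrable Hg (cosinD eta1).
have iPsi : (Fz \x gauss2)%E.-integrable setT
    (EFin \o (fun w : RM * (T * T) => Psi w.1 (colt w.2.1) (colt w.2.2))).
  apply: (le_integrable measurableT _ _ (integrableD measurableT i1 i2)).
    apply/measurable_EFinP; apply: measurable_funM; first exact: (measurable_slice1 Hf).
    exact: (measurable_slice Hg).
  move=> w _; rewrite /= /Psi mul1r mul0r addr0 lee_fin.
  rewrite [leRHS]ger0_norm ?addr_ge0 ?sqr_ge0//.
  move: (f _) (g _) => x y.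
  have := sqr_ge0 (x - y); have := sqr_ge0 (x + y).
  rewrite sqrrB sqrrD ler_norml => h1 h2; apply/andP; split; lra.
have [i3 i4] := EZ_fubini iPsi tPsi.
split; first by apply: eq_integrable i3 => // z _ /=; rewrite KE.
transitivity (EZ Fz Psi); last by rewrite i4; apply: eq_Rintegral => z _; rewrite KE.
rewrite /EZ /Rintegral unlock; congr fine.
have mX : measurable_fun setT (fun w : RM * (RM * RM) =>
    f (w.1 + al * w.2.1) * g (w.1 + al' * w.2.2) : RM).
  apply: measurable_funM.
    apply: measurableT_comp (measurable_f Hf) _; apply: measurable_funD => //.
    by apply: measurable_funM => //; exact: measurableT_comp.
  apply: measurableT_comp (measurable_f Hg) _; apply: measurable_funD => //.
  by apply: measurable_funM => //; exact: measurableT_comp.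
have tr := integral_Fz_binormal Fz eta.
have := @signed_transfer R _ _ _ _ (Fz \x binormal eta)%E (Fz \x gauss2)%E
  (fun w : RM * (T * T) => (w.1, pairl eta w.2)) _ mX tr.
exact.
Qed.

Lemma mix_integrable eta : -1 <= eta <= 1 -> Fz.-integrable setT (EFin \o K^~ eta).
Proof. by case/mix_repr. Qed.

Lemma dotv_slice (h : R -> R) (c z : R) (x : V) :
  dotv (slice h c z x) (slice h c z x) = h (z + c * x 0 0) ^+ 2.
Proof. by rewrite dotvE big_ord1 !mxE expr2. Qed.

Lemma mix_bound l eta : 0 < l -> -1 <= eta <= 1 ->
  `|G eta| <= 2^-1 * (l * a + l^-1 * b).
Proof.
move=> l0 eta1; have iK := mix_integrable eta1.
have [i1 e1] := fam_sqr_Rint Hf; have [i2 e2] := fam_sqr_Rint Hg.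
apply: le_trans (le_normr_Rintegral measurableT iK) _.
have i12 := integrableRD (integrableRZ l i1) (integrableRZ l^-1 i2).
have i3 := integrableRZ 2^-1 i12.
have -> : 2^-1 * (l * a + l^-1 * b) = \int[Fz]_z (2^-1 *
    (l * E1 (fun h : V => f (z + al * h 0 0) ^+ 2) + l^-1 * E1 (fun h : V => g (z + al' * h 0 0) ^+ 2))).
  rewrite (RintegralZl _ measurableT i12).
  rewrite (RintegralD measurableT (integrableRZ l i1) (integrableRZ l^-1 i2)).
  by rewrite (RintegralZl _ measurableT i1) (RintegralZl _ measurableT i2) e1 e2.
apply: (le_Rintegral measurableT _ i3); first exact: integrable_norm.
move=> z _; apply: le_trans (corrs_bound (slice_lipv Hf z) (slice_lipv Hg z) l0 eta1) _.
rewrite le_eqVlt; apply/orP; left; apply/eqP.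
by congr (_ * (_ * _ + _ * _)); apply: eq_E1 => x; rewrite dotv_slice.
Qed.

Lemma mix_sub x y : -1 <= x <= 1 -> -1 <= y <= 1 ->
  Fz.-integrable setT (EFin \o (fun z => K z y - K z x)) /\
  G y - G x = \int[Fz]_z (K z y - K z x).
Proof.
move=> x1 y1; have ix := mix_integrable x1; have iy := mix_integrable y1.
rewrite /mix_corr (RintegralB measurableT iy ix); split; last exact: erefl.
exact: (integrableRB iy ix).
Qed.

Lemma mix_mono x y : -1 <= x -> x <= y -> y <= 1 -> G x <= G y.
Proof.
move=> x1 xy y1; rewrite -subr_ge0.
have [_ ->] := mix_sub (x := x) (y := y) ltac:(by rewrite x1 (le_trans xy)) ltac:(by rewrite y1 (le_trans x1)).
apply: Rintegral_ge0 => z _; rewrite subr_ge0.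
have [? h1] := fam_sc Hf z; have [? h2] := fam_sc Hg z.
exact: corrs_mono h1 h2 x1 xy y1.
Qed.

Lemma mix_slope x y : -1 <= x -> x <= y -> y <= 1 -> G y - G x <= s * m * (y - x).
Proof.
move=> x1 xy y1.
have [i1 ->] := mix_sub (x := x) (y := y) ltac:(by rewrite x1 (le_trans xy)) ltac:(by rewrite y1 (le_trans x1)).
have [i2 e2] := fam_mean_Rint Hg.
have i3 := integrableRZ (s * (y - x)) i2.
have -> : s * m * (y - x) = \int[Fz]_z (s * (y - x) * E1 (fun h => dotv h (slice g al' z h))).
  by rewrite (RintegralZl _ measurableT i2) e2 mulrAC.
apply: (le_Rintegral measurableT i1 i3) => z _.
have [? h1] := fam_sc Hf z; have [? h2] := fam_sc Hg z.
by rewrite [leRHS]mulrAC; exact: corrs_lip h1 h2 x1 xy y1.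
Qed.

Lemma mix_slope_strict x y :
  (exists u v, s / al * u - f u != s / al * v - f v) -> (exists u v, g u != g v) ->
  -1 <= x -> x < y -> y <= 1 -> G y - G x < s * m * (y - x).
Proof.
move=> [u [v uv]] [u' [v' uv']] x1 xy y1; rewrite -subr_gt0.
have xI : -1 <= x <= 1 by rewrite x1 (le_trans (ltW xy)).
have yI : -1 <= y <= 1 by rewrite y1 (le_trans x1)// ltW.
have [i1 ->] := mix_sub xI yI.
have [i2 e2] := fam_mean_Rint Hg.
have i3 := integrableRZ (s * (y - x)) i2.
have -> : s * m * (y - x) = \int[Fz]_z (s * (y - x) * E1 (fun h => dotv h (slice g al' z h))).
  by rewrite (RintegralZl _ measurableT i2) e2 mulrAC.
rewrite -(RintegralB measurableT i3 i1); apply: (Rintegral_gt0 (integrableRB i3 i1)) => z.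
rewrite /= subr_gt0.
have [? h1] := fam_sc Hf z; have [? h2] := fam_sc Hg z.
have al0 := fam_al Hf; have al'0 := fam_al Hg.
(* The Gaussian value that brings the argument z + c G to w. Nonconstancy of f and g is thus
   inherited by the slices at every z, and the integrand is positive everywhere. *)
pose pt (c w : R) : V := const_mx ((w - z) / c).
have ptE c w : 0 < c -> z + c * pt c w 0 0 = w.
  by move=> c0; rewrite mxE mulrC divfK ?gt_eqF// subrKC.
have cE w : (s *: pt al w - slice f al z (pt al w)) 0 0 = (s / al * w - f w) - s / al * z.
  have -> : (s *: pt al w - slice f al z (pt al w)) 0 0 =
    s * pt al w 0 0 - f (z + al * pt al w 0 0) by rewrite !mxE.
  by rewrite (ptE _ _ al0) mxE; field; rewrite gt_eqF.
have gE w : slice g al' z (pt al' w) 0 0 = g w by rewrite mxE (ptE _ _ al'0).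
have n1 : (s *: pt al u - slice f al z (pt al u)) 0 0 !=
    (s *: pt al v - slice f al z (pt al v)) 0 0.
  by rewrite !cE (inj_eq (addIr _)).
have n2 : slice g al' z (pt al' u') 0 0 != slice g al' z (pt al' v') 0 0 by rewrite !gE.
have := corrs_strict (sc_compl h1) h2 n1 n2 x1 xy y1.
rewrite (corrs_lin s (slice_lipv Hf z) (slice_lipv Hg z) xI).
rewrite (corrs_lin s (slice_lipv Hf z) (slice_lipv Hg z) yI) -/(K z x) -/(K z y).
move: (K z x) (K z y) (E1 _) => A B C; lra.
Qed.

(** The difference quotients are bounded by C uniformly in z. The pointwise derivative l is obtained
    by choice, so its measurability has to come from being a limit of measurable quotients along a
    sequence; the estimate for all y near x then follows by contradiction, from a sequence of bad
    points. *)
Lemma mix_dq x : -1 <= x <= 1 -> exists l, dq I G x l.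
Proof.
move=> x1.
have K0 : 0 <= s by exact: ltW (fam_s Hf).
have K'0 : 0 <= s' by exact: ltW (fam_s Hg).
have /choice[l hl] z := corrs_dq (slice_lipv Hf z) (slice_lipv Hg z) K0 K'0 x1.
pose C := s * s' * @K2 R 1.
have lipC z y : -1 <= y <= 1 -> `|K z y - K z x| <= C * `|y - x|.
  move=> y1; rewrite /slice_corr /corrs 2!big_ord1.
  exact: corr_lipschitz K0 K'0 (slice_lipv Hf z 0) (slice_lipv Hg z 0) y1 x1.
(* By dominated convergence along sequences tending to x. *)
have seq (y : nat -> R) : (forall k, -1 <= y k <= 1) -> (forall k, y k != x) ->
    (forall k, `|y k - x| <= k.+1%:R^-1) ->
    Fz.-integrable setT (EFin \o l) /\
    (fun k => (G (y k) - G x) / (y k - x)) @ \oo --> \int[Fz]_z l z.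
  move=> yI yx yn.
  pose q k z := (K z (y k) - K z x) / (y k - x).
  have iq k : Fz.-integrable setT (EFin \o q k).
    have [i1 _] := mix_sub x1 (yI k).
    apply: eq_integrable (integrableRZ (y k - x)^-1 i1) => // z _ /=.
    by rewrite /q mulrC.
  have cq z : q ^~ z @ \oo --> l z.
    apply/cvgrPdist_le => e e0; have [d d0 hd] := hl z e e0.
    near=> k.
    have nd : k.+1%:R^-1 < d by near: k; exact: (near_infty_natSinv_lt (PosNum d0)).
    have := hd (y k) (yI k) (le_lt_trans (yn k) nd).
    have y0 : y k - x != 0 by rewrite subr_eq0.
    have -> : K z (y k) - K z x - l z * (y k - x) = - (l z - q k z) * (y k - x).
      by rewrite /q mulNr mulrBl divfK// opprB.
    by rewrite mulNr normrN normrM ler_pM2r// normr_gt0.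
  have bq k z : `|q k z| <= C.
    have y0 : 0 < `|y k - x| by rewrite normr_gt0 subr_eq0.
    by rewrite normrM normfV ler_pdivrMr//; exact: lipC.
  have ml : measurable_fun setT (EFin \o l : RM -> \bar R).
    apply: (emeasurable_fun_cvg (fun k => EFin \o q k)) => [k|z _].
      exact: measurable_int (iq k).
    by apply: cvg_EFin => //; [exact: nearW|exact: cq].
  have [||||il _ cl] := @dominated_convergence _ _ _ Fz setT measurableT
     (fun k => EFin \o q k) (EFin \o l) (cst C%:E) _ ml.
  - by move=> k; exact: measurable_int (iq k).
  - by apply: aeW => z _; apply: cvg_EFin => //; [exact: nearW|exact: cq].
  - exact: finite_measure_integrable_cst.
  - by apply: aeW => z k _; rewrite lee_fin.
  split => //.
  have -> : (fun k => (G (y k) - G x) / (y k - x)) = (fun k => fine (\int[Fz]_z (q k z)%:E)).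
    apply/funext => k; have [i1 e1] := mix_sub x1 (yI k).
    by rewrite e1 mulrC -(RintegralZl _ measurableT i1); apply: eq_Rintegral => z _; rewrite mulrC.
  apply: fine_cvg; rewrite /Rintegral fineK; first exact: cl.
  exact: integrable_fin_num.
exists (\int[Fz]_z l z) => e e0; apply: contrapT => /forallPNP no.
have bad k : exists y : R, [/\ -1 <= y <= 1, `|y - x| < k.+1%:R^-1 &
    e * `|y - x| < `|G y - G x - (\int[Fz]_z l z) * (y - x)|].
  apply: contrapT => /forallNP h; apply: (no k.+1%:R^-1); first by rewrite invr_gt0.
  move=> y yI yx; rewrite leNgt; apply/negP => hy; exact: (h y).
have [y hy] := choice bad.
have yx k : y k != x.
  apply/eqP => e1; have [_ _] := hy k; rewrite e1 !subrr normr0 !mulr0 subrr normr0 ltxx//.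
have [|||_] := seq y => //.
- by move=> k; have [] := hy k.
- by move=> k; have [_ /ltW] := hy k.
move/cvgrPdist_lt => /(_ e e0)[N _ /(_ N (leqnn N))] /=.
have [_ _] := hy N; have y0 : y N - x != 0 by rewrite subr_eq0.
move: (y N - x) (G (y N) - G x) (\int[Fz]_z l z) y0 => D A L D0 h1 h2.
have e1 : A - L * D = - (L - A / D) * D by field.
move: h1; rewrite e1 mulNr normrN normrM ltr_pM2r ?normr_gt0// => h1.
by have := lt_trans h1 h2; rewrite ltxx.
Unshelve. all: by end_near. Qed.
End two_families.

(** * Fixed points and the equations of the system *)

Section fixed_point.
Context {R : realType}.

(** Knaster-Tarski: the supremum of the points with x <= F x is fixed, with no appeal to
    continuity. *)
Lemma monotone_fixed_point (F : R -> R) :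
  {in `[-1, 1] &, {homo F : x y / x <= y}} ->
  (forall x, -1 <= x <= 1 -> -1 <= F x <= 1) ->
  exists2 x, -1 <= x <= 1 & F x = x.
Proof.
move=> Fm FI; pose S := [set x | -1 <= x <= 1 /\ x <= F x].
have Sm1 : S (-1).
  have I1 : -1 <= (-1 : R) <= 1 by rewrite lexx/=; lra.
  by split => //; case/andP: (FI _ I1).
have Sub : has_ubound S by exists 1 => x [/andP[_ ?] _].
have sI : -1 <= sup S <= 1.
  apply/andP; split; first exact: ub_le_sup.
  by apply: ge_sup; [exists (-1)|move=> x [/andP[_ ?] _]].
have itv x : -1 <= x <= 1 -> x \in `[-1, 1] by rewrite in_itv.
have sF : sup S <= F (sup S).
  apply: ge_sup; first by exists (-1).
  move=> x [xI xF]; apply: (le_trans xF); apply: Fm; [exact: itv|exact: itv|].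
  exact: (ub_le_sup Sub (conj xI xF)).
exists (sup S) => //; apply/eqP; rewrite eq_le sF andbT.
apply: (ub_le_sup Sub); split; first exact: FI.
by apply: Fm => //; apply: itv => //; exact: FI.
Qed.

(** Two fixed points x < y of the composition would give y - x <= L (F y - F x) < L M (y - x) <= y -
    x when L > 0, and y - x <= 0 when L = 0. *)
Lemma coupled_fixed_point (F H : R -> R) (B L M : R) :
  B <= 1 -> 0 <= L -> L * M <= 1 ->
  (forall x, -1 <= x <= 1 -> `|F x| <= B) ->
  (forall x, -1 <= x <= 1 -> `|H x| <= 1) ->
  {in `[-1, 1] &, {homo F : x y / x <= y}} ->
  {in `[-1, 1] &, {homo H : x y / x <= y}} ->
  (forall x y, -1 <= x <= 1 -> -1 <= y <= 1 -> `|H x - H y| <= L * `|x - y|) ->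
  (forall x y, -1 <= x -> x < y -> y <= 1 -> F y - F x < M * (y - x)) ->
  exists etaG etaH, [/\ [/\ -1 <= etaG <= 1, -1 <= etaH <= 1, etaG = H etaH & etaH = F etaG],
    - B <= etaH <= B &
    forall etaG' etaH', [/\ -1 <= etaG' <= 1, -1 <= etaH' <= 1, etaG' = H etaH' & etaH' = F etaG'] ->
      etaG' = etaG /\ etaH' = etaH].
Proof.
move=> B1 L0 LM FB H1 Fm Hm HL FM.
have itv x : -1 <= x <= 1 -> x \in `[-1, 1] by rewrite in_itv.
have FBI x : -1 <= x <= 1 -> - B <= F x <= B by move=> /FB; rewrite ler_norml.
have FI x : -1 <= x <= 1 -> -1 <= F x <= 1.
  by move=> /FBI/andP[h1 h2]; apply/andP; split; lra.
have HI x : -1 <= x <= 1 -> -1 <= H x <= 1 by move=> /H1; rewrite ler_norml.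
have [|x /FI/HI//|g gI gE] := @monotone_fixed_point (H \o F).
  move=> x y xI yI xy /=; have xI' := xI; have yI' := yI.
  rewrite in_itv/= in xI'; rewrite in_itv/= in yI'.
  by apply: Hm; [exact/itv/FI|exact/itv/FI|exact: Fm].
have uniq x y : -1 <= x <= 1 -> -1 <= y <= 1 -> x < y -> H (F x) = x -> H (F y) = y -> False.
  move=> xI yI xy ex ey; have /andP[x1 _] := xI; have /andP[_ y1] := yI.
  have := HL _ _ (FI _ yI) (FI _ xI); rewrite ex ey.
  have Fxy : F x <= F y by apply: Fm; [exact: itv|exact: itv|exact: ltW].
  rewrite ger0_norm ?subr_ge0 ?(ltW xy)// ger0_norm ?subr_ge0// => h.
  have h2 := FM x y x1 xy y1.
  have d0 : 0 < y - x by rewrite subr_gt0.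
  have [Lz|Ln] := eqVneq L 0; first by rewrite Lz mul0r in h; lra.
  have Lp : 0 < L by rewrite lt_neqAle eq_sym Ln.
  rewrite -(ltr_pM2l Lp) mulrA in h2.
  have h3 : L * M * (y - x) <= y - x by rewrite ler_piMl// ltW.
  have := lt_le_trans h2 h3; rewrite ltNge; move: h => -> //.
exists g, (F g); split; first by split => //; exact: FI.
  exact: FBI.
move=> g' h' [g'I h'I e1 e2].
suff gg : g' = g by rewrite e2 gg.
have e' : H (F g') = g' by rewrite -e2.
have [lt|lt|//] := ltgtP g' g.
  by case: (uniq g' g g'I gI lt e' gE).
by case: (uniq g g' gI g'I lt gE e').
Qed.
End fixed_point.

Section vector_side.
Context {R : realType} {p : nat}.
Local Notation V := 'cV[R]_p.
Context (s : R) (a : V -> R) (v : V -> V) (H : smooth_convex (s / 2) a v).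

Lemma sc_compl_lipv : lipv s (fun x => s *: x - v x).
Proof.
have := sc_lipv (sc_compl H).
by rewrite (_ : 2 * (s / 2) = s)//; field.
Qed.
End vector_side.

(** The source of finiteness: an equation of the system equates a real number with a positive
    multiple of an extended expectation. *)
Lemma ereal_scale_eq {R : realType} (c x : R) (e : \bar R) : 0 < c ->
  (x%:E = c%:E * e)%E -> e = (x / c)%:E.
Proof.
move=> c0; case: e => [r| |].
- rewrite -EFinM => -[->]; congr (_%:E).
  by rewrite mulrAC divff ?mul1r// gt_eqF.
- by rewrite gt0_muley ?lte_fin.
- by rewrite gt0_muleNy ?lte_fin.
Qed.

Lemma lipschitz_onE {R : realType} (k : R) (f : R -> R) :
  (forall x y, -1 <= x <= 1 -> -1 <= y <= 1 -> `|f x - f y| <= k * `|x - y|) ->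
  k.-lipschitz_`[-1, 1] f.
Proof.
move=> h [x y] [/= xI yI]; apply: h.
  by move: xI; rewrite /= in_itv.
by move: yI; rewrite /= in_itv.
Qed.

(** * Consequences of the system for the loss and for the residual *)

Section loss_family.
Context {R : realType} (Fz : probability (measurableTypeR R) R).
Context (ell : R -> R) (p : nat) (phi : 'cV[R]_p -> \bar R) (gamma : R).
Context (theta : 'cV[R]_p) (Sigma : 'M[R]_p) (alpha beta kappa nu : R).
Hypotheses (hell : convex_function [set: R^o] (ell : R^o -> R^o)) (gamma0 : 0 < gamma).
Hypotheses (hp : (1 <= p)%N) (hphi : regularizer phi).
Hypothesis hsys : systemA Fz ell phi gamma theta Sigma alpha beta kappa nu.

Lemma env_family : family Fz (env' ell ^~ kappa) alpha (alpha / kappa)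
  (beta ^+ 2 / gamma) (nu * alpha / gamma).
Proof.
have [[al0 b0 k0 n0] _ e2 _ e4] := hsys.
split => //; first exact: divr_gt0.
- exists kappa^-1 => x y.
  have := sc_lipv (env_sc hell k0 0 ltr01) ord0 (const_mx x) (const_mx y).
  rewrite /= !mxE !add0r !mul1r /N1 big_ord1 !mxE.
  by rewrite (_ : 2 * (kappa^-1 / 2) = kappa^-1)//; field; rewrite gt_eqF.
- by move=> z; have := env_sc hell k0 z al0; exists (fun h => alpha^-1 * env ell (z + alpha * h 0 0) kappa).
- exact: ereal_scale_eq gamma0 e2.
- exact: ereal_scale_eq gamma0 e4.
Qed.

(** A constant would be uncorrelated with G, whereas the system makes E[env' G] equal to nu alpha /
    gamma > 0. *)
Lemma env'_nonconstant : exists u v, env' ell u kappa != env' ell v kappa.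
Proof.
have [[al0 b0 k0 n0] _ _ _ _] := hsys.
apply: contrapT => /forallNP h.
have cst u : env' ell u kappa = env' ell 0 kappa.
  have /forallNP/(_ 0)/negP := h u; rewrite negbK => /eqP //.
have [_] := fam_mean_Rint env_family.
have z0 z : E1 (fun h => dotv h (slice (env' ell ^~ kappa) alpha z h)) = 0.
  transitivity (E1 (fun h : 'cV[R]_1 => env' ell 0 kappa * h 0 0)).
    by apply: eq_E1 => x; rewrite dotvE big_ord1 mxE cst mulrC.
  by rewrite (E1Z _ (tame_coord 0)) E1_coord mulr0.
under eq_Rintegral do rewrite z0.
rewrite Rintegral_cst// mul0r => e.
have : 0 < nu * alpha / gamma by rewrite divr_gt0// mulr_gt0.
by rewrite -e ltxx.
Qed.

(** Minus the residual, written as a complement so that [sc_compl] applies as it stands; the two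
    signs cancel in F_phi. *)
Definition resid_neg (h : 'cV[R]_p) := (beta / nu) *: h -
  ((beta / nu) *: h + residual phi theta Sigma beta nu h).

Lemma resid_negE h : resid_neg h = - residual phi theta Sigma beta nu h.
Proof. by rewrite /resid_neg opprD addrA subrr add0r. Qed.

Lemma resid_sc : exists a, smooth_convex (beta / nu / 2) a
    (fun h => (beta / nu) *: h + residual phi theta Sigma beta nu h).
Proof. by have [[_ b0 _ n0] _ _ _ _] := hsys; exact: residual_sc. Qed.

Lemma resid_lipv : lipv (beta / nu) resid_neg.
Proof. by have [a h] := resid_sc; exact: sc_compl_lipv h. Qed.

Lemma resid_sqr : E1 (fun k => dotv (resid_neg k) (resid_neg k)) = p%:R * alpha ^+ 2.
Proof.
have [_ e1 _ _ _] := hsys.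
have p0 : 0 < p%:R^-1 :> R by rewrite invr_gt0 ltr0n.
have := ereal_scale_eq p0 e1; rewrite unlock => e.
rewrite -[RHS]mulrC -[p%:R]invrK -[RHS]/(fine (_)%:E) -e.
by rewrite /E1 /Rintegral; congr fine; apply: eq_integral => t _; rewrite resid_negE dotvNl dotvNr opprK.
Qed.

Lemma resid_mean : E1 (fun k => dotv k (resid_neg k)) = p%:R * (kappa * beta).
Proof.
have [_ _ _ e3 _] := hsys.
have p0 : 0 < p%:R^-1 :> R by rewrite invr_gt0 ltr0n.
have := ereal_scale_eq p0 e3; rewrite unlock => e.
rewrite -[RHS]mulrC -[p%:R]invrK -[RHS]/(fine (_)%:E) -e.
rewrite /E1 /Rintegral; congr fine; apply: eq_integral => t _.
by rewrite resid_negE dotvNr dotvC dotvNr.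
Qed.
End loss_family.

Section auxiliary.
Context {R : realType}.
Local Notation I := [set y : R | -1 <= y <= 1].

Lemma tame_dotv2 p (L L' : R) (u u' : 'cV[R]_p -> 'cV[R]_p) : lipv L u -> lipv L' u' ->
  tame (fun x y => dotv (u x) (u' y)).
Proof.
move=> uL u'L; under eq_fun do under eq_fun do rewrite dotvE.
apply: (@tame_sum R p _ _ (fun i x y => u x i 0 * u' y i 0)) => i.
exact: tameM (tame_lip (uL i)) (tame_snd (tame_lip (u'L i))).
Qed.

Lemma E2_dotv p (L L' : R) (u u' : 'cV[R]_p -> 'cV[R]_p) eta : lipv L u -> lipv L' u' ->
  E2 (fun x y => dotv (u x) (u' (eta *: x + cosin eta *: y))) = corrs u u' eta.
Proof.
move=> uL u'L; rewrite /corrs /corr -E2_sum => [|i]; last first.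
  exact: tameM (tame_lip (uL i)) (tame_lin _ _ (tame_lip (u'L i))).
by apply: eq_E2 => x y; rewrite dotvE.
Qed.

Lemma mix_sym (Fz : probability (measurableTypeR R) R) f g al s a n al' s' b m eta :
  family Fz f al s a n -> family Fz g al' s' b m -> -1 <= eta <= 1 ->
  mix_corr Fz f g al al' eta = mix_corr Fz g f al' al eta.
Proof.
move=> Hf Hg eta1; apply: eq_Rintegral => z _.
exact: corrs_sym (slice_lipv Hf z) (slice_lipv Hg z) eta1.
Qed.

Lemma slope_lip (F : R -> R) M :
  (forall x y, -1 <= x -> x <= y -> y <= 1 -> F x <= F y) ->
  (forall x y, -1 <= x -> x <= y -> y <= 1 -> F y - F x <= M * (y - x)) ->
  forall x y, -1 <= x <= 1 -> -1 <= y <= 1 -> `|F x - F y| <= M * `|x - y|.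
Proof.
move=> mn sl x y; wlog xy : x y / x <= y => [hw|].
  have [|/ltW] := leP x y; first exact: hw.
  by move=> yx x1 y1; rewrite distrC (distrC x); exact: hw.
move=> /andP[x1 _] /andP[_ y1]; rewrite distrC (distrC x).
by rewrite !ger0_norm ?subr_ge0//; [exact: sl|exact: mn].
Qed.

Lemma lip_comp (F H : R -> R) (L M : R) : 0 <= L ->
  (forall x, -1 <= x <= 1 -> -1 <= F x <= 1) ->
  (forall x y, -1 <= x <= 1 -> -1 <= y <= 1 -> `|F x - F y| <= M * `|x - y|) ->
  (forall x y, -1 <= x <= 1 -> -1 <= y <= 1 -> `|H x - H y| <= L * `|x - y|) ->
  forall x y, -1 <= x <= 1 -> -1 <= y <= 1 -> `|H (F x) - H (F y)| <= L * M * `|x - y|.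
Proof.
move=> L0 FI FM HL x y x1 y1; apply: le_trans (HL _ _ (FI _ x1) (FI _ y1)) _.
by rewrite -mulrA; apply: ler_wpM2l => //; exact: FM.
Qed.

Lemma derivable_within_scale (F G : R -> R) (C : R) :
  (forall x, -1 <= x <= 1 -> F x = C * G x) ->
  (forall x, -1 <= x <= 1 -> exists l, dq I G x l) -> derivable_within `[-1, 1] F.
Proof.
move=> FG h; apply: dq_derivable_within => x xI.
have x1 : -1 <= x <= 1 by move: xI; rewrite /= ?in_itv.
have [l hl] := h x x1; exists (C * l + 0 * l).
apply: (@dq_sub _ I); first by move=> y /=; rewrite ?in_itv.
apply: (@dq_eq _ I (fun y => C * G y + 0 * G y)) => //; last exact: dq_lin.
by move=> y; rewrite inE => y1; rewrite mul0r addr0 FG.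
Qed.
End auxiliary.

(** * Bounds, slopes and the fixed point of the coupled system *)

Theorem theorem9 (R : realType) (Fz : probability (measurableTypeR R) R)
  (ell ellt : R -> R)
  (hell : convex_function [set: R^o] (ell : R^o -> R^o))
  (hellt : convex_function [set: R^o] (ellt : R^o -> R^o))
  (p : nat) (hp : (1 <= p)%N)
  (phi phit : 'cV[R]_p -> \bar R)
  (hphi : regularizer phi) (hphit : regularizer phit)
  (delta c ct : R) (hdelta : 0 < delta) (hc : 0 < c <= 1) (hct : 0 < ct <= 1)
  (theta : 'cV[R]_p) (Sigma : 'M[R]_p) (hSigma : posdefmx Sigma)
  (alpha beta kappa nu : R)
  (hsys : systemA Fz ell phi (c * delta) theta Sigma alpha beta kappa nu)
  (alphat betat kappat nut : R)
  (hsyst : systemA Fz ellt phit (ct * delta) theta Sigma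
             alphat betat kappat nut) :
  let F_l := Fl Fz ell ellt delta c ct alpha beta kappa alphat betat kappat in
  let F_phi := Fphi phi phit theta Sigma alpha beta nu alphat betat nut in
  let sol (etaG etaH : R) :=
    [/\ -1 <= etaG <= 1, -1 <= etaH <= 1, etaG = F_phi etaH & etaH = F_l etaG] in
  [/\ (forall eta, -1 <= eta <= 1 -> `|F_l eta| <= Num.sqrt (c * ct)) /\
      (forall eta, -1 <= eta <= 1 -> `|F_phi eta| <= 1),
      [/\ {in `[-1, 1] &, {homo F_l : x y / x <= y}},
          {in `[-1, 1] &, {homo F_phi : x y / x <= y}},
          derivable_within `[-1, 1] F_l,
          derivable_within `[-1, 1] F_phi &
          (Num.min c ct).-lipschitz_`[-1, 1] (F_l \o F_phi) /\
          (Num.min c ct).-lipschitz_`[-1, 1] (F_phi \o F_l)] &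
      exists etaG etaH : R,
        [/\ sol etaG etaH,
            - Num.sqrt (c * ct) <= etaH <= Num.sqrt (c * ct) &
            forall etaG' etaH', sol etaG' etaH' ->
              etaG' = etaG /\ etaH' = etaH]].
Proof.
move=> F_l F_phi sol; rewrite /sol {sol}.
have /andP[c0 c1] := hc; have /andP[ct0 ct1] := hct.
have g0 : 0 < c * delta by exact: mulr_gt0.
have gt0 : 0 < ct * delta by exact: mulr_gt0.
have [[al0 b0 k0 n0] _ _ _ _] := hsys.
have [[alt0 bt0 kt0 nt0] _ _ _ _] := hsyst.
have Hf := env_family hell g0 hsys; have Hg := env_family hellt gt0 hsyst.
have Ul := resid_lipv hp hphi hsys; have U'l := resid_lipv hp hphit hsyst.
have [a Hv] := resid_sc hp hphi hsys; have [a' Hv'] := resid_sc hp hphit hsyst.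
have HU := sc_compl Hv; have HU' := sc_compl Hv'.
pose U := resid_neg phi theta Sigma beta nu.
pose U' := resid_neg phit theta Sigma betat nut.
have p0 : 0 < p%:R :> R by rewrite ltr0n.
pose A := (alpha * alphat)^-1 * p%:R^-1; pose B := delta * c * ct / (beta * betat).
have A0 : 0 < A by rewrite mulr_gt0// invr_gt0// mulr_gt0.
have B0 : 0 < B by rewrite divr_gt0// !mulr_gt0.
pose G := mix_corr Fz (env' ell ^~ kappa) (env' ellt ^~ kappat) alpha alphat.
have FlE eta : -1 <= eta <= 1 -> F_l eta = B * G eta.
  by move=> eta1; have [_ e] := mix_repr Hf Hg eta1; rewrite /F_l /Fl -/B; congr (_ * _).
have FpE eta : F_phi eta = A * corrs U U' eta.
  rewrite /F_phi /Fphi -/A -(E2_dotv eta Ul U'l); congr (_ * _).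
  rewrite -(expectation_binormal eta (tame_dotv2 Ul U'l).1).
  congr fine; congr (expectation _ _); apply/funext => t.
  by rewrite !resid_negE dotvNl dotvNr opprK.
have between (x y : R) : -1 <= x -> x <= y -> y <= 1 -> -1 <= x <= 1 /\ -1 <= y <= 1.
  by move=> x1 xy y1; rewrite x1 y1 (le_trans x1 xy) (le_trans xy y1).
have Gmono := mix_mono Hf Hg.
have Fl_mono x y : -1 <= x -> x <= y -> y <= 1 -> F_l x <= F_l y.
  move=> x1 xy y1; have [xI yI] := between x y x1 xy y1.
  by rewrite (FlE _ xI) (FlE _ yI); apply: ler_wpM2l; [exact: ltW|exact: Gmono].
have Fp_mono x y : -1 <= x -> x <= y -> y <= 1 -> F_phi x <= F_phi y.
  move=> x1 xy y1; rewrite !FpE; apply: ler_wpM2l; first exact: ltW.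
  exact: corrs_mono HU HU' x1 xy y1.
(* Each slope bound is the prefactor, times the Lipschitz constant of the complemented factor, times
   the mean that the system gives for the other factor. *)
pose M1 := B * (alphat / kappat * (nu * alpha / (c * delta))).
pose M2 := B * (alpha / kappa * (nut * alphat / (ct * delta))).
pose L1 := A * (beta / nu * (p%:R * (kappat * betat))).
pose L2 := A * (betat / nut * (p%:R * (kappa * beta))).
(* The pairing is crosswise: M1 complements the second loss and L1 the first regularizer. All
   parameters of both systems then cancel. *)
have k1 : L1 * M1 = ct.
  rewrite /L1 /M1 /A /B; field.
  by rewrite !gt_eqF.
have k2 : L2 * M2 = c.
  rewrite /L2 /M2 /A /B; field.
  by rewrite !gt_eqF.
have L10 : 0 <= L1.
  by apply: mulr_ge0; [exact: ltW|apply: mulr_ge0; [apply: divr_ge0|apply: mulr_ge0; [|apply: mulr_ge0]]; exact: ltW].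
have L20 : 0 <= L2.
  by apply: mulr_ge0; [exact: ltW|apply: mulr_ge0; [apply: divr_ge0|apply: mulr_ge0; [|apply: mulr_ge0]]; exact: ltW].
have M10 : 0 <= M1.
  by apply: mulr_ge0; [exact: ltW|apply: mulr_ge0; [apply: divr_ge0|apply: divr_ge0; apply: mulr_ge0]; exact: ltW].
have M20 : 0 <= M2.
  by apply: mulr_ge0; [exact: ltW|apply: mulr_ge0; [apply: divr_ge0|apply: divr_ge0; apply: mulr_ge0]; exact: ltW].
have Fl_M2 x y : -1 <= x -> x <= y -> y <= 1 -> F_l y - F_l x <= M2 * (y - x).
  move=> x1 xy y1; have [xI yI] := between x y x1 xy y1.
  rewrite (FlE _ xI) (FlE _ yI) -mulrBr /M2 -[leRHS]mulrA; apply: ler_wpM2l; first exact: ltW.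
  exact: (mix_slope Hf Hg).
have Fl_M1 x y : -1 <= x -> x <= y -> y <= 1 -> F_l y - F_l x <= M1 * (y - x).
  move=> x1 xy y1; have [xI yI] := between x y x1 xy y1.
  rewrite (FlE _ xI) (FlE _ yI) -mulrBr /M1 -[leRHS]mulrA; apply: ler_wpM2l; first exact: ltW.
  rewrite /G (mix_sym Hf Hg xI) (mix_sym Hf Hg yI).
  exact: (mix_slope Hg Hf).
have Fp_L1 x y : -1 <= x -> x <= y -> y <= 1 -> F_phi y - F_phi x <= L1 * (y - x).
  move=> x1 xy y1; rewrite !FpE -mulrBr /L1 -[leRHS]mulrA; apply: ler_wpM2l; first exact: ltW.
  by rewrite -(resid_mean hp hsyst); exact: corrs_lip HU HU' x1 xy y1.
have Fp_L2 x y : -1 <= x -> x <= y -> y <= 1 -> F_phi y - F_phi x <= L2 * (y - x).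
  move=> x1 xy y1; have [xI yI] := between x y x1 xy y1.
  rewrite !FpE -mulrBr /L2 -[leRHS]mulrA; apply: ler_wpM2l; first exact: ltW.
  rewrite (corrs_sym Ul U'l xI) (corrs_sym Ul U'l yI) -(resid_mean hp hsys).
  exact: corrs_lip HU' HU x1 xy y1.
have cct : 0 < c * ct by exact: mulr_gt0.
pose r := Num.sqrt (c * ct).
have r0 : 0 < r by rewrite sqrtr_gt0.
have r2 : r * r = c * ct by rewrite -expr2 sqr_sqrtr// ltW.
have Fl_bound eta : -1 <= eta <= 1 -> `|F_l eta| <= r.
  move=> eta1; rewrite FlE// normrM gtr0_norm//.
  (* The square root of the quotient of the two second moments, which balances the terms of Young's
     inequality. *)
  pose l := betat * c / (beta * r).
  have l0 : 0 < l by rewrite /l !(divr_gt0, mulr_gt0).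
  apply: (le_trans (ler_wpM2l (ltW B0) (mix_bound Hf Hg l0 eta1))).
  rewrite le_eqVlt; apply/orP; left; apply/eqP.
  transitivity (2^-1 * (c * ct / r + r)).
    by rewrite /B /l; field; rewrite !gt_eqF.
  by rewrite -r2; field; rewrite gt_eqF.
have Fp_bound eta : -1 <= eta <= 1 -> `|F_phi eta| <= 1.
  move=> eta1; rewrite FpE// normrM gtr0_norm//.
  (* Again the balancing weight, now for the second moments p alpha^2 and p alphat^2. *)
  have l0 : 0 < alphat / alpha by exact: divr_gt0.
  apply: (le_trans (ler_wpM2l (ltW A0) (corrs_bound Ul U'l l0 eta1))).
  rewrite (resid_sqr hp hsys) (resid_sqr hp hsyst).
  rewrite le_eqVlt; apply/orP; left; apply/eqP.
  by rewrite /A; field; rewrite !gt_eqF.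
have r1 : r <= 1.
  by rewrite /r -[leRHS]sqrtr1; apply: ler_wsqrtr; apply: mulr_ile1 => //; exact: ltW.
have FlI x : -1 <= x <= 1 -> -1 <= F_l x <= 1.
  by move=> x1; rewrite -ler_norml; exact: le_trans (Fl_bound x x1) r1.
have FpI x : -1 <= x <= 1 -> -1 <= F_phi x <= 1.
  by move=> x1; rewrite -ler_norml; exact: Fp_bound.
have itv (F : R -> R) : (forall x y, -1 <= x -> x <= y -> y <= 1 -> F x <= F y) ->
    {in `[-1, 1] &, {homo F : x y / x <= y}}.
  by move=> h x y; rewrite !in_itv/= => /andP[x1 _] /andP[_ y1] xy; exact: h.
have minle (F : R -> R) x y : `|F x - F y| <= ct * `|x - y| -> `|F x - F y| <= c * `|x - y| ->
    `|F x - F y| <= Num.min c ct * `|x - y|.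
  by move=> h1 h2; case: (leP c ct).
have lip_l1 := slope_lip Fl_mono Fl_M1; have lip_l2 := slope_lip Fl_mono Fl_M2.
have lip_p1 := slope_lip Fp_mono Fp_L1; have lip_p2 := slope_lip Fp_mono Fp_L2.
split.
- exact (conj Fl_bound Fp_bound).
- split.
  + exact (itv _ Fl_mono).
  + exact (itv _ Fp_mono).
  + apply: (derivable_within_scale FlE) => x; exact: (mix_dq Hf Hg).
  + apply: (derivable_within_scale (fun x _ => FpE x)) => x x1.
    have s0 : 0 <= beta / nu by apply: divr_ge0; exact: ltW.
    have s'0 : 0 <= betat / nut by apply: divr_ge0; exact: ltW.
    exact: corrs_dq Ul U'l s0 s'0 x1.
  + split; apply: lipschitz_onE => x y x1 y1; apply: (minle (_ \o _)).
    * rewrite -k1 [L1 * M1]mulrC; exact: (lip_comp M10 FpI lip_p1 lip_l1).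
    * rewrite -k2 [L2 * M2]mulrC; exact: (lip_comp M20 FpI lip_p2 lip_l2).
    * rewrite -k1; exact: (lip_comp L10 FlI lip_l1 lip_p1).
    * rewrite -k2; exact: (lip_comp L20 FlI lip_l2 lip_p2).
- have k2' : L2 * M2 <= 1 by rewrite k2.
  (* M2 is the partner of L2, with L2 M2 = c <= 1. Its strict version combines the complement of the
     first loss with [env'] of the second. *)
  have strict x y : -1 <= x -> x < y -> y <= 1 -> F_l y - F_l x < M2 * (y - x).
    move=> x1 xy y1; have [xI yI] := between x y x1 (ltW xy) y1.
    rewrite (FlE _ xI) (FlE _ yI) -mulrBr /M2 -[ltRHS]mulrA ltr_pM2l//.
    apply: (mix_slope_strict Hf Hg _ _ x1 xy y1).
      have [u [v uv]] := prox_nonconstant hell k0; exists u, v.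
      have e w : alpha / kappa / alpha * w = w / kappa by field; rewrite !gt_eqF.
      by rewrite !e.
    exact: env'_nonconstant hellt gt0 hsyst.
  exact: (coupled_fixed_point r1 L20 k2' Fl_bound Fp_bound (itv _ Fl_mono) (itv _ Fp_mono)
    lip_p2 strict).
Qed.
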